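(* Let $0<c<1$, let $1/2<\sigma_0<1$, let $N\ge0$ and $\underline{z}=(z_0,\dots,z_N)\in\mathbb{C}^{N+1}$. Then for every $\epsilon>0$ there exist a positive real number $\rho$ and a finite subset $\mathcal{E}\subset\mathcal{A}$, both depending on $c,\epsilon,\sigma_0,\underline{z}$, such that \[ \liminf_{T\to\infty}\frac{1}{T}\operatorname{meas}\Big\{\tau\in[0,T]\ \Big|\ \max_{0\le n\le N}|\zeta^{(n)}(\sigma_0+i\tau,\alpha)-z_n|<\epsilon\Big\}>0 \] for every $\alpha\in\mathcal{A}_\rho(c)\setminus\mathcal{E}$.
   Context: For $0<\alpha\le1$, $\zeta(s,\alpha)$ is the Hurwitz zeta-function ($\sum_{n\ge0}(n+\alpha)^{-s}$ for $\mathrm{Re}\, s>1$, continued meromorphically), and $\zeta^{(n)}(s,\alpha)$ is its $n$-th derivative in $s$. $\mathcal{A}=\{0<\alpha<1: \alpha \text{ algebraic and irrational}\}$, and for $0<c<1$, $\rho>0$, $\mathcal{A}_\rho(c)=\{\alpha\in\mathcal{A}: |\alpha-c|\le\rho\}$. $\operatorname{meas}$ is Lebesgue measure. *)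

(* Defs.v *)
From HB Require Import structures.
From mathcomp Require Export all_boot all_order all_algebra.
From mathcomp Require Export all_classical all_reals all_analysis.
From mathcomp Require Export complex.

Set Implicit Arguments.
Unset Strict Implicit.
Unset Printing Implicit Defensive.

Export Order.TTheory GRing.Theory Num.Theory.
Export numFieldNormedType.Exports.

Local Open Scope classical_set_scope.
Local Open Scope ring_scope.
Local Open Scope complex_scope.

Definition cexp (R : realType) (z : R[i]) : R[i] :=
  (expR (complex.Re z))%:C * (cos (complex.Im z) +i* sin (complex.Im z)).

(* [x ^ s] for [x > 0], with the real logarithm of [x]. *)
Definition cpow (R : realType) (x : R) (s : R[i]) : R[i] :=
  cexp (s * (ln x)%:C).

(* [F] is holomorphic on the half-plane [x < Re s] minus the point 1, and is
   given by the Dirichlet series for [1 < Re s].  Here [derivable _ s 1] is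
   complex differentiability: the scalar field is [R[i]]. *)
Definition hurwitz_continuation (R : realType) (a : R) (x : R)
    (F : R[i] -> R[i]) : Prop :=
  (forall s : R[i], x < complex.Re s -> s != 1 ->
     derivable (F : R[i]^o -> R[i]^o) s 1) /\
  (forall s : R[i], 1 < complex.Re s ->
     series (fun n : nat => cpow (n%:R + a) (- s)) @ \oo
       --> (F s : R[i]^o)).

(* The Hurwitz zeta-function [zeta(s, a)]: the value at [s] of the analytic
   continuation of the Dirichlet series to any punctured half-plane
   containing [s].  By the identity theorem the value does not depend on the
   half-plane, so on all of [C] minus the pole 1 this is the meromorphic
   continuation.  The value at [s = 1] is meaningless. *)
Definition hurwitz_zeta (R : realType) (a : R) (s : R[i]) : R[i] :=
  xget 0 [set w : R[i] | exists (x : R) (F : R[i] -> R[i]),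
    [/\ x < complex.Re s, hurwitz_continuation a x F & F s = w]].

Definition hurwitz_zeta_derive (R : realType) (n : nat) (a : R) (s : R[i])
    : R[i] :=
  derive1n n (fun u : R[i]^o => hurwitz_zeta a u : R[i]^o) s.

Definition calA (R : realType) : set R :=
  [set a : R | [/\ 0 < a < 1, algebraicOver (@ratr R) a
                 & irrational a]].

Definition calA_near (R : realType) (c rho : R) : set R :=
  [set a : R | calA a /\ `|a - c| <= rho].

(* Main.v *)
(* Let v_{n,j} = (- log (n + alpha))^j (n + alpha)^(- sigma0), so that formally
   zeta^(j)(sigma0 + i tau, alpha) = sum_n v_{n,j} e_n with phases
   e_n = (n + alpha)^(- i tau).  For T <= tau <= 2T the part n > T^g of this
   series, g slightly above 1, is negligible by a repeated Euler-Maclaurin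
   estimate, and the part M < n <= T^g has small mean square, because
   sum_n n^(- 2 sigma0) converges.  The part n <= M is steered by a weight
   w(tau) = prod_{n <= M} p_n(e_n), with p_n >= 0 a trigonometric polynomial of
   mean 1.  If no integer relation with small coefficients holds between the
   log (n + alpha), the e_n behave under w like independent variables with the
   densities p_n.  For n < M1 take p_n = |1 + e|^(2K) / C(2K, K), which
   concentrates e_n near 1; for n >= M1 take the Riesz factors
   p_n = 1 + Re (conj t_n e), whose total variance is a tail of
   sum_n n^(- 2 sigma0).  Since sum_n n^(- sigma0) diverges, a Vandermonde
   argument gives t_n with |t_n| <= 1 for which the w-mean of
   sum_n v_{n,j}(c) e_n is z_j for all j <= N.  By Chebyshev's inequality the
   weighted mass of the good tau is >> T, and w is bounded.  An alpha admitting a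
   relation is a root of one of finitely many nonzero polynomials. *)

Require Import Defs.
From mathcomp Require Import ring lra zify measurable_realfun.

Local Open Scope classical_set_scope.
Local Open Scope ring_scope.
Local Open Scope complex_scope.

Set Implicit Arguments.
Unset Strict Implicit.
Unset Printing Implicit Defensive.

(** The exceptional set has to be finite and fixed before alpha, so the argument may use only
    relations of bounded size. A weight of degree [K] in finitely many phases meets this demand: its
    second moments involve only exponents up to [2 (K + 1)], the extra 1 coming from the factors
    [e - mu] that are averaged. The middle sum contains more and more phases as T grows, and its
    correlation with the weight is out of control. There the weight is replaced by an upper bound
    [W], so the mean square of the middle sum must be small compared with [1 / W]. This would be
    circular if [W] grew with [M]. It does not: past the support of [t] every density is the
    constant 1, so [W] is fixed first and [M] is enlarged afterwards. The order of choice is [M1]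
    (tail variance), [K] (variance of the head), [t] (solved at the centre c), [W], [M], and last
    [rho], which keeps the coefficients of the finite sum close to those at c. Powers of logarithms,
    produced by the derivatives, are absorbed by lowering sigma0 to an exponent [sp] still above
    1/2. *)

Notation normC := ComplexField.Normc.normc.
Notation Re := complex.Re.
Notation Im := complex.Im.

(** * The modulus on the complex numbers *)

Section Norm.
Variable R : realType.
Implicit Types (x y z : R[i]) (r : R).

Lemma normC_ge0 z : 0 <= normC z.
Proof. by case: z => a b /=; exact: sqrtr_ge0. Qed.

Lemma normC0 : normC (0 : R[i]) = 0.
Proof. exact: ComplexField.Normc.normc0. Qed.

Lemma normC1 : normC (1 : R[i]) = 1.
Proof. exact: ComplexField.Normc.normc1. Qed.

Lemma normCM x y : normC (x * y) = normC x * normC y.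
Proof. exact: ComplexField.Normc.normcM. Qed.

Lemma normCV x : normC x^-1 = (normC x)^-1.
Proof. exact: ComplexField.Normc.normcV. Qed.

Lemma normCD x y : normC (x + y) <= normC x + normC y.
Proof. exact: le_normcD. Qed.

Lemma normCN x : normC (- x) = normC x.
Proof. exact: normcN. Qed.

Lemma normCB x y : normC (x - y) <= normC x + normC y.
Proof. by rewrite (le_trans (normCD _ _))// normCN. Qed.

Lemma normC_distC x y : normC (x - y) = normC (y - x).
Proof. by rewrite -normCN opprB. Qed.

Lemma normC_eq0 x : (normC x == 0) = (x == 0).
Proof.
apply/eqP/eqP => [/ComplexField.Normc.eq0_normc//|->]; exact: normC0.
Qed.

Lemma normC_gt0 x : (0 < normC x) = (x != 0).
Proof. by rewrite lt_neqAle normC_ge0 andbT eq_sym normC_eq0. Qed.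

Lemma normC_real r : normC r%:C = `|r|.
Proof. by rewrite /= expr0n addr0 sqrtr_sqr. Qed.

Lemma normC_norm z : `|z| = (normC z)%:C.
Proof. by rewrite normc_def; case: z. Qed.

Lemma sqr_normC z : normC z ^+ 2 = Re z ^+ 2 + Im z ^+ 2.
Proof. by case: z => a b /=; rewrite sqr_sqrtr// addr_ge0 ?sqr_ge0. Qed.

Lemma normC_Re z : `|Re z| <= normC z.
Proof.
case: z => a b /=; rewrite -sqrtr_sqr ler_wsqrtr//.
by rewrite lerDl sqr_ge0.
Qed.

Lemma normC_Im z : `|Im z| <= normC z.
Proof.
case: z => a b /=; rewrite -sqrtr_sqr ler_wsqrtr//.
by rewrite lerDr sqr_ge0.
Qed.

Lemma normC_le_ReIm z : normC z <= `|Re z| + `|Im z|.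
Proof.
rewrite -(@ler_pXn2r _ 2)// ?nnegrE ?normC_ge0 ?addr_ge0//.
have : 0 <= `|Re z| * `|Im z| by rewrite mulr_ge0.
have := real_normK (num_real (Re z)); have := real_normK (num_real (Im z)).
rewrite sqr_normC; nra.
Qed.

Definition cconj z : R[i] := Re z +i* (- Im z).

Lemma normC_conj z : normC (cconj z) = normC z.
Proof. by case: z => a b /=; rewrite sqrrN. Qed.

Lemma mul_conj z : z * cconj z = (normC z ^+ 2)%:C.
Proof.
rewrite sqr_normC; case: z => a b; rewrite /cconj /=; simpc; rewrite -!expr2 /real_complex_def.
by congr (_ +i* _); ring.
Qed.

Lemma normCX x n : normC (x ^+ n) = normC x ^+ n.
Proof. by elim: n => [|n IH]; rewrite ?expr0 ?normC1// !exprS normCM IH. Qed.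

Lemma ReD x y : Re (x + y) = Re x + Re y. Proof. by case: x; case: y. Qed.
Lemma ImD x y : Im (x + y) = Im x + Im y. Proof. by case: x; case: y. Qed.
Lemma ReN x : Re (- x) = - Re x. Proof. by case: x. Qed.
Lemma ImN x : Im (- x) = - Im x. Proof. by case: x. Qed.
Lemma ReM x y : Re (x * y) = Re x * Re y - Im x * Im y.
Proof. by case: x; case: y. Qed.
Lemma ImM x y : Im (x * y) = Re x * Im y + Im x * Re y.
Proof. by case: x => a b; case: y => c d; rewrite /= addrC. Qed.
Definition ReImE := (ReD, ImD, ReN, ImN, ReM, ImM).

Lemma eqC x y : Re x = Re y -> Im x = Im y -> x = y.
Proof. by case: x => a b; case: y => c d /= -> ->. Qed.

Lemma normC_sum I (s : seq I) (P : pred I) (F : I -> R[i]) :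
  normC (\sum_(i <- s | P i) F i) <= \sum_(i <- s | P i) normC (F i).
Proof.
elim/big_rec2 : _ => [|i a b _ ab]; first by rewrite normC0.
by rewrite (le_trans (normCD _ _))// lerD2l.
Qed.

Lemma lt_eps (a b : R) : (forall e, 0 < e -> a <= b + e) -> a <= b.
Proof. by move=> H; apply/ler_addgt0Pr => e e0; exact: H. Qed.

Lemma normC_eps0 z (K : R) : (forall e, 0 < e -> normC z <= K * e) -> z = 0.
Proof.
move=> H; apply/eqP; rewrite -normC_eq0; apply/eqP.
apply/eqP; rewrite eq_le normC_ge0 andbT; apply: lt_eps => e e0.
rewrite add0r (le_trans (H (e / (`|K| + 1)) _))//.
  by rewrite divr_gt0// ltr_wpDl.
rewrite mulrA ler_pdivrMr ?ltr_wpDl// mulrC ler_wpM2l ?ltW//.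
by rewrite (le_lt_trans (ler_norm _))// ltrDl.
Qed.

End Norm.

(** * Complex derivatives *)

Section Deriv.
Variable R : realType.
Notation C := R[i].

(** The difference quotient is multiplied out, so [h = 0] is allowed and the chain rule needs no
    case distinction on a vanishing inner increment. *)
Definition cderiv (f : C -> C) (s d : C) := forall e : R, 0 < e ->
  exists2 t : R, 0 < t &
    forall h, normC h < t -> normC (f (s + h) - f s - d * h) <= e * normC h.

Lemma real_diff_eps (f : R -> R) (x d : R) : is_derive x 1 f d ->
  forall e : R, 0 < e -> exists2 t : R, 0 < t &
    forall h, `|h| < t -> `|f (x + h) - f x - d * h| <= e * `|h|.
Proof.
move=> [df fd] e e0.
have /cvgrPdist_le/(_ e e0) : h^-1 *: ((f \o shift x) h - f x) @[h --> 0^'] --> d.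
  rewrite -fd; move: df; rewrite /derivable /derive.
  have -> : (fun h : R => h^-1 *: ((f \o shift x) (h *: 1%R) - f x))
     = (fun h => h^-1 *: ((f \o shift x) h - f x)).
    by apply/funext => h; rewrite /GRing.scale /= mulr1.
  done.
rewrite near_withinE => /nbhs_ballP[t /= t0 tP]; exists t => // h ht.
have [->|h0] := eqVneq h 0; first by rewrite addr0 subrr mulr0 subr0 normr0 mulr0.
have := tP h; rewrite /ball /= sub0r normrN => /(_ ht h0).
rewrite /GRing.scale /= => H.
rewrite -ler_pdivrMr ?normr_gt0// -normfV -normrM.
rewrite (le_trans _ H)// distrC le_eqVlt; apply/orP; left; apply/eqP; congr (`| _ |).
by rewrite (addrC h x); field.
Qed.

Lemma is_derive_eps (f : R -> R) (x d : R) :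
  (forall e : R, 0 < e -> exists2 t : R, 0 < t &
    forall h, `|h| < t -> `|f (x + h) - f x - d * h| <= e * `|h|) ->
  is_derive x 1 f d.
Proof.
move=> H.
have cv : (fun h : R => h^-1 *: ((f \o shift x) (h *: 1%R) - f x)) @ 0^' --> d.
  apply/cvgrPdist_le => e e0; have [t t0 tP] := H e e0.
  rewrite near_withinE; apply/nbhs_ballP; exists t => //= h.
  rewrite /ball /= sub0r normrN => ht h0.
  rewrite /GRing.scale /= mulr1 (addrC h x) distrC.
  rewrite -(@ler_pM2r _ `|h|) ?normr_gt0// -normrM (le_trans _ (tP h ht))//.
  rewrite le_eqVlt; apply/orP; left; apply/eqP; congr (`| _ |).
  by rewrite mulrBl mulrAC mulVf// mul1r.
apply: DeriveDef; first by apply/cvg_ex; exists d.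
exact: (cvg_lim _ cv).
Qed.

Lemma cderiv_derivable (f : C -> C) (s d : C) : cderiv f s d ->
  derivable (f : R[i]^o -> R[i]^o) s 1 /\ derive1 (f : R[i]^o -> R[i]^o) s = d.
Proof.
move=> H.
have cv : (fun h : C => h^-1 *: (f (h + s) - f s) : R[i]^o) @ (0 : R[i]^o)^' --> (d : R[i]^o).
  apply/cvgrPdist_le => e e0.
  have eR : e = (Re e)%:C by move/gtr0_real : e0 => /RRe_real.
  move: e0; rewrite eR ltcR => e0; have [t t0 tP] := H _ e0.
  rewrite near_withinE; apply/nbhs_ballP; exists t%:C; first by rewrite /= ltcR.
  move=> h; rewrite /ball /= sub0r normrN normC_norm ltcR => ht h0.
  rewrite distrC /GRing.scale /= normC_norm lecR.
  rewrite -(@ler_pM2r _ (normC h)) ?normC_gt0// -normCM (le_trans _ (tP h ht))//.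
  rewrite le_eqVlt; apply/orP; left; apply/eqP; congr (normC _).
  by rewrite (addrC h s) mulrBl mulrAC mulVf// mul1r.
split; last exact: (cvg_lim _ cv).
apply/cvg_ex; exists d => /=.
have -> // : (fun h : C => h^-1 *: (f (h *: (1 : R[i]^o) + s) - f s) : R[i]^o) =
   (fun h : C => h^-1 *: (f (h + s) - f s) : R[i]^o).
by apply/funext => h; rewrite [h *: _]/GRing.scale /= mulr1.
Qed.

Lemma derivable_cderiv (f : C -> C) (s : C) : derivable (f : R[i]^o -> R[i]^o) s 1 ->
  exists d, cderiv f s d.
Proof.
move=> /cvg_ex[/= d /cvgrPdist_le cv]; exists d => e e0.
have /cv : 0 < e%:C by rewrite ltcR.
rewrite near_withinE => /nbhs_ballP[t /= t0 tP].
have tR : t = (Re t)%:C by move/gtr0_real : t0 => /RRe_real.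
move: t0 tP; rewrite tR ltcR => t0 tP; exists (Re t) => // h ht.
have [->|h0] := eqVneq h 0; first by rewrite addr0 subrr mulr0 subr0 normC0 mulr0.
have := tP h; rewrite /ball /= sub0r normrN normC_norm ltcR => /(_ ht h0).
rewrite distrC /GRing.scale /= normC_norm lecR mulr1 => H.
rewrite -ler_pdivrMr ?normC_gt0// -normCV -normCM (le_trans _ H)//.
rewrite le_eqVlt; apply/orP; left; apply/eqP; congr (normC _).
by rewrite (addrC h s) mulrC; field.
Qed.

Lemma derive1_cderiv f s d : cderiv f s d ->
  derive1 (f : R[i]^o -> R[i]^o) s = d.
Proof. by move=> /cderiv_derivable[]. Qed.

Lemma cderiv_near f g s d : (exists2 t, 0 < t & forall u, normC (u - s) < t -> f u = g u) ->
  cderiv f s d -> cderiv g s d.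
Proof.
move=> [t t0 fg] H e e0; have [t' t'0 Ht'] := H e e0.
exists (Num.min t t'); first by rewrite lt_min t0 t'0.
move=> h; rewrite lt_min => /andP[ht ht'].
rewrite -!fg; first exact: Ht'.
  by rewrite subrr normC0.
by rewrite addrC addKr.
Qed.

Lemma cderiv_cont f s d : cderiv f s d -> forall e : R, 0 < e ->
  exists2 t : R, 0 < t & forall h, normC h < t -> normC (f (s + h) - f s) < e.
Proof.
move=> H e e0; have [t t0 tP] := H 1 ltr01.
have k0 : 0 < normC d + 1 by rewrite ltr_wpDl ?normC_ge0.
exists (Num.min t (e / (normC d + 1))); first by rewrite lt_min t0 divr_gt0.
move=> h; rewrite lt_min => /andP[ht]; rewrite ltr_pdivlMr// => he.
have := tP h ht; rewrite mul1r => H1.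
have -> : f (s + h) - f s = (f (s + h) - f s - d * h) + d * h by rewrite subrK.
rewrite (le_lt_trans (normCD _ _))// (le_lt_trans _ he)// normCM mulrDr mulr1 addrC.
by rewrite (mulrC (normC h)) lerD2l.
Qed.

Lemma cderiv_cst (k : C) s : cderiv (fun=> k) s 0.
Proof.
move=> e e0; exists 1 => // h _; rewrite subrr mul0r subr0 normC0.
by rewrite mulr_ge0 ?normC_ge0// ltW.
Qed.

Lemma cderiv_id s : cderiv id s 1.
Proof.
move=> e e0; exists 1 => // h _; rewrite mul1r (addrC s) addrK subrr normC0.
by rewrite mulr_ge0 ?normC_ge0// ltW.
Qed.

Lemma cderivD f g s a b : cderiv f s a -> cderiv g s b ->
  cderiv (fun u => f u + g u) s (a + b).
Proof.
move=> Hf Hg e e0.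
have e20 : 0 < e / 2 by rewrite divr_gt0.
have [t t0 tP] := Hf _ e20; have [u u0 uP] := Hg _ e20.
exists (Num.min t u); first by rewrite lt_min t0.
move=> h; rewrite lt_min => /andP[/tP h1 /uP h2].
have -> : f (s + h) + g (s + h) - (f s + g s) - (a + b) * h =
  (f (s + h) - f s - a * h) + (g (s + h) - g s - b * h) by ring.
rewrite (le_trans (normCD _ _))// (le_trans (lerD h1 h2))//.
by rewrite -mulrDl -splitr.
Qed.

Lemma cderiv_comp f g s a b : cderiv g s b -> cderiv f (g s) a ->
  cderiv (fun u => f (g u)) s (a * b).
Proof.
move=> Hg Hf e e0.
have kb : 0 < normC b + 1 by rewrite ltr_wpDl ?normC_ge0.
have ka : 0 < normC a + 1 by rewrite ltr_wpDl ?normC_ge0.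
pose e1 := e / 2 / (normC b + 1).
pose e2 := Num.min 1 (e / 2 / (normC a + 1)).
have e10 : 0 < e1 by rewrite !divr_gt0.
have e20 : 0 < e2 by rewrite lt_min ltr01 !divr_gt0.
have [t t0 tP] := Hf _ e10; have [u u0 uP] := Hg _ e20.
exists (Num.min u (t / (normC b + 1))); first by rewrite lt_min u0 divr_gt0.
move=> h; rewrite lt_min => /andP[/uP h1]; rewrite ltr_pdivlMr// => h2.
set k := g (s + h) - g s in h1.
have kE : g (s + h) = g s + k by rewrite /k; ring.
have kn : normC k <= normC h * (normC b + 1).
  have -> : k = (k - b * h) + b * h by rewrite subrK.
  rewrite (le_trans (normCD _ _))// mulrDr mulr1 addrC normCM mulrC lerD2l.
  rewrite (le_trans h1)// ler_piMl ?normC_ge0//.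
  by rewrite /e2 ge_min lexx.
have := tP k (le_lt_trans kn h2); rewrite kE => h3.
have -> : f (g s + k) - f (g s) - a * b * h =
   (f (g s + k) - f (g s) - a * k) + a * (k - b * h) by ring.
rewrite (le_trans (normCD _ _))// (splitr e) mulrDl lerD//.
  rewrite (le_trans h3)// (le_trans (ler_wpM2l (ltW e10) kn))//.
  by rewrite /e1 (mulrC (normC h)) mulrA divfK// lt0r_neq0.
rewrite normCM (le_trans (ler_wpM2l (normC_ge0 _) h1))//.
rewrite mulrA ler_wpM2r ?normC_ge0//.
apply: (@le_trans _ _ ((normC a + 1) * (e / 2 / (normC a + 1)))).
  by rewrite ler_pM ?normC_ge0 ?(ltW e20) ?lerDl// /e2 ge_min lexx orbT.
by rewrite mulrC divfK// lt0r_neq0.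
Qed.

Lemma cderivZ (k : C) f s a : cderiv f s a -> cderiv (fun u => k * f u) s (k * a).
Proof.
move=> H e e0; have kk : 0 < normC k + 1 by rewrite ltr_wpDl ?normC_ge0.
have [t t0 tP] := H (e / (normC k + 1)) (divr_gt0 e0 kk).
exists t => // h /tP h1.
rewrite -mulrA -!mulrBr normCM.
rewrite (le_trans (ler_wpM2l (normC_ge0 _) h1))// mulrA ler_wpM2r ?normC_ge0//.
by rewrite mulrA ler_pdivrMr// mulrC ler_wpM2l ?(ltW e0)// lerDl.
Qed.

Lemma cderivN f s a : cderiv f s a -> cderiv (fun u => - f u) s (- a).
Proof.
move=> /(cderivZ (-1)); rewrite mulN1r.
by congr cderiv; apply/funext => u; rewrite mulN1r.
Qed.

Lemma cderivB f g s a b : cderiv f s a -> cderiv g s b ->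
  cderiv (fun u => f u - g u) s (a - b).
Proof. by move=> Hf /cderivN; exact: cderivD. Qed.

Lemma cderiv_sqr s : cderiv (fun u => u * u) s (s + s).
Proof.
move=> e e0; exists e => // h he.
have -> : (s + h) * (s + h) - s * s - (s + s) * h = h * h by ring.
by rewrite normCM ler_wpM2r ?normC_ge0// ltW.
Qed.

(* The product rule follows from the chain rule for squaring by polarisation. *)
Lemma cderivM f g s a b : cderiv f s a -> cderiv g s b ->
  cderiv (fun u => f u * g u) s (a * g s + f s * b).
Proof.
move=> Hf Hg.
have H2 : (2 : C) != 0 by rewrite pnatr_eq0.
have S h c : cderiv h s c -> cderiv (fun u => h u * h u) s ((h s + h s) * c).
  move=> Hh; exact: (cderiv_comp Hh (cderiv_sqr _)).
have := cderivZ 2^-1 (cderivB (S _ _ (cderivD Hf Hg)) (cderivD (S _ _ Hf) (S _ _ Hg))).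
rewrite (_ : 2^-1 * _ = a * g s + f s * b); last by field.
by congr cderiv; apply/funext => u /=; field.
Qed.

Lemma cderivV s : s != 0 -> cderiv (fun u => u^-1) s (- s^-1 ^+ 2).
Proof.
move=> s0 e e0.
have n0 : 0 < normC s by rewrite normC_gt0.
exists (Num.min (normC s / 2) (e * normC s ^+ 3 / 2)).
  by rewrite lt_min !divr_gt0// mulr_gt0// exprn_gt0.
move=> h; rewrite lt_min => /andP[h1 h2].
have sh : normC s / 2 <= normC (s + h).
  have : normC s <= normC (s + h) + normC h.
    by rewrite -{1}(addrK h s) (le_trans (normCB _ _)).
  lra.
have sh0 : s + h != 0.
  by rewrite -normC_gt0 (lt_le_trans _ sh)// divr_gt0.
have -> : (s + h)^-1 - s^-1 - - s^-1 ^+ 2 * h = h * (h * (s + h)^-1 * s^-1 ^+ 2).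
  by field; rewrite s0 sh0.
rewrite normCM mulrC ler_wpM2r ?normC_ge0// normCM normCM normCX !normCV.
apply: (@le_trans _ _ ((e * normC s ^+ 3 / 2) * (normC s / 2)^-1 * (normC s)^-1 ^+ 2)).
  rewrite ler_pM ?mulr_ge0 ?exprn_ge0 ?invr_ge0 ?normC_ge0//.
  rewrite ler_pM ?invr_ge0 ?normC_ge0 ?(ltW h2)//.
  by rewrite lef_pV2 ?posrE ?divr_gt0// normC_gt0.
rewrite le_eqVlt; apply/orP; left; apply/eqP; field.
by rewrite lt0r_neq0.
Qed.

Lemma cderiv_sum I (r : seq I) (F : I -> C -> C) (D : I -> C) s :
  (forall i, cderiv (F i) s (D i)) ->
  cderiv (fun u => \sum_(i <- r) F i u) s (\sum_(i <- r) D i).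
Proof.
move=> H; elim: r => [|i r IH].
  rewrite big_nil; have := cderiv_cst 0 s; congr cderiv.
  by apply/funext => u; rewrite big_nil.
rewrite big_cons; have := cderivD (H i) IH; congr cderiv.
by apply/funext => u; rewrite big_cons.
Qed.

End Deriv.

(** * The complex exponential and powers of a positive base *)

Section Exp.
Variable R : realType.
Notation C := R[i].

Lemma cexpD (z w : C) : cexp (z + w) = cexp z * cexp w.
Proof.
rewrite /cexp ReD ImD expRD rmorphM /=; case: z => a b; case: w => c d /=.
rewrite cosD sinD; apply: eqC; rewrite !ReImE /=; ring.
Qed.

Lemma cexp0 : cexp (0 : C) = 1.
Proof. by rewrite /cexp /= expR0 cos0 sin0 mul1r. Qed.

Lemma cexp_neq0 (z : C) : cexp z != 0.
Proof.
apply/eqP => z0; have := cexpD z (- z); rewrite subrr cexp0 z0 mul0r.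
by move/eqP; rewrite oner_eq0.
Qed.

Lemma cexpN (z : C) : cexp (- z) = (cexp z)^-1.
Proof.
apply: (mulfI (cexp_neq0 z)); rewrite -cexpD subrr cexp0 mulfV//.
exact: cexp_neq0.
Qed.

Lemma normC_cexp (z : C) : normC (cexp z) = expR (Re z).
Proof.
rewrite /cexp normCM normC_real ger0_norm ?expR_ge0//.
by rewrite /= cos2Dsin2 sqrtr1 mulr1.
Qed.

Lemma cexp_real (x : R) : cexp x%:C = (expR x)%:C.
Proof. by rewrite /cexp /= cos0 sin0 mulr1. Qed.

Lemma cexp_conj (z : C) : cconj (cexp z) = cexp (cconj z).
Proof. by case: z => a b; rewrite /cexp /cconj /= cosN sinN; apply: eqC => /=; ring. Qed.

Lemma cderiv_cexp (s : C) : cderiv (@cexp R) s (cexp s).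
Proof.
(* The functional equation [cexpD] moves the question to the origin. *)
suff H0 : cderiv (@cexp R) 0 1.
  have Hs : cderiv (fun u : C => u - s) s 1.
    by have := cderivB (cderiv_id s) (cderiv_cst s s); rewrite subr0.
  have := @cderiv_comp _ (@cexp R) (fun u => u - s) s 1 1 Hs.
  rewrite subrr => /(_ H0) /(cderivZ (cexp s)); rewrite !mulr1.
  by congr cderiv; apply/funext => u; rewrite -cexpD addrC subrK.
move=> e e0.
(* Since [expR x <= 2] near 0, the real and the imaginary part each collect three errors of size
   [e / 8 * normC h]. *)
have e80 : 0 < e / 8 by rewrite divr_gt0.
have [t1 t10 H1] := real_diff_eps (@is_derive_expR R 0) e80.
have [t2 t20 H2] := real_diff_eps (@is_derive_cos R 0) e80.
have [t3 t30 H3] := real_diff_eps (@is_derive_sin R 0) e80.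
have [t4 t40 H4] : exists2 t : R, 0 < t & forall x, `|x| < t -> `|expR x - 1| <= Num.min 1 (e/8).
  have d0 : 0 < Num.min 1 (e / 8) by rewrite lt_min ltr01.
  have [t t0 tP] := real_diff_eps (@is_derive_expR R 0) (@ltr01 R).
  exists (Num.min t (Num.min 1 (e / 8) / 2)); first by rewrite lt_min t0 divr_gt0.
  move=> x; rewrite lt_min => /andP[/tP]; rewrite add0r expR0 !mul1r => h1 h2.
  have : `|expR x - 1| <= `|expR x - 1 - x| + `|x|.
    by rewrite -{1}(subrK x (expR x - 1)) (le_trans (ler_normD _ _)).
  move: (Num.min 1 (e / 8)) h1 h2 => m; lra.
exists (Num.min (Num.min t1 t2) (Num.min t3 t4)).
  by rewrite !lt_min t10 t20 t30 t40.
move=> h; rewrite !lt_min => /andP[/andP[ht1 ht2] /andP[ht3 ht4]].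
have hR := normC_Re h; have hI := normC_Im h.
move: (H1 (Re h) (le_lt_trans hR ht1)) (H2 (Im h) (le_lt_trans hI ht2))
  (H3 (Im h) (le_lt_trans hI ht3)) (H4 (Re h) (le_lt_trans hR ht4)).
rewrite !add0r expR0 cos0 sin0 mul1r oppr0 mul0r !subr0 mul1r.
set x := Re h; set y := Im h => h1 h2; rewrite ?addr0 => h3; rewrite le_min => /andP[h4 h5].
have ex2 : `|expR x| <= 2.
  have : `|expR x| <= `|expR x - 1| + `|1| by rewrite -{1}(subrK 1 (expR x)) (le_trans (ler_normD _ _)).
  by rewrite normr1; lra.
have yh : `|y| <= normC h by [].
have xh : `|x| <= normC h by [].
rewrite cexp0 mul1r (le_trans (normC_le_ReIm _))// !ReImE /= !mul0r subr0 addr0 oppr0 addr0 -/x -/y.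
have -> : expR x * cos y - 1 - x = (expR x - 1 - x) + expR x * (cos y - 1) by ring.
have -> : expR x * sin y - y = expR x * (sin y - y) + (expR x - 1) * y by ring.
have A1 : `|expR x - 1 - x + expR x * (cos y - 1)| <= e / 8 * normC h + 2 * (e / 8 * normC h).
  rewrite (le_trans (ler_normD _ _))// lerD//.
    by rewrite (le_trans h1)// ler_wpM2l// ltW.
  rewrite normrM ler_pM// (le_trans h2)// ler_wpM2l// ltW//.
have A2 : `|expR x * (sin y - y) + (expR x - 1) * y| <= 2 * (e / 8 * normC h) + e / 8 * normC h.
  rewrite (le_trans (ler_normD _ _))// lerD// normrM ler_pM//.
  by rewrite (le_trans h3)// ler_wpM2l// ltW.
have := normC_ge0 h; nra.
Qed.

Lemma cderiv_cpow (x : R) (s : C) :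
  cderiv (fun u => cpow x (- u)) s (- (ln x)%:C * cpow x (- s)).
Proof.
have L : cderiv (fun u : C => - u * (ln x)%:C) s (- (ln x)%:C).
  have := cderivZ (- (ln x)%:C) (cderiv_id s); rewrite mulr1.
  by congr cderiv; apply/funext => u /=; rewrite mulNr mulrC mulNr.
by have := cderiv_comp L (cderiv_cexp _); rewrite mulrC.
Qed.

Lemma cpowD (x : R) (s w : C) : cpow x (s + w) = cpow x s * cpow x w.
Proof. by rewrite /cpow mulrDl cexpD. Qed.

Lemma cpow1 (x : R) : 0 < x -> cpow x 1 = x%:C.
Proof. by move=> x0; rewrite /cpow mul1r cexp_real lnK. Qed.

Lemma normC_cpow (x : R) (s : C) : normC (cpow x s) = expR (Re s * ln x).
Proof. by rewrite /cpow normC_cexp ReM /= mulr0 subr0. Qed.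

End Exp.

#[global] Arguments ComplexField.Normc.normc : simpl never.

(** * Integrals of complex-valued functions *)

Section Integral.
Variable R : realType.
Notation C := R[i].
Notation mu := (@lebesgue_measure R).

Definition Int (a b : R) (g : R -> R) : R := (\int[mu]_(x in `[a, b]) g x)%R.

(** Continuity is two-sided also at the end points, so the one-sided limits asked for by the
    fundamental theorem come for free. *)
Definition contab (a b : R) (g : R -> R) := forall t, a <= t <= b -> {for t, continuous g}.

Lemma contab_within a b g : contab a b g -> {within `[a, b], continuous g}.
Proof.
move=> H; apply: continuous_in_subspaceT => t.
by rewrite inE /= in_itv /=; exact: H.
Qed.

Lemma contab_integrable a b g : contab a b g -> mu.-integrable `[a, b] (EFin \o g).
Proof.
move=> H; apply: continuous_compact_integrable; first exact: segment_compact.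
exact: contab_within.
Qed.

Lemma contabD a b f g : contab a b f -> contab a b g -> contab a b (fun t => f t + g t).
Proof. by move=> Hf Hg t tab; apply: cvgD; [exact: Hf|exact: Hg]. Qed.

Lemma contabM a b f g : contab a b f -> contab a b g -> contab a b (fun t => f t * g t).
Proof. by move=> Hf Hg t tab; apply: cvgM; [exact: Hf|exact: Hg]. Qed.

Lemma contabN a b f : contab a b f -> contab a b (fun t => - f t).
Proof. by move=> Hf t tab; apply: cvgN; exact: Hf. Qed.

Lemma contab_cst a b k : contab a b (fun=> k).
Proof. by move=> t _; exact: cvg_cst. Qed.

Lemma contab_sqrt a b f : contab a b f -> contab a b (fun t => Num.sqrt (f t)).
Proof.
move=> Hf t tab; apply: (@continuous_comp _ _ _ f (@Num.sqrt R)); first exact: Hf.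
exact: sqrt_continuous.
Qed.

Lemma IntD a b f g : contab a b f -> contab a b g ->
  Int a b (fun t => f t + g t) = Int a b f + Int a b g.
Proof.
move=> Hf Hg; rewrite /Int RintegralD//; exact: contab_integrable.
Qed.

Lemma IntZ a b k f : contab a b f -> Int a b (fun t => k * f t) = k * Int a b f.
Proof. by move=> Hf; rewrite /Int RintegralZl//; exact: contab_integrable. Qed.

Lemma Int_le a b f g : contab a b f -> contab a b g ->
  (forall t, a <= t <= b -> f t <= g t) -> Int a b f <= Int a b g.
Proof.
move=> Hf Hg fg; apply: le_Rintegral => //; exact: contab_integrable.
Qed.

Lemma eq_Int a b f g : (forall t, a <= t <= b -> f t = g t) -> Int a b f = Int a b g.
Proof. by move=> fg; apply: eq_Rintegral => x; rewrite inE /= in_itv /=; exact: fg. Qed.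

Lemma Int_cst a b k : a <= b -> Int a b (fun=> k) = k * (b - a).
Proof.
move=> ab; rewrite /Int Rintegral_cst//= lebesgue_measure_itv /= lte_fin.
case: ltP => //= ba; have -> : a = b by apply/eqP; rewrite eq_le ab.
by rewrite subrr.
Qed.

Lemma Int_split a m b f : a <= m -> m <= b -> contab a b f ->
  Int a b f = Int a m f + Int m b f.
Proof.
move=> am mb H; apply/eqP; rewrite addrC -subr_eq; apply/eqP.
rewrite /Int Rintegral_itvB ?bnd_simp//; last exact: contab_integrable.
rewrite Rintegral_itv_obnd_cbnd//; apply: integrableS (contab_integrable H) => //.
by move=> x /=; rewrite !in_itv /= => /andP[mx ->]; rewrite (le_trans am) ?ltW.
Qed.

Lemma Int_FTC a b f F : a <= b -> contab a b f ->
  (forall t, a <= t <= b -> is_derive t 1 F (f t)) -> Int a b f = F b - F a.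
Proof.
rewrite le_eqVlt => /predU1P[->|ab] cf dF.
  by rewrite subrr /Int set_itv1 Rintegral_set1.
have cF t : a <= t <= b -> {for t, continuous F}.
  move=> /dF [df _]; exact/differentiable_continuous/derivable1_diffP.
have aab : a <= a <= b by rewrite lexx ltW.
have bab : a <= b <= b by rewrite lexx ltW.
rewrite /Int /Rintegral (@continuous_FTC2 _ f F)//; first exact: contab_within.
  split.
  - by move=> x; rewrite in_itv /= => /andP[ax xb]; have [] := dF x; rewrite ?(ltW ax) ?(ltW xb).
  - by apply: cvg_at_right_filter; exact: cF.
  - by apply: cvg_at_left_filter; exact: cF.
move=> x; rewrite in_itv /= => /andP[ax xb].
have xab : a <= x <= b by rewrite !ltW.
by rewrite derive1E; have [_ ->] := dF x xab.
Qed.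

Definition ccont (f : R -> C) (t : R) :=
  {for t, continuous (fun u => Re (f u))} /\ {for t, continuous (fun u => Im (f u))}.

Definition ccontab a b (f : R -> C) := forall t, a <= t <= b -> ccont f t.

Definition cint a b (f : R -> C) : C :=
  Int a b (fun t => Re (f t)) +i* Int a b (fun t => Im (f t)).

Lemma ccontRe a b f : ccontab a b f -> contab a b (fun t => Re (f t)).
Proof. by move=> H t /H[]. Qed.

Lemma ccontIm a b f : ccontab a b f -> contab a b (fun t => Im (f t)).
Proof. by move=> H t /H[]. Qed.

Lemma ccontP a b (f : R -> C) : contab a b (fun t => Re (f t)) ->
  contab a b (fun t => Im (f t)) -> ccontab a b f.
Proof. by move=> H1 H2 t tab; split; [exact: H1|exact: H2]. Qed.

Lemma contab_eq a b f g : f =1 g -> contab a b f -> contab a b g.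
Proof. by move=> /funext ->. Qed.

Lemma ccontD a b f g : ccontab a b f -> ccontab a b g -> ccontab a b (fun t => f t + g t).
Proof.
move=> Hf Hg; apply: ccontP.
  apply: contab_eq (contabD (ccontRe Hf) (ccontRe Hg)) => t; by rewrite ReD.
apply: contab_eq (contabD (ccontIm Hf) (ccontIm Hg)) => t; by rewrite ImD.
Qed.

Lemma ccont_cst a b (k : C) : ccontab a b (fun=> k).
Proof. by apply: ccontP; exact: contab_cst. Qed.

Lemma ccontM a b f g : ccontab a b f -> ccontab a b g -> ccontab a b (fun t => f t * g t).
Proof.
move=> Hf Hg; apply: ccontP.
  apply: contab_eq (contabD (contabM (ccontRe Hf) (ccontRe Hg))
    (contabN (contabM (ccontIm Hf) (ccontIm Hg)))) => t; by rewrite ReM.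
apply: contab_eq (contabD (contabM (ccontRe Hf) (ccontIm Hg))
    (contabM (ccontIm Hf) (ccontRe Hg))) => t; by rewrite ImM.
Qed.

Lemma ccontZ a b (k : C) g : ccontab a b g -> ccontab a b (fun t => k * g t).
Proof. by move=> H; apply: ccontM => //; exact: ccont_cst. Qed.

Lemma ccont_sum a b I (s : seq I) (F : I -> R -> C) :
  (forall i, ccontab a b (F i)) -> ccontab a b (fun t => \sum_(i <- s) F i t).
Proof.
move=> H; elim: s => [|i s IH].
  have -> : (fun t => \sum_(i <- [::]) F i t) = (fun=> 0) by apply/funext => t; rewrite big_nil.
  exact: ccont_cst.
have -> : (fun t => \sum_(j <- i :: s) F j t) = (fun t => F i t + \sum_(j <- s) F j t).
  by apply/funext => t; rewrite big_cons.
exact: ccontD.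
Qed.

Lemma ccont_prod a b I (s : seq I) (F : I -> R -> C) :
  (forall i, ccontab a b (F i)) -> ccontab a b (fun t => \prod_(i <- s) F i t).
Proof.
move=> H; elim: s => [|i s IH].
  have -> : (fun t => \prod_(i <- [::]) F i t) = (fun=> 1) by apply/funext => t; rewrite big_nil.
  exact: ccont_cst.
have -> : (fun t => \prod_(j <- i :: s) F j t) = (fun t => F i t * \prod_(j <- s) F j t).
  by apply/funext => t; rewrite big_cons.
exact: ccontM.
Qed.

Lemma ccont_conj a b f : ccontab a b f -> ccontab a b (fun t => (cconj (f t))).
Proof.
move=> H; apply: ccontP.
  by apply: contab_eq (ccontRe H) => t; case: (f t).
by apply: contab_eq (contabN (ccontIm H)) => t; case: (f t).
Qed.

Lemma ccont_norm a b f : ccontab a b f -> contab a b (fun t => normC (f t)).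
Proof.
move=> H; apply: contab_eq (contab_sqrt (contabD (contabM (ccontRe H) (ccontRe H))
   (contabM (ccontIm H) (ccontIm H)))) => t.
by rewrite -!expr2 -sqr_normC sqrtr_sqr ger0_norm// normC_ge0.
Qed.

Lemma cintD a b f g : ccontab a b f -> ccontab a b g ->
  cint a b (fun t => f t + g t) = cint a b f + cint a b g.
Proof.
move=> Hf Hg; rewrite /cint; apply: eqC => /=.
  rewrite -IntD; [|exact: ccontRe..]; by apply: eq_Int => t _; rewrite ReD.
rewrite -IntD; [|exact: ccontIm..]; by apply: eq_Int => t _; rewrite ImD.
Qed.

Lemma cintZ a b (k : C) f : ccontab a b f -> cint a b (fun t => k * f t) = k * cint a b f.
Proof.
move=> Hf; have cR := ccontRe Hf; have cI := ccontIm Hf.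
have cN r g : contab a b g -> contab a b (fun t => r * g t).
  by apply: contabM; exact: contab_cst.
rewrite /cint; apply: eqC; rewrite ?ReM ?ImM /=.
  rewrite -mulNr -!IntZ// -IntD; [|exact: cN..].
  by apply: eq_Int => t _; rewrite ReM mulNr.
by rewrite -!IntZ// -IntD; [|exact: cN..]; apply: eq_Int => t _; rewrite ImM.
Qed.

Lemma cintN a b f : ccontab a b f -> cint a b (fun t => - f t) = - cint a b f.
Proof.
move=> H; rewrite -mulN1r -cintZ//; congr cint; by apply/funext => t; rewrite mulN1r.
Qed.

Lemma ccontN a b f : ccontab a b f -> ccontab a b (fun t => - f t).
Proof.
by move=> /(ccontZ (-1)); congr ccontab; apply/funext => t; rewrite mulN1r.
Qed.

Lemma ccontB a b f g : ccontab a b f -> ccontab a b g -> ccontab a b (fun t => f t - g t).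
Proof. by move=> Hf Hg; apply: ccontD => //; exact: ccontN. Qed.

Lemma cintB a b f g : ccontab a b f -> ccontab a b g ->
  cint a b (fun t => f t - g t) = cint a b f - cint a b g.
Proof. by move=> Hf Hg; rewrite cintD ?cintN//; exact: ccontN. Qed.

Lemma eq_cint a b f g : (forall t, a <= t <= b -> f t = g t) -> cint a b f = cint a b g.
Proof. by move=> fg; congr (_ +i* _); apply: eq_Int => t /fg ->. Qed.

Lemma cint_cst a b (k : C) : a <= b -> cint a b (fun=> k) = k * (b - a)%:C.
Proof.
move=> ab; rewrite /cint !Int_cst//; apply: eqC; rewrite ?ReM ?ImM /=; ring.
Qed.

Lemma cint_split a m b f : a <= m -> m <= b -> ccontab a b f ->
  cint a b f = cint a m f + cint m b f.
Proof.
move=> am mb H; rewrite /cint (Int_split am mb (ccontRe H)) (Int_split am mb (ccontIm H)).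
by apply: eqC.
Qed.

(** Rotation by [cconj I]: [normC I ^+ 2] is the integral of [Re (cconj I * f t)], whose integrand
    is at most [normC I * normC (f t)]. *)
Lemma cint_norm a b f : ccontab a b f -> normC (cint a b f) <= Int a b (fun t => normC (f t)).
Proof.
move=> H; set I := cint a b f.
have [->|I0] := eqVneq I 0.
  rewrite normC0; have <- : Int a b (fun=> 0) = 0.
    have [ab|ba] := leP a b; first by rewrite Int_cst ?mul0r.
    by rewrite /Int set_itv_ge ?bnd_simp -?ltNge// Rintegral_set0.
  apply: Int_le => [||t _]; [exact: contab_cst|exact: ccont_norm|exact: normC_ge0].
have nI : 0 < normC I by rewrite normC_gt0.
rewrite -(ler_pM2l nI) -expr2.
have -> : normC I ^+ 2 = Re (cconj I * I) by rewrite mulrC mul_conj.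
rewrite /I -cintZ// -/I /= -IntZ; last exact: ccont_norm.
apply: Int_le.
- by apply: ccontRe; exact: ccontZ.
- by apply: contabM; [exact: contab_cst|exact: ccont_norm].
- move=> t _; rewrite (le_trans (ler_norm _))// (le_trans (normC_Re _))//.
  by rewrite normCM normC_conj.
Qed.

Lemma cint_bound a b f (M : R) : a <= b -> ccontab a b f ->
  (forall t, a <= t <= b -> normC (f t) <= M) -> normC (cint a b f) <= M * (b - a).
Proof.
move=> ab H fM; rewrite (le_trans (cint_norm H))// -(Int_cst _ ab).
by apply: Int_le => //; [exact: ccont_norm|exact: contab_cst].
Qed.

Lemma cint_FTC a b (f F : R -> C) : a <= b -> ccontab a b f ->
  (forall t, a <= t <= b -> is_derive t 1 (fun u => Re (F u)) (Re (f t)) /\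
                            is_derive t 1 (fun u => Im (F u)) (Im (f t))) ->
  cint a b f = F b - F a.
Proof.
move=> ab H dF; rewrite /cint; apply: eqC; rewrite !ReImE /=.
  apply: (@Int_FTC a b _ (fun u => Re (F u))) => //; first exact: ccontRe.
  by move=> t /dF[].
apply: (@Int_FTC a b _ (fun u => Im (F u))) => //; first exact: ccontIm.
by move=> t /dF[].
Qed.

Lemma cint_sum a b I (s : seq I) (F : I -> R -> C) : (forall i, ccontab a b (F i)) ->
  cint a b (fun t => \sum_(i <- s) F i t) = \sum_(i <- s) cint a b (F i).
Proof.
move=> H; elim: s => [|i s IH].
  rewrite big_nil -[RHS](mul0r (cint a b (fun=> 1))) -cintZ; last exact: ccont_cst.
  by apply: eq_cint => t _; rewrite big_nil mul0r.
rewrite big_cons -IH -cintD//; last exact: ccont_sum.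
by apply: eq_cint => t _; rewrite big_cons.
Qed.

Lemma cderiv_path (f : C -> C) (p v d : C) (t : R) : cderiv f (p + t%:C * v) d ->
  is_derive t 1 (fun u => Re (f (p + u%:C * v))) (Re (d * v)) /\
  is_derive t 1 (fun u => Im (f (p + u%:C * v))) (Im (d * v)).
Proof.
move=> H.
have K (e : R) : 0 < e -> exists2 x : R, 0 < x & forall h : R, `|h| < x ->
   normC (f (p + (t + h)%:C * v) - f (p + t%:C * v) - (d * v) * h%:C) <= e * `|h|.
  move=> e0; have k0 : 0 < normC v + 1 by rewrite ltr_wpDl ?normC_ge0.
  have [x x0 xP] := H _ (divr_gt0 e0 k0).
  exists (x / (normC v + 1)); first by rewrite divr_gt0.
  move=> h; rewrite ltr_pdivlMr// => hx.
  have hv : normC (h%:C * v) <= `|h| * (normC v + 1).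
    by rewrite normCM normC_real ler_wpM2l// lerDl.
  have := xP _ (le_lt_trans hv hx).
  have -> : p + (t + h)%:C * v = p + t%:C * v + h%:C * v by rewrite rmorphD /=; ring.
  have -> : d * v * h%:C = d * (h%:C * v) by ring.
  move=> /le_trans; apply; rewrite (le_trans (ler_wpM2l _ hv)) ?(ltW (divr_gt0 _ _))//.
  by rewrite mulrCA -mulrA mulVf ?mulr1 1?mulrC// lt0r_neq0.
split; apply: is_derive_eps => e /K [x x0 xP]; exists x => // h /xP.
  apply: le_trans; apply: le_trans (normC_Re _).
  by rewrite !ReD !ReN [Re (_ * h%:C)]ReM /= mulr0 subr0.
apply: le_trans; apply: le_trans (normC_Im _).
by rewrite !ImD !ImN [Im (_ * h%:C)]ImM /= mulr0 add0r.
Qed.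

Lemma cderiv_path_cont (f : C -> C) (p v d : C) (t : R) : cderiv f (p + t%:C * v) d ->
  ccont (fun u => f (p + u%:C * v)) t.
Proof.
move=> /cderiv_path[[d1 _] [d2 _]].
by split; apply/differentiable_continuous/derivable1_diffP.
Qed.

Lemma cint_deriv_path (F f : C -> C) (p v : C) a b : a <= b ->
  (forall t, a <= t <= b -> cderiv F (p + t%:C * v) (f (p + t%:C * v))) ->
  ccontab a b (fun t => f (p + t%:C * v)) ->
  cint a b (fun t => f (p + t%:C * v) * v) = F (p + b%:C * v) - F (p + a%:C * v).
Proof.
move=> ab dF cf.
apply: (@cint_FTC a b (fun t => f (p + t%:C * v) * v) (fun t => F (p + t%:C * v))) => //.
  by apply: ccontM => //; exact: ccont_cst.
by move=> t /dF /cderiv_path.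
Qed.

End Integral.

(** * Cauchy's theorem *)

Section Goursat.
Variable R : realType.
Notation C := R[i].
Implicit Types (h : C -> C) (a b c d : R).

(** Counterclockwise contour integral around the rectangle with horizontal sides over [[a, b]] at
    heights [c] and [d]. *)
Definition bdry h a b c d : C :=
  cint a b (fun x => h (x +i* c)) - cint a b (fun x => h (x +i* d)) +
  'i * (cint c d (fun y => h (b +i* y)) - cint c d (fun y => h (a +i* y))).

Definition holrect h a b c d :=
  forall x y, a <= x <= b -> c <= y <= d -> exists D, cderiv h (x +i* y) D.

Lemma holrectS h a b c d a' b' c' d' : a <= a' -> b' <= b -> c <= c' -> d' <= d ->
  holrect h a b c d -> holrect h a' b' c' d'.
Proof.
move=> aa bb cc dd H x y /andP[ax xb] /andP[cy yd].
by apply: H; rewrite ?(le_trans aa ax) ?(le_trans xb) ?(le_trans cc cy) ?(le_trans yd).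
Qed.

Lemma horizE (x y : R) : x +i* y = (0 +i* y) + x%:C * 1.
Proof. by rewrite mulr1; simpc. Qed.

Lemma vertE (x y : R) : x +i* y = (x +i* 0) + y%:C * 'i.
Proof. by simpc. Qed.

Lemma horiz_cont h a b c d y : holrect h a b c d -> c <= y <= d ->
  ccontab a b (fun x => h (x +i* y)).
Proof.
move=> H yd t tab; have [D] := H t y tab yd; rewrite horizE => /cderiv_path_cont.
by congr ccont; apply/funext => u; rewrite -horizE.
Qed.

Lemma vert_cont h a b c d x : holrect h a b c d -> a <= x <= b ->
  ccontab c d (fun y => h (x +i* y)).
Proof.
move=> H xd t tab; have [D] := H x t xd tab; rewrite vertE => /cderiv_path_cont.
by congr ccont; apply/funext => u; rewrite -vertE.
Qed.

Lemma bdry_splitx h a m b c d : a <= m -> m <= b -> c <= d -> holrect h a b c d ->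
  bdry h a b c d = bdry h a m c d + bdry h m b c d.
Proof.
move=> am mb cd H; rewrite /bdry !(cint_split am mb).
- by ring.
- by apply: horiz_cont H _; rewrite lexx cd.
- by apply: horiz_cont H _; rewrite lexx cd.
Qed.

Lemma bdry_splity h a b c m d : c <= m -> m <= d -> a <= b -> holrect h a b c d ->
  bdry h a b c d = bdry h a b c m + bdry h a b m d.
Proof.
move=> am mb cd H; rewrite /bdry !(cint_split am mb).
- by ring.
- by apply: vert_cont H _; rewrite lexx cd.
- by apply: vert_cont H _; rewrite lexx cd.
Qed.

Lemma bdry_deriv (F f : C -> C) a b c d : a <= b -> c <= d ->
  (forall z, cderiv F z (f z)) -> holrect f a b c d -> bdry f a b c d = 0.
Proof.
move=> ab cd dF Hf.
have hz y : c <= y <= d -> cint a b (fun x => f (x +i* y)) = F (b +i* y) - F (a +i* y).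
  move=> yd; rewrite (horizE b) (horizE a) -(@cint_deriv_path _ F f)//.
    by apply: eq_cint => t _; rewrite -horizE mulr1.
  have := horiz_cont Hf yd; congr ccontab; apply/funext => t; by rewrite -horizE.
have vt x : a <= x <= b -> cint c d (fun y => f (x +i* y)) * 'i = F (x +i* d) - F (x +i* c).
  move=> xd; have cv := vert_cont Hf xd.
  rewrite (vertE x d) (vertE x c) -(@cint_deriv_path _ F f)//.
    by rewrite mulrC -cintZ//; apply: eq_cint => t _; rewrite -vertE mulrC.
  by move: cv; congr ccontab; apply/funext => t; rewrite -vertE.
rewrite /bdry mulrC mulrBl !hz ?vt ?lexx ?ab ?cd//; ring.
Qed.

(** An affine function has a primitive, so subtracting it leaves the contour integral unchanged;
    what remains is at most [e] times the perimeter. *)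
Lemma bdry_small h a b c d (al be : C) (e : R) : a <= b -> c <= d ->
  holrect h a b c d ->
  (forall x y, a <= x <= b -> c <= y <= d ->
    normC (h (x +i* y) - (al + be * (x +i* y))) <= e) ->
  normC (bdry h a b c d) <= e * (2 * ((b - a) + (d - c))).
Proof.
move=> ab cd H He.
pose l := fun z : C => al + be * z.
have dl z : cderiv l z be.
  have := cderivD (cderiv_cst al z) (cderivZ be (cderiv_id z)).
  by rewrite add0r mulr1.
pose F := fun z : C => al * z + be / 2 * (z * z).
have dF z : cderiv F z (l z).
  have := cderivD (cderivZ al (cderiv_id z)) (cderivZ (be / 2) (cderiv_sqr z)).
  by congr cderiv; rewrite /l mulr1; field.
have Hl : holrect l a b c d by move=> x y _ _; exists be.
have l0 := bdry_deriv ab cd dF Hl.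
have aa : a <= a <= b by rewrite lexx.
have bb : a <= b <= b by rewrite lexx ab.
have cc : c <= c <= d by rewrite lexx.
have dd : c <= d <= d by rewrite lexx cd.
have E : bdry h a b c d =
  cint a b (fun x => h (x +i* c) - l (x +i* c)) - cint a b (fun x => h (x +i* d) - l (x +i* d)) +
  'i * (cint c d (fun y => h (b +i* y) - l (b +i* y)) - cint c d (fun y => h (a +i* y) - l (a +i* y))).
  rewrite -[LHS]subr0 -l0 /bdry !cintB; first (by ring); solve [exact: (vert_cont H)|exact: (vert_cont Hl)|exact: (horiz_cont H)|exact: (horiz_cont Hl)].
have Bh y : c <= y <= d -> normC (cint a b (fun x => h (x +i* y) - l (x +i* y))) <= e * (b - a).
  move=> yd; apply: cint_bound => //; last by move=> t tab; exact: He.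
  by apply: ccontB; [exact: (horiz_cont H)|exact: (horiz_cont Hl)].
have Bv x : a <= x <= b -> normC (cint c d (fun y => h (x +i* y) - l (x +i* y))) <= e * (d - c).
  move=> yd; apply: cint_bound => //; last by move=> t tab; exact: He.
  by apply: ccontB; [exact: (vert_cont H)|exact: (vert_cont Hl)].
rewrite E (le_trans (normCD _ _))// normCM.
have -> : normC ('i : C) = 1 by rewrite /ComplexField.Normc.normc expr0n add0r expr1n sqrtr1.
rewrite mul1r.
have T (A B C' D : C) (x y : R) : normC A <= x -> normC B <= x -> normC C' <= y ->
  normC D <= y -> normC (A - B) + normC (C' - D) <= 2 * x + 2 * y.
  by move=> ? ? ? ?; have := normCB A B; have := normCB C' D; lra.
rewrite (_ : e * _ = 2 * (e * (b - a)) + 2 * (e * (d - c))); last by ring.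
apply: T; [exact: Bh|exact: Bh|exact: Bv|exact: Bv].
Qed.

Lemma half_pow_small (K t : R) : 0 < t -> exists n : nat, K / 2 ^+ n < t.
Proof.
move=> t0; have [n Kn] : exists n : nat, `|K| / t < n%:R.
  by exists (Num.bound (`|K| / t)); rewrite archi_boundP// divr_ge0// ltW.
exists n; rewrite ltr_pdivrMr ?exprn_gt0//.
rewrite (le_lt_trans (ler_norm K))//; move: Kn; rewrite ltr_pdivrMr// => /lt_le_trans; apply.
by rewrite mulrC ler_wpM2l ?(ltW t0)// -natrX ler_nat ltnW// ltn_expl.
Qed.

Section bisection.
Variables (h : C -> C) (a c w k : R).

(** Goursat's bisection, recording the lower left corner of the rectangle of stage [n], with sides
    [w / 2 ^+ n] and [k / 2 ^+ n]. The upper right quarter is the default; [gbd_step] shows that it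
    carries a fourth of the integral when the other three fail to. *)
Fixpoint gseq n : R * R := if n is m.+1 then
  let: (x, y) := gseq m in
  let w' := w / 2 ^+ n in let k' := k / 2 ^+ n in
  let B := normC (bdry h x (x + w' + w') y (y + k' + k')) in
  if B <= 4 * normC (bdry h x (x + w') y (y + k')) then (x, y) else
  if B <= 4 * normC (bdry h (x + w') (x + w' + w') y (y + k')) then (x + w', y) else
  if B <= 4 * normC (bdry h x (x + w') (y + k') (y + k' + k')) then (x, y + k') else
  (x + w', y + k')
  else (a, c).

Definition gbd n := bdry h (gseq n).1 ((gseq n).1 + w / 2 ^+ n) (gseq n).2 ((gseq n).2 + k / 2 ^+ n).

Hypotheses (w0 : 0 <= w) (k0 : 0 <= k).
Hypothesis Hh : holrect h a (a + w) c (c + k).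

Lemma gseq_step n : (gseq n).1 <= (gseq n.+1).1 /\ (gseq n).2 <= (gseq n.+1).2 /\
  (gseq n.+1).1 + w / 2 ^+ n.+1 <= (gseq n).1 + w / 2 ^+ n /\
  (gseq n.+1).2 + k / 2 ^+ n.+1 <= (gseq n).2 + k / 2 ^+ n.
Proof.
have E (u : R) : u / 2 ^+ n = u / 2 ^+ n.+1 + u / 2 ^+ n.+1.
  by rewrite exprS; field; rewrite expf_neq0.
rewrite /=; case: (gseq n) => x y; rewrite [w / 2 ^+ n]E [k / 2 ^+ n]E.
have w1 : 0 <= w / 2 ^+ n.+1 by rewrite divr_ge0// exprn_ge0.
have k1 : 0 <= k / 2 ^+ n.+1 by rewrite divr_ge0// exprn_ge0.
move: (w / 2 ^+ n.+1) (k / 2 ^+ n.+1) w1 k1 => w' k' w1 k1.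
by case: ifP => _; [|case: ifP => _; [|case: ifP => _]] => /=; repeat split; lra.
Qed.

Lemma gseq_mono n m : (n <= m)%N -> (gseq n).1 <= (gseq m).1 /\ (gseq n).2 <= (gseq m).2 /\
  (gseq m).1 + w / 2 ^+ m <= (gseq n).1 + w / 2 ^+ n /\
  (gseq m).2 + k / 2 ^+ m <= (gseq n).2 + k / 2 ^+ n.
Proof.
elim: m => [|m IH]; first by rewrite leqn0 => /eqP ->.
rewrite leq_eqVlt => /predU1P[->//|]; rewrite ltnS => /IH[h1 [h2 [h3 h4]]].
have [g1 [g2 [g3 g4]]] := gseq_step m.
by split; [exact: le_trans h1 g1|split; [exact: le_trans h2 g2|
  split; [exact: le_trans g3 h3|exact: le_trans g4 h4]]].
Qed.

Lemma gbd_step n : normC (gbd n) <= 4 * normC (gbd n.+1).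
Proof.
have [h1 [h2 [h3 h4]]] := gseq_mono (leq0n n); rewrite expr0 !divr1 /= in h1 h2 h3 h4.
have E (u : R) : u / 2 ^+ n = u / 2 ^+ n.+1 + u / 2 ^+ n.+1.
  by rewrite exprS; field; rewrite expf_neq0.
rewrite /gbd /=; case: (gseq n) h1 h2 h3 h4 => x y /= h1 h2; rewrite [w / 2 ^+ n]E [k / 2 ^+ n]E.
have w1 : 0 <= w / 2 ^+ n.+1 by rewrite divr_ge0// exprn_ge0.
have k1 : 0 <= k / 2 ^+ n.+1 by rewrite divr_ge0// exprn_ge0.
move: (w / 2 ^+ n.+1) (k / 2 ^+ n.+1) w1 k1 => w' k' w1 k1 h3 h4; rewrite !addrA in h3 h4 *.
have Hr : holrect h x (x + w' + w') y (y + k' + k') by apply: holrectS Hh.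
have S : bdry h x (x + w' + w') y (y + k' + k') =
  bdry h x (x + w') y (y + k') + bdry h x (x + w') (y + k') (y + k' + k') +
  (bdry h (x + w') (x + w' + w') y (y + k') + bdry h (x + w') (x + w' + w') (y + k') (y + k' + k')).
  rewrite (@bdry_splitx h x (x + w')) ?lerDl//; last by lra.
  rewrite (@bdry_splity h x (x + w') y (y + k')) ?lerDl//; last by apply: holrectS Hr; lra.
  by rewrite (@bdry_splity h (x + w') (x + w' + w') y (y + k')) ?lerDl//; apply: holrectS Hr; lra.
case: ifPn => //; rewrite -ltNge => A1; case: ifPn => //; rewrite -ltNge => A2.
case: ifPn => //; rewrite -ltNge => A3 /=.
move: A1 A2 A3; rewrite S; set B1 := bdry h x (x + w') y (y + k').
set B2 := bdry h x (x + w') _ _; set B3 := bdry h _ _ y _; set B4 := bdry h (x + w') _ (y + k') _.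
have := normCD (B1 + B2) (B3 + B4); have := normCD B1 B2; have := normCD B3 B4.
lra.
Qed.

Lemma gbd_pow n : normC (bdry h a (a + w) c (c + k)) <= 4 ^+ n * normC (gbd n).
Proof.
elim: n => [|n IH]; first by rewrite expr0 mul1r /gbd /= expr0 !divr1.
rewrite (le_trans IH)// exprSr -mulrA ler_wpM2l ?exprn_ge0//; exact: gbd_step.
Qed.

(** At the common point of the nested rectangles [h] is affine up to [e] times the diameter.
    Multiplied by the perimeter this is of order [e / 4 ^+ n], which cancels the factor [4 ^+ n]
    lost in [gbd_pow]. *)
Lemma goursat_aux : bdry h a (a + w) c (c + k) = 0.
Proof.
(* The suprema of the corner coordinates give a point lying in all the nested rectangles. *)
pose px := sup [set x | exists n, x = (gseq n).1].
pose py := sup [set x | exists n, x = (gseq n).2].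
have Bx n m : (gseq n).1 <= (gseq m).1 + w / 2 ^+ m.
  have [h1 _] := gseq_mono (leq_maxl n m); rewrite (le_trans h1)//.
  have [_ [_ [h3 _]]] := gseq_mono (leq_maxr n m); rewrite (le_trans _ h3)//.
  by rewrite lerDl divr_ge0// exprn_ge0.
have By n m : (gseq n).2 <= (gseq m).2 + k / 2 ^+ m.
  have [_ [h1 _]] := gseq_mono (leq_maxl n m); rewrite (le_trans h1)//.
  have [_ [_ [_ h3]]] := gseq_mono (leq_maxr n m); rewrite (le_trans _ h3)//.
  by rewrite lerDl divr_ge0// exprn_ge0.
have Px n : (gseq n).1 <= px <= (gseq n).1 + w / 2 ^+ n.
  apply/andP; split.
    apply: ub_le_sup; last by exists n.
    by exists ((gseq n).1 + w / 2 ^+ n) => _ [m ->].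
  by apply: ge_sup; [exists (gseq 0).1; exists 0%N|move=> _ [m ->]].
have Py n : (gseq n).2 <= py <= (gseq n).2 + k / 2 ^+ n.
  apply/andP; split.
    apply: ub_le_sup; last by exists n.
    by exists ((gseq n).2 + k / 2 ^+ n) => _ [m ->].
  by apply: ge_sup; [exists (gseq 0).2; exists 0%N|move=> _ [m ->]].
have := Px 0%N; have := Py 0%N; rewrite /= expr0 !divr1 => py0 px0.
have [D HD] := Hh px0 py0.
apply: (@normC_eps0 _ _ (2 * (w + k) ^+ 2)) => e e0.
have [t t0 tP] := HD e e0.
have [n nP] := half_pow_small (w + k) t0.
have n4 : (0 : R) < 2 ^+ n by rewrite exprn_gt0.
rewrite (le_trans (gbd_pow n))//.
have wn : 0 <= w / 2 ^+ n by rewrite divr_ge0// exprn_ge0.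
have kn : 0 <= k / 2 ^+ n by rewrite divr_ge0// exprn_ge0.
have [h1 [h2 [h3 h4]]] := gseq_mono (leq0n n); rewrite expr0 !divr1 /= in h1 h2 h3 h4.
have : normC (gbd n) <= e * ((w + k) / 2 ^+ n) * (2 * ((gseq n).1 + w / 2 ^+ n - (gseq n).1 + ((gseq n).2 + k / 2 ^+ n - (gseq n).2))).
  apply: (@bdry_small _ _ _ _ _ (h (px +i* py) - D * (px +i* py)) D); rewrite ?lerDl//.
    exact: holrectS Hh.
  move=> x y xb yb.
  pose u := (x - px) +i* (y - py) : C.
  have zE : x +i* y = (px +i* py) + u by rewrite /u; simpc; rewrite !(addrC px) !(addrC py) !subrK.
  have un : normC u <= (w + k) / 2 ^+ n.
    rewrite (le_trans (normC_le_ReIm _))//= mulrDl lerD// ler_norml.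
      by have := Px n; move: xb => /andP[? ?] /andP[? ?]; apply/andP; split; lra.
    by have := Py n; move: yb => /andP[? ?] /andP[? ?]; apply/andP; split; lra.
  have := tP u (le_lt_trans un nP); rewrite -zE => H1.
  have -> : h (x +i* y) - (h (px +i* py) - D * (px +i* py) + D * (x +i* y)) =
    h (x +i* y) - h (px +i* py) - D * u by rewrite zE; ring.
  by rewrite (le_trans H1)// ler_wpM2l// ltW.
move=> H; have p4 : (0 : R) <= 4 ^+ n by rewrite exprn_ge0.
rewrite (le_trans (ler_wpM2l p4 H))// le_eqVlt; apply/orP; left; apply/eqP.
have -> : (4 : R) = 2 * 2 by ring.
by rewrite exprMn; field; rewrite lt0r_neq0.
Qed.

End bisection.

Lemma goursat h a b c d : a <= b -> c <= d -> holrect h a b c d -> bdry h a b c d = 0.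
Proof.
move=> ab cd H; have := @goursat_aux h a c (b - a) (d - c).
by rewrite !subr_ge0 !(addrC _ (_ - _)) !subrK; exact.
Qed.

End Goursat.

(** * Circle means, Cauchy estimates and the identity theorem on a disc *)

Section Circle.
Variable R : realType.
Notation C := R[i].
Implicit Types (f g : C -> C) (a b p q s : C) (r : R).

Definition holat f s := exists D, cderiv f s D.
(* Locked, so that unification never unfolds the limit. *)
Fact cD_key : unit. Proof. exact: tt. Qed.
Definition cD f : C -> C := locked_with cD_key (derive1 (f : R[i]^o -> R[i]^o)).
Definition ccont_at f s := forall e : R, 0 < e ->
  exists2 t : R, 0 < t & forall h, normC h < t -> normC (f (s + h) - f s) < e.

Lemma cDE f s : cD f s = derive1 (f : R[i]^o -> R[i]^o) s.
Proof. by rewrite /cD unlock. Qed.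

Lemma cDP f s : holat f s -> cderiv f s (cD f s).
Proof. by move=> [D HD]; rewrite cDE (derive1_cderiv HD). Qed.

Lemma cD_eq f s D : cderiv f s D -> cD f s = D.
Proof. by rewrite cDE; exact: derive1_cderiv. Qed.

Lemma holat_cont f s : holat f s -> ccont_at f s.
Proof. by move=> [D HD] e e0; exact: cderiv_cont HD e e0. Qed.

Lemma two_pi_ge0 : 0 <= 2 * pi :> R.
Proof. by rewrite mulr_ge0// pi_ge0. Qed.

Lemma two_pi_gt0 : 0 < 2 * pi :> R.
Proof. by rewrite mulr_gt0// pi_gt0. Qed.

Lemma cint_bound_2pi (F : R -> C) (M : R) : ccontab 0 (2 * pi) F ->
  (forall y, normC (F y) <= M) -> normC (cint 0 (2 * pi) F) <= M * (2 * pi).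
Proof.
move=> cF FM; have := cint_bound two_pi_ge0 cF (fun y _ => FM y).
by rewrite subr0.
Qed.

(** Written through [cexp], so that an annulus is the image of a rectangle in the logarithmic
    variable and concentric circles are the images of its vertical sides. *)
Definition cpt a r (y : R) : C := a + cexp (ln r +i* y).

(** This is [2 * pi] times the mean of [f] over the circle, that is, the contour integral of
    [f s / (s - a)] divided by ['i]. *)
Definition circ f a r : C := cint 0 (2 * pi) (fun y => f (cpt a r y)).

Lemma cptB a r y : cpt a r y - a = cexp (ln r +i* y).
Proof. by rewrite /cpt addrC addKr. Qed.

Lemma normC_cpt a r y : 0 < r -> normC (cpt a r y - a) = r.
Proof. by move=> r0; rewrite cptB normC_cexp lnK. Qed.

Lemma ccont_eps (F : R -> C) (t : R) :
  (forall e : R, 0 < e -> exists2 d : R, 0 < d &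
     forall h, `|h| < d -> normC (F (t + h) - F t) < e) -> ccont F t.
Proof.
move=> H; split; apply/cvgrPdist_lt => e e0; have [d d0 dP] := H e e0.
  apply/nbhs_ballP; exists d => //= u; rewrite /ball /= distrC => ud.
  rewrite distrC (le_lt_trans _ (dP _ ud))// (le_trans _ (normC_Re _))//.
  by rewrite ReD ReN (addrC t) subrK.
apply/nbhs_ballP; exists d => //= u; rewrite /ball /= distrC => ud.
rewrite distrC (le_lt_trans _ (dP _ ud))// (le_trans _ (normC_Im _))//.
by rewrite ImD ImN (addrC t) subrK.
Qed.

Lemma circ_cont f a r c d : (forall y, ccont_at f (cpt a r y)) ->
  ccontab c d (fun y => f (cpt a r y)).
Proof.
move=> H y _; apply: ccont_eps => e e0.
have [t t0 tP] := H y e e0.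
have [x x0 xP] := cderiv_cont (cderiv_cexp (ln r +i* y)) t0.
exists x => // h hx.
have := xP (0 +i* h); rewrite (_ : normC (0 +i* h) = `|h|); last first.
  by rewrite /ComplexField.Normc.normc expr0n add0r sqrtr_sqr.
move=> /(_ hx)/tP; congr (normC (f _ - _) < e).
rewrite /cpt (_ : ln r +i* (y + h) = ln r +i* y + (0 +i* h)); first by ring.
by simpc.
Qed.

(** By periodicity the two horizontal sides cancel in Goursat's theorem. *)
Lemma periodic_vert g A B : A <= B -> holrect g A B 0 (2 * pi) ->
  (forall x : R, g (x +i* (2 * pi)) = g (x +i* 0)) ->
  cint 0 (2 * pi) (fun y => g (A +i* y)) = cint 0 (2 * pi) (fun y => g (B +i* y)).
Proof.
move=> AB Hg per; have := goursat AB two_pi_ge0 Hg.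
rewrite /bdry (_ : cint A B (fun x => g (x +i* (2 * pi))) = cint A B (fun x => g (x +i* 0))); last first.
  by apply: eq_cint => t _.
rewrite subrr add0r => /eqP; rewrite mulf_eq0 => /orP[|].
  by rewrite eq_complex /= oner_eq0 andbF.
by rewrite subr_eq0 => /eqP.
Qed.

Lemma cexp_2pi (x : R) : cexp (x +i* (2 * pi)) = cexp (x +i* 0).
Proof. by rewrite /cexp /= mulr_natl cos2pi sin2pi cos0 sin0. Qed.

Lemma holat_comp f g s : holat g s -> holat f (g s) -> holat (fun u => f (g u)) s.
Proof. by move=> [D HD] [D' HD']; exists (D' * D); exact: cderiv_comp. Qed.

Lemma holat_cexpD a s : holat (fun u => a + cexp u) s.
Proof. by eexists; apply: cderivD; [exact: cderiv_cst|exact: cderiv_cexp]. Qed.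

Lemma circ_indep f a r1 r2 : 0 < r1 -> r1 <= r2 ->
  (forall s, r1 <= normC (s - a) <= r2 -> holat f s) -> circ f a r1 = circ f a r2.
Proof.
move=> r10 r12 H; have r20 : 0 < r2 by exact: lt_le_trans r12.
apply: (@periodic_vert (fun w => f (a + cexp w))).
- by rewrite ler_ln.
- move=> x y /andP[x1 x2] _; apply: holat_comp; first exact: holat_cexpD.
  apply: H; rewrite (addrC a) addrK normC_cexp /=.
  by rewrite -(lnK r10) -(lnK r20) !ler_expR x1 x2.
- by move=> x; rewrite cexp_2pi.
Qed.

(** The mean value property, by shrinking the radius. At the centre only continuity is assumed, so
    it applies to difference quotients before they are known to be differentiable there. *)
Lemma circ_center f a r : 0 < r -> ccont_at f a ->
  (forall s, 0 < normC (s - a) <= r -> holat f s) -> circ f a r = f a * (2 * pi)%:C.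
Proof.
move=> r0 ca H; apply/eqP; rewrite -subr_eq0; apply/eqP.
apply: (@normC_eps0 _ _ (2 * pi)) => e e0.
have [t t0 tP] := ca e e0.
pose r1 := Num.min r (t / 2).
have r10 : 0 < r1 by rewrite lt_min r0 divr_gt0.
have r1r : r1 <= r by rewrite ge_min lexx.
have r1t : r1 < t by rewrite gt_min; apply/orP; right; rewrite ltr_pdivrMr// mulr_natr mulr2n ltrDl.
rewrite -(circ_indep r10 r1r); last first.
  by move=> s /andP[s1 s2]; apply: H; rewrite (lt_le_trans r10 s1).
have cc : ccontab 0 (2 * pi) (fun y => f (cpt a r1 y)).
  apply: circ_cont => y; apply: holat_cont; apply: H.
  by rewrite normC_cpt// r10.
have -> : f a * (2 * pi)%:C = cint 0 (2 * pi) (fun=> f a).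
  by rewrite cint_cst ?two_pi_ge0// subr0.
rewrite /circ -cintB//; last exact: ccont_cst.
rewrite [leRHS]mulrC; apply: cint_bound_2pi.
  by apply: ccontB => //; exact: ccont_cst.
move=> y; apply: ltW.
have := tP (cpt a r1 y - a); rewrite normC_cpt// => /(_ r1t).
by rewrite (addrC a) subrK.
Qed.

(** The real mean value theorem for [Re (cconj w * f)] along the segment, with [w = f q - f p]. *)
Lemma cmvi f p q (M : R) :
  (forall t : R, 0 <= t <= 1 -> exists2 D, cderiv f (p + t%:C * (q - p)) D & normC D <= M) ->
  normC (f q - f p) <= M * normC (q - p).
Proof.
move=> H; set w := f q - f p.
have [->|w0] := eqVneq w 0.
  rewrite normC0 mulr_ge0 ?normC_ge0//.
  by have [|D _] := H 0; rewrite ?lexx ?ler01//; apply: le_trans; exact: normC_ge0.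
pose phi (t : R) := Re (cconj w * f (p + t%:C * (q - p))).
have dphi (t : R) : 0 <= t <= 1 -> is_derive t 1 phi (Re (cconj w * cD f (p + t%:C * (q - p)) * (q - p))).
  move=> /H[D HD _]; have := cderivZ (cconj w) HD => /cderiv_path[].
  by rewrite (cD_eq HD).
have [||x] := @MVT R phi (fun t => Re (cconj w * cD f (p + t%:C * (q - p)) * (q - p))) 0 1 ltr01.
- by move=> x; rewrite in_itv /= => /andP[? ?]; apply: dphi; rewrite !ltW.
- apply: contab_within => t /dphi[d _]; exact/differentiable_continuous/derivable1_diffP.
rewrite in_itv /= => /andP[x0 x1].
have x01 : 0 <= x <= 1 by rewrite !ltW.
have -> : phi 1 - phi 0 = Re (cconj w * w).
  by rewrite /phi rmorph1 rmorph0 mul1r mul0r addr0 (addrC p) subrK /w !ReImE; ring.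
rewrite subr0 mulr1 mulrC mul_conj /= => E.
have [D HD DM] := H _ x01.
rewrite (cD_eq HD) in E.
have w1 : 0 < normC w by rewrite normC_gt0.
rewrite -(ler_pM2l w1) -expr2 E (le_trans (ler_norm _))// (le_trans (normC_Re _))//.
rewrite !normCM normC_conj -mulrA ler_wpM2l ?normC_ge0// ler_wpM2r ?normC_ge0//.
Qed.

Definition holdisc f a r := forall s, normC (s - a) <= r -> holat f s.

Definition dquot f a s : C := if s == a then cD f a else (f s - f a) / (s - a).

Lemma dquot_cont f a : holat f a -> ccont_at (dquot f a) a.
Proof.
move=> /cDP H e e0; have e20 : 0 < e / 2 by rewrite divr_gt0.
have [t t0 tP] := H _ e20; exists t => // h ht; rewrite /dquot eqxx.
have [->|h0] := eqVneq h 0; first by rewrite addr0 eqxx subrr normC0.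
rewrite -subr_eq0 (addrC a) addrK (negPf h0).
have n0 : 0 < normC h by rewrite normC_gt0.
rewrite -(ltr_pM2r n0) -normCM mulrBl divfK//.
rewrite (addrC h) (le_lt_trans (tP _ ht))// ltr_pM2r// ltr_pdivrMr// mulr_natr mulr2n.
by rewrite ltrDl.
Qed.

Lemma holatB f g s : holat f s -> holat g s -> holat (fun u => f u - g u) s.
Proof. by move=> [D HD] [D' HD']; eexists; exact: cderivB HD HD'. Qed.

Lemma holatM f g s : holat f s -> holat g s -> holat (fun u => f u * g u) s.
Proof. by move=> [D HD] [D' HD']; eexists; exact: cderivM HD HD'. Qed.

Lemma holat_cst (k : C) s : holat (fun=> k) s.
Proof. by eexists; exact: cderiv_cst. Qed.

Lemma holat_id s : holat id s.
Proof. by eexists; exact: cderiv_id. Qed.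

Lemma holatV f s : holat f s -> f s != 0 -> holat (fun u => (f u)^-1) s.
Proof.
by move=> [D HD] fs; eexists; exact: (cderiv_comp HD (cderivV fs)).
Qed.

Lemma holatX f s n : holat f s -> holat (fun u => f u ^+ n) s.
Proof.
move=> H; elim: n => [|n IH].
  have -> : (fun u => f u ^+ 0) = (fun=> 1) by apply/funext => u; rewrite expr0.
  exact: holat_cst.
have -> : (fun u => f u ^+ n.+1) = (fun u => f u * f u ^+ n) by apply/funext => u; rewrite exprS.
exact: holatM.
Qed.

Lemma holat_near f g s : (exists2 t, 0 < t & forall u, normC (u - s) < t -> f u = g u) ->
  holat f s -> holat g s.
Proof. by move=> H [D HD]; exists D; exact: cderiv_near HD. Qed.

Lemma dquot_hol f a s : s != a -> holat f s -> holat (dquot f a) s.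
Proof.
move=> sa H; apply: (@holat_near (fun u => (f u - f a) / (u - a))).
  exists (normC (s - a)); first by rewrite normC_gt0 subr_eq0.
  move=> u us; rewrite /dquot; case: eqP => // ua.
  by move: us; rewrite ua normC_distC ltxx.
apply: holatM; first by apply: holatB => //; exact: holat_cst.
apply: (@holatV (fun u => u - a)); last by rewrite subr_eq0.
by apply: holatB; [exact: holat_id|exact: holat_cst].
Qed.

(** Cauchy's formula for the derivative, read as the mean value property of the difference quotient,
    whose value at the centre is [cD f a]. *)
Lemma cauchy_deriv f a r : 0 < r -> holdisc f a r ->
  circ (dquot f a) a r = cD f a * (2 * pi)%:C.
Proof.
move=> r0 H; have -> : cD f a = dquot f a a by rewrite /dquot eqxx.
apply: circ_center => //.
  by apply: dquot_cont; apply: H; rewrite subrr normC0 ltW.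
move=> s /andP[s0 sr]; apply: dquot_hol; last exact: H.
by rewrite -subr_eq0 -normC_gt0.
Qed.

Lemma ccontab_dquot f a r c d : 0 < r -> holdisc f a r ->
  ccontab c d (fun y => dquot f a (cpt a r y)).
Proof.
move=> r0 H; apply: circ_cont => y; apply: holat_cont.
apply: dquot_hol; last by apply: H; rewrite normC_cpt.
by rewrite -subr_eq0 -normC_gt0 normC_cpt.
Qed.

Lemma dquot_cpt f a r y : 0 < r ->
  dquot f a (cpt a r y) = (f (cpt a r y) - f a) / cexp (ln r +i* y).
Proof.
move=> r0; rewrite /dquot -subr_eq0 -normC_eq0 normC_cpt// gt_eqF//.
by rewrite cptB.
Qed.

Lemma holdiscS f a r b r' : normC (b - a) + r' <= r -> holdisc f a r -> holdisc f b r'.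
Proof.
move=> h H s sb; apply: H; rewrite (le_trans _ h)//.
have -> : s - a = (b - a) + (s - b) by ring.
by rewrite (le_trans (normCD _ _))// lerD2l.
Qed.

Lemma twopiC_gt0 : 0 < normC ((2 * pi)%:C : C).
Proof. by rewrite normC_real gtr0_norm two_pi_gt0. Qed.

Lemma cauchy_bound f a r (M : R) : 0 < r -> holdisc f a r ->
  (forall s, normC (s - a) <= r -> normC (f s) <= M) -> normC (cD f a) <= 2 * M / r.
Proof.
move=> r0 H fM; rewrite -(ler_pM2r twopiC_gt0) -normCM -(cauchy_deriv r0 H).
rewrite normC_real (gtr0_norm two_pi_gt0).
apply: cint_bound_2pi; [exact: ccontab_dquot|move=> y].
rewrite dquot_cpt// normCM normCV normC_cexp /= lnK//.
rewrite ler_pM2r ?invr_gt0//.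
rewrite (le_trans (normCB _ _))// mulr_natl mulr2n lerD// fM//.
  by rewrite normC_cpt.
by rewrite subrr normC0 ltW.
Qed.

(** Compare Cauchy's formulas on circles of equal radius [r / 4] about [a] and [b]. The two
    increments of [f] in the numerator are each at most [4 * M / r * normC (b - a)], and division by
    [r / 4] produces the 32. *)
Lemma cD_lipschitz f a r (M : R) b : 0 < r -> holdisc f a r ->
  (forall s, normC (s - a) <= r -> normC (f s) <= M) ->
  normC (b - a) <= r / 4 -> normC (cD f b - cD f a) <= 32 * M / r ^+ 2 * normC (b - a).
Proof.
move=> r0 H fM ba.
have r40 : 0 < r / 4 by rewrite divr_gt0.
have Hb : holdisc f b (r / 4) by apply: holdiscS H; lra.
have Ha : holdisc f a (r / 4) by apply: holdiscS H; rewrite subrr normC0; lra.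
rewrite -(ler_pM2r twopiC_gt0) -normCM.
have -> : (cD f b - cD f a) * (2 * pi)%:C = circ (dquot f b) b (r / 4) - circ (dquot f a) a (r / 4).
  have aux (u v w u' v' : C) : u' = u * w -> v' = v * w -> (u - v) * w = u' - v'.
    by move=> -> ->; ring.
  exact: aux (cauchy_deriv r40 Hb) (cauchy_deriv r40 Ha).
rewrite /circ -cintB; [|exact: ccontab_dquot..].
rewrite normC_real (gtr0_norm two_pi_gt0).
have B2 c : normC (c - a) <= r / 2 -> normC (cD f c) <= 4 * M / r.
  move=> ca; have r20 : 0 < r / 2 by rewrite divr_gt0.
  apply: (@le_trans _ _ (2 * M / (r / 2))).
    apply: cauchy_bound => //; first by apply: holdiscS H; lra.
    move=> s sc; apply: fM; have -> : s - a = (c - a) + (s - c) by ring.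
    by rewrite (le_trans (normCD _ _))//; lra.
  rewrite le_eqVlt; apply/orP; left; apply/eqP; field; exact: lt0r_neq0.
have L c : normC (c - a) <= r / 4 -> normC (f (c + (b - a)) - f c) <= 4 * M / r * normC (b - a).
  move=> ca; have := @cmvi f c (c + (b - a)) (4 * M / r).
  rewrite [c + _ - c]addrC addKr; apply=> t /andP[t0 t1].
  have d : normC (c + t%:C * (b - a) - a) <= r / 2.
    have -> : c + t%:C * (b - a) - a = (c - a) + t%:C * (b - a) by ring.
    rewrite (le_trans (normCD _ _))// normCM normC_real ger0_norm//.
    by have := normC_ge0 (b - a); nra.
  exists (cD f (c + t%:C * (b - a))); last exact: B2.
  apply: cDP; apply: H; lra.
apply: cint_bound_2pi; [by apply: ccontB; exact: ccontab_dquot|move=> y].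
rewrite !dquot_cpt// -mulrBl normCM normCV normC_cexp /= lnK//.
rewrite ler_pdivrMr//.
have -> : f (cpt b (r / 4) y) - f b - (f (cpt a (r / 4) y) - f a) =
  (f (cpt a (r / 4) y + (b - a)) - f (cpt a (r / 4) y)) - (f (a + (b - a)) - f a).
  have -> : cpt a (r / 4) y + (b - a) = cpt b (r / 4) y by rewrite /cpt; ring.
  by rewrite (addrC a) subrK; ring.
rewrite (le_trans (normCB _ _))//.
have -> : 32 * M / r ^+ 2 * normC (b - a) * (r / 4) =
   4 * M / r * normC (b - a) + 4 * M / r * normC (b - a).
  by field; exact: lt0r_neq0.
rewrite lerD//; apply: L; first by rewrite normC_cpt.
by rewrite subrr normC0 ltW.
Qed.

(** The mean value inequality for [f s - cD f a * s], whose derivative is small by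
    [cD_lipschitz]. *)
Lemma taylor2 f a r (M : R) h : 0 < r -> holdisc f a r ->
  (forall s, normC (s - a) <= r -> normC (f s) <= M) ->
  normC h <= r / 4 -> normC (f (a + h) - f a - cD f a * h) <= 32 * M / r ^+ 2 * normC h ^+ 2.
Proof.
move=> r0 H fM hr.
have M0 : 0 <= M by rewrite (le_trans (normC_ge0 _) (fM a _))// subrr normC0 ltW.
have K0 : 0 <= 32 * M / r ^+ 2 by rewrite divr_ge0 ?sqr_ge0//; exact: mulr_ge0.
have := @cmvi (fun s => f s - cD f a * s) a (a + h) (32 * M / r ^+ 2 * normC h).
rewrite [a + h - a]addrC addKr => L.
have -> : f (a + h) - f a - cD f a * h = f (a + h) - cD f a * (a + h) - (f a - cD f a * a) by ring.
rewrite expr2 mulrA; apply: L => t /andP[t0 t1].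
have d : normC (a + t%:C * h - a) <= normC h.
  by rewrite [a + _ - a]addrC addKr normCM normC_real ger0_norm// ler_piMl// normC_ge0.
exists (cD f (a + t%:C * h) - cD f a).
  have := cderivZ (cD f a) (cderiv_id (a + t%:C * h)); rewrite mulr1.
  apply: cderivB; apply: cDP; apply: H; lra.
rewrite (le_trans (cD_lipschitz r0 H fM _))//; first lra.
by rewrite ler_wpM2l.
Qed.

Lemma hol_bounded f a r : 0 < r -> holdisc f a r -> exists r' M, [/\ 0 < r', r' <= r,
   holdisc f a r' & forall s, normC (s - a) <= r' -> normC (f s) <= M].
Proof.
move=> r0 H; have [] := @holat_cont f a _ 1 ltr01.
  by apply: H; rewrite subrr normC0 ltW.
move=> t t0 tP; exists (Num.min r (t / 2)), (normC (f a) + 1).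
have h : normC (a - a) + Num.min r (t / 2) <= r by rewrite subrr normC0 add0r ge_min lexx.
split; [by rewrite lt_min r0 divr_gt0|by rewrite ge_min lexx|exact: holdiscS H|].
move=> s; rewrite le_min => /andP[_ st].
have := tP (s - a); rewrite (addrC a) subrK => /(_ _) H1.
have -> : f s = f a + (f s - f a) by ring.
rewrite (le_trans (normCD _ _))// lerD2l ltW// H1//; lra.
Qed.

(** Differentiate [cauchy_deriv] with respect to the centre at a fixed radius. The integrand differs
    from its linearisation by two [taylor2] errors, quadratic in [h] uniformly over the circle. *)
Lemma hol_cD f a r' : 0 < r' -> holdisc f a r' -> holat (cD f) a.
Proof.
move=> r0' H'; have [r [M [r0 _ H fM]]] := hol_bounded r0' H'.
have M0 : 0 <= M by rewrite (le_trans (normC_ge0 _) (fM a _))// subrr normC0 ltW.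
have r40 : 0 < r / 4 by rewrite divr_gt0.
have r20 : 0 < r / 2 by rewrite divr_gt0.
have dc c : normC (c - a) <= r / 2 -> holdisc f c (r / 2) /\
  (forall s, normC (s - c) <= r / 2 -> normC (f s) <= M).
  move=> ca; split; first by apply: holdiscS H; lra.
  move=> s sc; apply: fM; have -> : s - a = (c - a) + (s - c) by ring.
  rewrite (le_trans (normCD _ _))//; lra.
set K := 32 * M / (r / 2) ^+ 2.
have K0 : 0 <= K by rewrite divr_ge0 ?sqr_ge0//; exact: mulr_ge0.
have cDc c : normC (c - a) <= r / 2 -> ccont_at (cD f) c.
  move=> ca e e0; exists (Num.min (r / 8) (e / (K + 1))).
    by rewrite lt_min !divr_gt0// ltr_wpDl.
  move=> h; rewrite lt_min => /andP[h1]; rewrite ltr_pdivlMr ?ltr_wpDl// => h2.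
  have [Hc fc] := dc c ca.
  have := @cD_lipschitz f c (r / 2) M (c + h) r20 Hc fc.
  rewrite (addrC c) addrK => /(_ _)/le_lt_trans; apply; first by lra.
  rewrite (le_lt_trans _ h2)// mulrC ler_wpM2l ?normC_ge0// /K; lra.
have cpt4 y : normC (cpt a (r / 4) y - a) <= r / 2 by rewrite normC_cpt//; lra.
have aa : normC (a - a) <= r / 2 by rewrite subrr normC0 ltW.
have Ha : holdisc f a (r / 4) by apply: holdiscS H; rewrite subrr normC0; lra.
pose G y := (cD f (cpt a (r / 4) y) - cD f a) * (cexp (ln (r / 4) +i* y))^-1.
have cV : ccontab 0 (2 * pi) (fun y => (cexp (ln (r / 4) +i* y))^-1 : C).
  have : ccontab 0 (2 * pi) (fun y => (fun s => (s - a)^-1) (cpt a (r / 4) y)).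
    apply: (@circ_cont (fun s => (s - a)^-1)) => y; apply: holat_cont; apply: (@holatV (fun u => u - a)).
      by apply: holatB; [exact: holat_id|exact: holat_cst].
    by rewrite -normC_gt0 normC_cpt.
  by congr ccontab; apply/funext => y /=; rewrite cptB.
have cG : ccontab 0 (2 * pi) G.
  apply: ccontM => //; apply: ccontB; last exact: ccont_cst.
  by apply: circ_cont => y; exact: cDc.
exists (cint 0 (2 * pi) G / (2 * pi)%:C) => e e0.
have pn : (2 * pi)%:C != 0 :> C by rewrite -normC_gt0 twopiC_gt0.
pose K2 := (K + K) / (r / 4).
have K20 : 0 <= K2 by rewrite divr_ge0 ?addr_ge0// ltW.
exists (Num.min (r / 8) (e / (K2 + 1))).
  by rewrite lt_min !divr_gt0// ltr_wpDl.
move=> h; rewrite lt_min => /andP[h1]; rewrite ltr_pdivlMr ?ltr_wpDl// => h2.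
have ah : normC (a + h - a) <= r / 4 by rewrite (addrC a) addrK; lra.
have Hh : holdisc f (a + h) (r / 4) by apply: holdiscS H; lra.
rewrite -(ler_pM2r twopiC_gt0) -normCM.
have -> : (cD f (a + h) - cD f a - cint 0 (2 * pi) G / (2 * pi)%:C * h) * (2 * pi)%:C =
   circ (dquot f (a + h)) (a + h) (r / 4) - circ (dquot f a) a (r / 4) - h * cint 0 (2 * pi) G.
  have aux (u v w u' v' I : C) : w != 0 -> u' = u * w -> v' = v * w ->
    (u - v - I / w * h) * w = u' - v' - h * I.
    by move=> w0 -> ->; field.
  exact: aux pn (cauchy_deriv r40 Hh) (cauchy_deriv r40 Ha).
rewrite /circ -cintZ// -cintB; [|exact: ccontab_dquot..].
rewrite -cintB; [|by apply: ccontB; exact: ccontab_dquot|exact: ccontZ].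
rewrite normC_real (gtr0_norm two_pi_gt0).
apply: cint_bound_2pi; last move=> y.
  by apply: ccontB; [apply: ccontB; exact: ccontab_dquot|exact: ccontZ].
rewrite !dquot_cpt// /G mulrA -!mulrBl normCM normCV normC_cexp /= lnK//.
set u := cpt a (r / 4) y.
have -> : f (cpt (a + h) (r / 4) y) - f (a + h) - (f u - f a) - h * (cD f u - cD f a) =
  (f (u + h) - f u - cD f u * h) - (f (a + h) - f a - cD f a * h).
  have -> : cpt (a + h) (r / 4) y = u + h by rewrite /u /cpt; ring.
  ring.
have [Hu fu] := dc u (cpt4 y); have [Ha2 fa] := dc a aa.
have h8 : normC h <= r / 2 / 4 by lra.
have := normC_ge0 h => h0.
apply: (@le_trans _ _ ((K * normC h ^+ 2 + K * normC h ^+ 2) / (r / 4))).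
  rewrite ler_pM2r ?invr_gt0// (le_trans (normCB _ _))// lerD// taylor2//.
have -> : (K * normC h ^+ 2 + K * normC h ^+ 2) / (r / 4) = normC h * K2 * normC h.
  by rewrite /K2; field; exact: lt0r_neq0.
rewrite ler_wpM2r// (le_trans _ (ltW h2))// ler_wpM2l//; lra.
Qed.

(** [f] has a second derivative [D2] at [p]; the mean value inequality applied to [k] gives the
    second order expansion of [f], and division by [h] shows that the quotient has derivative
    [D2 / 2]. *)
Lemma dquot_hol_center f p r : 0 < r -> holdisc f p r -> holat (dquot f p) p.
Proof.
move=> r0 H; have [D2 HD2] := hol_cD r0 H.
exists (D2 / 2) => e e0; have [t t0 tP] := HD2 e e0.
exists (Num.min r t); first by rewrite lt_min r0.
move=> h; rewrite lt_min => /andP[hr ht].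
rewrite /dquot eqxx; have [->|h0] := eqVneq h 0.
  by rewrite addr0 eqxx subrr mulr0 subr0 normC0 mulr0.
rewrite -subr_eq0 (addrC p) addrK (negPf h0).
have n0 : 0 < normC h by rewrite normC_gt0.
rewrite -(ler_pM2r n0) -normCM.
pose k := fun s => f s - (cD f p * s + D2 / 2 * ((s - p) * (s - p))).
have -> : ((f (h + p) - f p) / h - cD f p - D2 / 2 * h) * h = k (p + h) - k p.
  by rewrite /k (addrC h) [p + h - p]addrC addKr subrr; field.
have := @cmvi k p (p + h) (e * normC h); rewrite [p + h - p]addrC addKr; apply.
move=> x /andP[x0 x1].
have d : normC (x%:C * h) <= normC h.
  by rewrite normCM normC_real ger0_norm// ler_piMl// normC_ge0.
exists (cD f (p + x%:C * h) - (cD f p + D2 * (x%:C * h))).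
  apply: cderivB.
    by apply: cDP; apply: H; rewrite [p + _ - p]addrC addKr (le_trans d) ?ltW.
  apply: cderivD.
    by have := cderivZ (cD f p) (cderiv_id (p + x%:C * h)); rewrite mulr1.
  have D1 : cderiv (fun s => s - p) (p + x%:C * h) 1.
    by have := cderivB (cderiv_id (p + x%:C * h)) (cderiv_cst p _); rewrite subr0.
  have := cderivZ (D2 / 2) (cderivM D1 D1); congr cderiv.
  by rewrite [p + _ - p]addrC addKr; field.
rewrite opprD addrA (le_trans (tP _ (le_lt_trans d ht)))//.
by rewrite ler_wpM2l// ltW.
Qed.

Lemma pow_small (th K : R) : 0 <= th < 1 -> forall e, 0 < e -> exists n, K * th ^+ n <= e.
Proof.
move=> /andP[t0 t1] e e0.
have k0 : 0 < `|K| + 1 by rewrite ltr_wpDl.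
have /cvgrPdist_le/(_ (e / (`|K| + 1))) : (th ^+ n @[n --> \oo] --> (0 : R))%classic.
  by apply: cvg_expr; rewrite ger0_norm.
rewrite divr_gt0// => /(_ isT)[n _ /(_ n (leqnn n))].
rewrite sub0r normrN ger0_norm ?exprn_ge0// ler_pdivlMr// => H; exists n.
rewrite mulrC (le_trans _ H)// ler_wpM2l ?exprn_ge0//.
by rewrite (le_trans (ler_norm _))// lerDl.
Qed.

(** With [w = u / v] this says that [1 / (1 - w)] maps the unit disc into the half-plane of real
    part above 1/2. It keeps the kernel integral in [identity_disc] away from 0 without evaluating
    it. *)
Lemma Re_kernel (u v : C) : normC u < normC v -> 1 / 2 <= Re (v / (v - u)).
Proof.
move=> uv; have vu0 : 0 < normC (v - u).
  by rewrite normC_gt0 subr_eq0; apply: contraTneq uv => ->; rewrite ltxx.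
have u2 : normC u ^+ 2 < normC v ^+ 2 by rewrite ltr_pXn2r ?nnegrE ?normC_ge0.
have w2 : 0 < normC (v - u) ^+ 2 by rewrite exprn_gt0.
rewrite !sqr_normC in u2 w2; move: u2 w2; case: (u) => u1 u2; case: (v) => v1 v2 /= h1 h2.
have -> : v1 * ((v1 - u1) / ((v1 - u1) ^+ 2 + (v2 - u2) ^+ 2)) -
  v2 * - ((v2 - u2) / ((v1 - u1) ^+ 2 + (v2 - u2) ^+ 2)) =
  (v1 * (v1 - u1) + v2 * (v2 - u2)) / ((v1 - u1) ^+ 2 + (v2 - u2) ^+ 2) by ring.
rewrite ler_pdivlMr//; nra.
Qed.

(* Put [F_n s = f s ((p - a) / (s - a)) ^ n]; it is holomorphic since [f = 0]
   near [a], and [F_n p = f p].  The integral of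
   [(F_n s - F_n p) (s - a) / (s - p)] over the circle of radius [r] vanishes,
   while [F_n -> 0] uniformly on the circle and
   [Re ((s - a) / (s - p)) >= 1 / 2] there, so [f p = 0]. *)
Lemma identity_disc f a r0 d p : 0 < d ->
  (forall s, normC (s - a) < r0 -> holat f s) ->
  (forall s, normC (s - a) < d -> f s = 0) -> normC (p - a) < r0 -> f p = 0.
Proof.
move=> d0 H0 fz pr0.
have [pa|pa] := eqVneq p a; first by apply: fz; rewrite pa subrr normC0.
pose r := (normC (p - a) + r0) / 2.
have pr : normC (p - a) < r by rewrite /r; lra.
have r0r : r < r0 by rewrite /r; lra.
have H s : normC (s - a) <= r -> holat f s by move=> sr; apply: H0; exact: le_lt_trans r0r.
have npa : 0 < normC (p - a) by rewrite normC_gt0 subr_eq0.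
have rpos : 0 < r by exact: lt_trans pr.
pose F n s := f s * ((p - a) / (s - a)) ^+ n.
have Fp n : F n p = f p by rewrite /F divff ?subr_eq0// expr1n mulr1.
have HF n s : normC (s - a) <= r -> holat (F n) s.
  move=> sr; have [sa|sa] := eqVneq s a.
    apply: (@holat_near (fun=> 0)); last exact: holat_cst.
    by exists d => // u; rewrite sa => /fz fu; rewrite /F fu mul0r.
  apply: holatM; first exact: H.
  apply: (@holatX (fun u => (p - a) / (u - a))); apply: holatM; first exact: holat_cst.
  apply: (@holatV (fun u => u - a)); last by rewrite subr_eq0.
  by apply: holatB; [exact: holat_id|exact: holat_cst].
pose G n s := dquot (F n) p s * (s - a).
have G0 n : circ (G n) a r = 0.
  rewrite circ_center//; first by rewrite /G subrr mulr0 mul0r.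
    apply: holat_cont; apply: holatM; last by apply: holatB; [exact: holat_id|exact: holat_cst].
    by apply: dquot_hol; [rewrite eq_sym|apply: HF; rewrite subrr normC0 ltW].
  move=> s /andP[_ sr]; apply: holatM; last by apply: holatB; [exact: holat_id|exact: holat_cst].
  have [->|sp] := eqVneq s p; last by apply: dquot_hol => //; exact: HF.
  apply: (@dquot_hol_center _ _ (r - normC (p - a))); first by rewrite subr_gt0.
  move=> u up; apply: HF; have -> : u - a = (u - p) + (p - a) by ring.
  by rewrite (le_trans (normCD _ _))//; lra.
have cp y : cpt a r y != p.
  apply/eqP => E; have := normC_cpt a y rpos; rewrite E => E2; lra.
pose kr y := (cpt a r y - a) / (cpt a r y - p).
have ckr : ccontab 0 (2 * pi) kr.
  apply: (@circ_cont (fun s => (s - a) / (s - p))) => y; apply: holat_cont.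
  apply: holatM; first by apply: holatB; [exact: holat_id|exact: holat_cst].
  apply: (@holatV (fun u => u - p)); last by rewrite subr_eq0.
  by apply: holatB; [exact: holat_id|exact: holat_cst].
have cF n : ccontab 0 (2 * pi) (fun y => F n (cpt a r y)).
  by apply: circ_cont => y; apply: holat_cont; apply: HF; rewrite normC_cpt.
have cf : ccontab 0 (2 * pi) (fun y => f (cpt a r y)).
  by apply: circ_cont => y; apply: holat_cont; apply: H; rewrite normC_cpt.
have E n : f p * cint 0 (2 * pi) kr = cint 0 (2 * pi) (fun y => F n (cpt a r y) * kr y).
  apply/eqP; rewrite -subr_eq0 -opprB oppr_eq0 -cintZ// -cintB; [|exact: ccontM|exact: ccontZ].
  rewrite -(G0 n) /circ; apply/eqP; apply: eq_cint => y _.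
  rewrite /G /dquot (negPf (cp y)) Fp /kr -mulrBl; ring.
have krn y : normC (kr y) <= r / (r - normC (p - a)).
  rewrite /kr normCM normCV normC_cpt// ler_pM2l// lef_pV2 ?posrE ?subr_gt0//; last first.
    by rewrite normC_gt0 subr_eq0.
  rewrite -[X in X - _](normC_cpt a y rpos) lerBlDr.
  have {1}-> : cpt a r y - a = (cpt a r y - p) + (p - a) by ring.
  exact: normCD.
have f0 : f p * cint 0 (2 * pi) kr = 0.
  apply: (@normC_eps0 _ _ 1) => e e0; rewrite mul1r.
  have th : 0 <= normC (p - a) / r < 1.
    by rewrite divr_ge0 ?normC_ge0 ?(ltW rpos)//= ltr_pdivrMr// mul1r.
  have [n nP] := pow_small (r / (r - normC (p - a)) * Int 0 (2 * pi) (fun y => normC (f (cpt a r y)))) th e0.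
  rewrite (E n) (le_trans _ nP)//.
  rewrite (le_trans (cint_norm _))//; first exact: ccontM.
  rewrite mulrAC -IntZ; last exact: ccont_norm.
  apply: Int_le.
  - by apply: ccont_norm; exact: ccontM.
  - by apply: contabM; [exact: contab_cst|exact: ccont_norm].
  move=> y _; rewrite normCM {1}/F normCM normCX normCM normCV normC_cpt//.
  move/andP: th => [th _].
  by rewrite -mulrA [leRHS]mulrC ler_wpM2l ?normC_ge0// mulrC ler_wpM2r// exprn_ge0.
have krRe y : 1 / 2 <= Re (kr y).
  have vu : cpt a r y - p = (cpt a r y - a) - (p - a) by ring.
  by rewrite /kr vu; apply: Re_kernel; rewrite normC_cpt.
have : pi <= Re (cint 0 (2 * pi) kr).
  have piE : Int 0 (2 * pi) (fun=> 1 / 2) = pi :> R; last first.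
    rewrite -[X in X <= _]piE /=; apply: Int_le => [||t _]; [exact: contab_cst|exact: ccontRe|exact: krRe].
  by rewrite Int_cst ?two_pi_ge0// subr0 mulrA divfK// ?mul1r// pnatr_eq0.
move: f0 => /eqP; rewrite mulf_eq0 => /orP[/eqP//|/eqP ->] /=.
by rewrite leNgt pi_gt0.
Qed.

End Circle.

(** * Locally uniform limits of holomorphic functions *)

Section Limits.
Variable R : realType.
Notation C := R[i].
Implicit Types (u v : nat -> C) (l : C).

Definition cvgC u l := forall e : R, 0 < e -> exists n0, forall n, (n0 <= n)%N -> normC (u n - l) <= e.

Lemma cvgC_unique u l l' : cvgC u l -> cvgC u l' -> l = l'.
Proof.
move=> H H'; apply/eqP; rewrite -subr_eq0; apply/eqP.
apply: (@normC_eps0 _ _ 2) => e e0.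
have [n nP] := H e e0; have [m mP] := H' e e0.
have := nP _ (leq_maxl n m); have := mP _ (leq_maxr n m).
set w := u _ => h1 h2; have -> : l - l' = (w - l') - (w - l) by ring.
by rewrite (le_trans (normCB _ _))//; lra.
Qed.

Lemma cvgC_shift u l k : cvgC (fun n => u (n + k)%N) l <-> cvgC u l.
Proof.
split=> H e /H[n nP].
  exists (n + k)%N => m nkm; rewrite -(subnK (leq_trans (leq_addl n k) nkm)).
  by apply: nP; rewrite -(leq_add2r k) subnK// (leq_trans _ nkm)// leq_addl.
by exists n => m nm; apply: nP; rewrite (leq_trans nm)// leq_addr.
Qed.

Lemma cvgC_addl u l k : cvgC u l -> cvgC (fun n => k + u n) (k + l).
Proof.
by move=> H e /H[n nP]; exists n => m /nP; congr (normC _ <= e); ring.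
Qed.

Lemma cvgC_le u l (M : R) n0 : cvgC u l -> (forall n, (n0 <= n)%N -> normC (u n) <= M) -> normC l <= M.
Proof.
move=> H uM; apply: lt_eps => e e0; have [n nP] := H e e0.
have := nP _ (leq_maxl n n0); have := uM _ (leq_maxr n n0).
set w := u _ => h1 h2; have -> : l = w - (w - l) by ring.
by rewrite (le_trans (normCB _ _))//; lra.
Qed.

Lemma cauchy_real (u : nat -> R) :
  (forall e : R, 0 < e -> exists n0, forall n m, (n0 <= n)%N -> (n0 <= m)%N -> `|u n - u m| <= e) ->
  exists l : R, forall e : R, 0 < e -> exists n0, forall n, (n0 <= n)%N -> `|u n - l| <= e.
Proof.
move=> H; have cu : cvgn u.
  apply/cauchy_cvgP/cauchy_ballP => e e0; have e20 : 0 < e / 2 by rewrite divr_gt0.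
  have [n0 nP] := H _ e20.
  rewrite near_map2; exists ([set n | (n0 <= n)%N], [set n | (n0 <= n)%N]); first by split; exists n0.
  case=> n m /= [h1 h2]; rewrite /ball /= (le_lt_trans (nP _ _ h1 h2))//.
  by rewrite ltr_pdivrMr// mulr_natr mulr2n ltrDl.
exists (limn u) => e e0; move/cvgrPdist_le : cu => /(_ e e0)[n0 _ nP].
by exists n0 => n h; rewrite distrC; exact: nP.
Qed.

Lemma cvgC_cauchy u :
  (forall e : R, 0 < e -> exists n0, forall n m, (n0 <= n)%N -> (n0 <= m)%N -> normC (u n - u m) <= e) ->
  exists l, cvgC u l.
Proof.
move=> H.
have [|a aP] := @cauchy_real (fun n => Re (u n)).
  move=> e /H[n0 nP]; exists n0 => n m h1 h2; rewrite (le_trans _ (nP _ _ h1 h2))//.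
  by rewrite (le_trans _ (normC_Re _))// ReD ReN.
have [|b bP] := @cauchy_real (fun n => Im (u n)).
  move=> e /H[n0 nP]; exists n0 => n m h1 h2; rewrite (le_trans _ (nP _ _ h1 h2))//.
  by rewrite (le_trans _ (normC_Im _))// ImD ImN.
exists (a +i* b) => e e0; have e20 : 0 < e / 2 by rewrite divr_gt0.
have [n nP] := aP _ e20; have [m mP] := bP _ e20.
exists (maxn n m) => k; rewrite geq_max => /andP[/nP h1 /mP h2].
rewrite (le_trans (normC_le_ReIm _))// !ReImE /=; lra.
Qed.

(** The Cauchy estimate makes the derivatives at [a] converge, and the quadratic remainder of
    [taylor2], uniform in [n], passes to the limit. *)
Lemma weierstrass (f : C -> C) (fn : nat -> C -> C) (a : C) (r M : R) (ep : nat -> R) :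
  0 < r -> (forall n, holdisc (fn n) a r) ->
  (forall n s, normC (s - a) <= r -> normC (fn n s) <= M) ->
  (forall e, 0 < e -> exists n0, forall n, (n0 <= n)%N -> ep n <= e) ->
  (forall n s, normC (s - a) <= r -> normC (fn n s - f s) <= ep n) -> holat f a.
Proof.
move=> r0 H fM ep0 fe.
have [D DP] : exists D, cvgC (fun n => cD (fn n) a) D.
  apply: cvgC_cauchy => e e0; have e1 : 0 < e * r / 4 by rewrite divr_gt0// mulr_gt0.
  have [n0 nP] := ep0 _ e1; exists n0 => n m hn hm.
  have Hd : holdisc (fun s => fn n s - fn m s) a r by move=> s sr; apply: holatB; exact: H.
  have aa : normC (a - a) <= r by rewrite subrr normC0 ltW.
  have -> : cD (fn n) a - cD (fn m) a = cD (fun s => fn n s - fn m s) a.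
    by apply/esym/cD_eq/cderivB; apply: cDP; apply: H.
  rewrite (le_trans (@cauchy_bound _ _ _ _ (e * r / 2) r0 Hd _))//.
    move=> s sr; have -> : fn n s - fn m s = (fn n s - f s) - (fn m s - f s) by ring.
    rewrite (le_trans (normCB _ _))//.
    have := fe n s sr; have := fe m s sr; have := nP n hn; have := nP m hm; lra.
  by rewrite le_eqVlt; apply/orP; left; apply/eqP; field; exact: lt0r_neq0.
have M0 : 0 <= M.
  by rewrite (le_trans (normC_ge0 _) (fM 0%N a _))// subrr normC0 ltW.
set K := 32 * M / r ^+ 2.
have K0 : 0 <= K by rewrite divr_ge0 ?sqr_ge0//; exact: mulr_ge0.
exists D => e e0; exists (Num.min (r / 4) (e / (K + 1))).
  by rewrite lt_min !divr_gt0// ltr_wpDl.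
move=> h; rewrite lt_min => /andP[h1]; rewrite ltr_pdivlMr ?ltr_wpDl// => h2.
apply: (@le_trans _ _ (K * normC h ^+ 2)); last first.
  rewrite expr2 mulrA ler_wpM2r ?normC_ge0// (le_trans _ (ltW h2))// mulrC ler_wpM2l ?normC_ge0//; lra.
apply: lt_eps => x x0.
have nh1 : 0 < normC h + 1 by rewrite ltr_wpDl ?normC_ge0.
have [n nP] := ep0 (x / 4) (divr_gt0 x0 (ltr0n _ 4)).
have [m mP] := DP (x / 4 / (normC h + 1)) (divr_gt0 (divr_gt0 x0 (ltr0n _ 4)) nh1).
pose k := maxn n m.
have E1 := nP k (leq_maxl _ _); have E2 := mP k (leq_maxr _ _).
have T := @taylor2 _ (fn k) a r M h r0 (H k) (fM k) (ltW h1).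
have ha : normC (a + h - a) <= r by rewrite (addrC a) addrK; lra.
have F1 := fe k _ ha; have F2 : normC (fn k a - f a) <= ep k.
  by apply: fe; rewrite subrr normC0 ltW.
have -> : f (a + h) - f a - D * h = (fn k (a + h) - fn k a - cD (fn k) a * h)
   - (fn k (a + h) - f (a + h)) + ((fn k a - f a) + (cD (fn k) a - D) * h) by ring.
have G : normC ((cD (fn k) a - D) * h) <= x / 4.
  rewrite normCM (@le_trans _ _ (x / 4 / (normC h + 1) * (normC h + 1)))//.
    by rewrite ler_pM ?normC_ge0// lerDl.
  by rewrite divfK// lt0r_neq0.
rewrite (le_trans (normCD _ _))// (le_trans (lerD (normCB _ _) (normCD _ _)))//.
move: T; rewrite -/K; lra.
Qed.

Definition copen (U : C -> Prop) := forall s, U s -> exists2 t : R, 0 < t & forall w, normC (w - s) <= t -> U w.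

Lemma cDn_hol (U : C -> Prop) (f : C -> C) n : copen U -> (forall s, U s -> holat f s) ->
  forall s, U s -> holat (iter n (@cD R) f) s.
Proof.
move=> oU Hf; elim: n => [//|n IH] s Us /=.
by have [t t0 tP] := oU _ Us; apply: (@hol_cD _ _ _ t) => // w /tP/IH.
Qed.

Lemma cDn_eq (U : C -> Prop) (f g : C -> C) n : copen U -> (forall s, U s -> holat f s) ->
  (forall s, U s -> f s = g s) ->
  forall s, U s -> iter n (@cD R) f s = iter n (@cD R) g s.
Proof.
move=> oU Hf fg; elim: n => [//|n IH] s Us /=.
have := cDP (cDn_hol n oU Hf Us) => HD; apply/esym/cD_eq.
have [t t0 tP] := oU _ Us; apply: cderiv_near HD; exists t => // w /ltW/tP; exact: IH.
Qed.

Lemma cDn_derive1n (f : C -> C) n s :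
  derive1n n (f : R[i]^o -> R[i]^o) s = iter n (@cD R) f s.
Proof.
elim: n s => [//|n IH] s /=; rewrite cDE.
by congr (derive1 _ s); apply/funext.
Qed.

Lemma cDnD (U : C -> Prop) (f g : C -> C) n : copen U -> (forall s, U s -> holat f s) ->
  (forall s, U s -> holat g s) ->
  forall s, U s -> iter n (@cD R) (fun w => f w + g w) s = iter n (@cD R) f s + iter n (@cD R) g s.
Proof.
move=> oU Hf Hg; elim: n => [//|n IH] s Us /=; apply: cD_eq.
have [t t0 tP] := oU _ Us.
have := cderivD (cDP (cDn_hol n oU Hf Us)) (cDP (cDn_hol n oU Hg Us)).
by apply: cderiv_near; exists t => // w /ltW/tP/IH.
Qed.

Lemma cderiv_fsum n (F : nat -> C -> C) (D : nat -> C) s :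
  (forall i, cderiv (F i) s (D i)) ->
  cderiv (fun w => \sum_(i < n) F i w) s (\sum_(i < n) D i).
Proof. by move=> H; apply: (@cderiv_sum _ _ _ (fun i : 'I_n => F i)) => i; exact: H. Qed.

Lemma cDn_sum_cpow (x : nat -> R) L n s :
  iter n (@cD R) (fun w => \sum_(i < L) cpow (x i) (- w)) s =
  \sum_(i < L) (- (ln (x i))%:C) ^+ n * cpow (x i) (- s).
Proof.
elim: n s => [|n IH] s /=; first by apply: eq_bigr => i _; rewrite expr0 mul1r.
apply: cD_eq.
have := @cderiv_fsum L (fun i w => (- (ln (x i))%:C) ^+ n * cpow (x i) (- w)) _ s
  (fun i => cderivZ ((- (ln (x i))%:C) ^+ n) (cderiv_cpow (x i) s)).
rewrite (eq_bigr (fun i : 'I_L => (- (ln (x i))%:C) ^+ n.+1 * cpow (x i) (- s))); last first.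
  by move=> i _; rewrite exprSr -mulrA.
by apply: cderiv_near; exists 1 => // w _; rewrite IH.
Qed.

(** The constant in the iterated Cauchy estimate: each derivative spends half of the remaining
    radius. *)
Fixpoint Kc n (r : R) : R := if n is m.+1 then 2 * Kc m (r / 2) / (r / 2) else 1.

Lemma cDn_bound n (f : C -> C) (a : C) (r M : R) : 0 < r -> holdisc f a r ->
  (forall s, normC (s - a) <= r -> normC (f s) <= M) -> normC (iter n (@cD R) f a) <= Kc n r * M.
Proof.
elim: n a r => [|n IH] a r r0 H fM.
  by rewrite mul1r fM// subrr normC0 ltW.
have r20 : 0 < r / 2 by rewrite divr_gt0.
have S c : normC (c - a) <= r / 2 -> holdisc f c (r / 2) /\
    (forall s, normC (s - c) <= r / 2 -> normC (f s) <= M).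
  move=> ca; split; first by apply: holdiscS H; lra.
  move=> s sc; apply: fM; have -> : s - a = (c - a) + (s - c) by ring.
  by rewrite (le_trans (normCD _ _))//; lra.
rewrite iterS (le_trans (@cauchy_bound _ _ _ (r / 2) (Kc n (r / 2) * M) _ _ _))//.
- move=> c ca.
  apply: (@cDn_hol (fun w => normC (w - a) < r)); last by lra.
  + move=> s sr; exists ((r - normC (s - a)) / 2); first by rewrite divr_gt0// subr_gt0.
    move=> w ws; have -> : w - a = (w - s) + (s - a) by ring.
    by rewrite (le_lt_trans (normCD _ _))//; lra.
  + by move=> s /ltW/H.
- by move=> s /S[Hs fs]; exact: IH.
- by rewrite /= mulrA mulrAC.
Qed.

End Limits.

(** * Continuation of the Hurwitz zeta-function *)

Section Hurwitz.
Variable R : realType.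
Notation C := R[i].
Implicit Types (s w : C) (x b : R).

Definition rder (F : R -> C) (t : R) (d : C) :=
  is_derive t 1 (fun u => Re (F u)) (Re d) /\ is_derive t 1 (fun u => Im (F u)) (Im d).

Lemma rderD F G t (a b' : C) : rder F t a -> rder G t b' -> rder (fun u => F u + G u) t (a + b').
Proof.
move=> [F1 F2] [G1 G2]; split.
  rewrite ReD (_ : (fun u => _) = (fun u => Re (F u)) + (fun u => Re (G u))); first exact: is_deriveD.
  by apply/funext => u; rewrite ReD.
rewrite ImD (_ : (fun u => _) = (fun u => Im (F u)) + (fun u => Im (G u))); first exact: is_deriveD.
by apply/funext => u; rewrite ImD.
Qed.

Lemma rderZ (k : C) F t a : rder F t a -> rder (fun u => k * F u) t (k * a).
Proof.
move=> [F1 F2]; split.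
  rewrite ReM (_ : (fun u => _) = Re k \*: (fun u => Re (F u)) - Im k \*: (fun u => Im (F u))).
    by apply: is_deriveB; exact: is_deriveZ.
  by apply/funext => u; rewrite ReM.
rewrite ImM (_ : (fun u => _) = Re k \*: (fun u => Im (F u)) + Im k \*: (fun u => Re (F u))).
  by apply: is_deriveD; exact: is_deriveZ.
by apply/funext => u; rewrite ImM.
Qed.

Lemma Re_rmul (r : R) (z : C) : Re (r%:C * z) = r * Re z.
Proof. by rewrite ReM /= mul0r subr0. Qed.

Lemma Im_rmul (r : R) (z : C) : Im (r%:C * z) = r * Im z.
Proof. by rewrite ImM /= mul0r addr0. Qed.

Lemma rder_cpow x w : 0 < x -> rder (fun u => cpow u w) x (w * cpow x (w - 1)).
Proof.
move=> x0.
have /cderiv_path[H1 H2] : cderiv (@cexp R) (0 + (ln x)%:C * w) (cexp (0 + (ln x)%:C * w)) by exact: cderiv_cexp.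
have E : w * cpow x (w - 1) = (x^-1)%:C * (cexp (0 + (ln x)%:C * w) * w).
  have E1 : cpow x (-1) = (x^-1)%:C.
    by rewrite /cpow mulN1r cexpN cexp_real lnK// rmorphV// unitfE lt0r_neq0.
  by rewrite add0r cpowD E1 (mulrC (ln x)%:C) -/(cpow x w); ring.
have dl := is_derive1_ln x0.
have F u : cpow u w = cexp (0 + (ln u)%:C * w) by rewrite /cpow add0r mulrC.
split; rewrite E ?Re_rmul ?Im_rmul.
  have := is_derive1_comp H1 dl; rewrite mulrC; congr is_derive.
  by apply/funext => u; rewrite F.
have := is_derive1_comp H2 dl; rewrite mulrC; congr is_derive.
by apply/funext => u; rewrite F.
Qed.

Lemma rder_cont F t d : rder F t d -> ccont F t.
Proof. by move=> [[d1 _] [d2 _]]; split; apply/differentiable_continuous/derivable1_diffP. Qed.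

Lemma cpow_cont a b w : 0 < a -> ccontab a b (fun u => cpow u w).
Proof. by move=> a0 t /andP[ta _]; apply: rder_cont (rder_cpow w (lt_le_trans a0 ta)). Qed.

Lemma rder_FTC (a b : R) F f : a <= b -> ccontab a b f -> (forall t, a <= t <= b -> rder F t (f t)) ->
  cint a b f = F b - F a.
Proof. exact: cint_FTC. Qed.

(* [(x ^ (1 - s) - (x + 1) ^ (1 - s)) / (s - 1)] is the integral of [u ^ (- s)]
   over [[x, x + 1]]; the difference with [x ^ (- s)] is summable over
   [x = b + n] as soon as [0 < Re s]. *)
Definition Eterm s x : C := cpow x (- s) - (cpow x (1 - s) - cpow (x + 1) (1 - s)) / (s - 1).

Definition rpw x (r : R) : R := expR (r * ln x).

Lemma rpw_gt0 x r : 0 < rpw x r. Proof. exact: expR_gt0. Qed.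

Lemma normC_cpowE x w : normC (cpow x w) = rpw x (Re w).
Proof. exact: normC_cpow. Qed.

Lemma rpwD x r r' : rpw x (r + r') = rpw x r * rpw x r'.
Proof. by rewrite /rpw mulrDl expRD. Qed.

Lemma rpwN x r : rpw x (- r) = (rpw x r)^-1.
Proof. by rewrite /rpw mulNr expRN. Qed.

Lemma rpw1 x : 0 < x -> rpw x 1 = x.
Proof. by move=> x0; rewrite /rpw mul1r lnK. Qed.

Lemma ler_rpw x y r : 0 < x -> x <= y -> 0 <= r -> rpw x r <= rpw y r.
Proof.
move=> x0 xy r0; rewrite /rpw ler_expR ler_wpM2l// ler_ln// posrE//.
exact: lt_le_trans xy.
Qed.

Lemma ler_rpwN x y r : 0 < x -> x <= y -> 0 <= r -> rpw y (- r) <= rpw x (- r).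
Proof. by move=> x0 xy r0; rewrite !rpwN lef_pV2 ?posrE ?rpw_gt0// ler_rpw. Qed.

Lemma ler_rpw_exp x r r' : 1 <= x -> r <= r' -> rpw x r <= rpw x r'.
Proof. by move=> x1 rr; rewrite /rpw ler_expR ler_wpM2r// ln_ge0. Qed.

Lemma rpw_FTC x y (r : R) : 0 < x -> x <= y -> Int x y (fun u => r * rpw u (r - 1)) = rpw y r - rpw x r.
Proof.
move=> x0 xy.
have E u (p : R) : cpow u p%:C = (rpw u p)%:C.
  by rewrite /cpow -rmorphM cexp_real.
have D t : x <= t <= y -> is_derive t 1 (fun u => rpw u r) (r * rpw t (r - 1)).
  move=> /andP[xt _]; have [+ _] := rder_cpow r%:C (lt_le_trans x0 xt).
  have -> : r%:C * cpow t (r%:C - 1) = (r * rpw t (r - 1))%:C :> C.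
    by have := E t (r - 1); rewrite rmorphB rmorph1 => ->; rewrite -rmorphM.
  congr is_derive; by apply/funext => u; rewrite E.
apply: Int_FTC => //.
move=> t /andP[xt ty]; have := rder_cont (rder_cpow (r - 1)%:C (lt_le_trans x0 xt)).
move=> [+ _]; rewrite (_ : (fun u : R => Re (cpow u (r - 1)%:C)) = (fun u => rpw u (r - 1))); last first.
  by apply/funext => u; rewrite E.
by move=> H; apply: cvgM => //; exact: cvg_cst.
Qed.

Lemma Eterm_int s x : 0 < x -> s != 1 ->
  Eterm s x = s * cint x (x + 1) (fun y => (x + 1 - y)%:C * cpow y (- s - 1)).
Proof.
move=> x0 s1; have s10 : s - 1 != 0 by rewrite subr_eq0.
(* A primitive of [s * (x + 1 - y) * y ^ (- s - 1)], obtained by splitting off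
   [y * y ^ (- s - 1) = y ^ (- s)]. *)
pose F y := (- (x + 1)%:C) * cpow y (- s) + (s / (s - 1)) * cpow y (1 - s).
have pE y : 0 < y -> cpow y (- s) = y%:C * cpow y (- s - 1).
  by move=> y0; rewrite -(cpow1 y0) -cpowD addrC subrK.
have p1E y : 0 < y -> cpow y (1 - s) = y%:C * cpow y (- s).
  by move=> y0; rewrite -(cpow1 y0) -cpowD.
have cc : ccontab x (x + 1) (fun y => (x + 1 - y)%:C * cpow y (- s - 1)).
  apply: ccontM; last exact: cpow_cont.
  apply: ccontP; last exact: contab_cst.
  apply: contabD; first exact: contab_cst.
  by apply: contabN => t _; exact: cvg_id.
rewrite -cintZ// (@rder_FTC _ _ F).
- rewrite /F /Eterm (p1E _ x0) rmorphD /= (p1E (x + 1)) ?addr_gt0// rmorphD /=; field.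
  exact: s10.
- by rewrite lerDl.
- exact: ccontZ.
move=> y /andP[xy _]; have y0 : 0 < y by exact: lt_le_trans xy.
have -> : s * ((x + 1 - y)%:C * cpow y (- s - 1)) = (- (x + 1)%:C) * (- s * cpow y (- s - 1)) +
    s / (s - 1) * ((1 - s) * cpow y (1 - s - 1)).
  rewrite (_ : 1 - s - 1 = - s); last by ring.
  by rewrite (pE _ y0) !rmorphD rmorphN /=; field.
by apply: rderD; apply: rderZ; exact: rder_cpow.
Qed.

(** The kernel [x + 1 - y] is at most 1, and the remaining integral is kept as a difference of
    powers so that the bounds telescope in [psum_tail]. *)
Lemma Eterm_bound s x : 0 < x -> s != 1 -> 0 < Re s ->
  normC (Eterm s x) <= normC s / Re s * (rpw x (- Re s) - rpw (x + 1) (- Re s)).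
Proof.
move=> x0 s1 s0; rewrite Eterm_int// normCM -mulrA ler_wpM2l ?normC_ge0//.
have cc : ccontab x (x + 1) (fun y => (x + 1 - y)%:C * cpow y (- s - 1)).
  apply: ccontM; last exact: cpow_cont.
  apply: ccontP; last exact: contab_cst.
  apply: contabD; first exact: contab_cst.
  by apply: contabN => t _; exact: cvg_id.
have x1 : x <= x + 1 by rewrite lerDl.
rewrite (le_trans (cint_norm cc))//.
have cr : contab x (x + 1) (fun u => rpw u (- Re s - 1)).
  have : ccontab x (x + 1) (fun u => cpow u (- s - 1)) by exact: cpow_cont.
  move=> /ccont_norm; congr contab; apply/funext => u.
  by rewrite normC_cpowE ReD !ReN.
rewrite -(opprB (rpw (x + 1) _)) -(@rpw_FTC x (x + 1) (- Re s))// IntZ// mulNr opprK.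
rewrite mulKf ?lt0r_neq0//; apply: Int_le => //; first exact: ccont_norm.
move=> t /andP[xt tx]; rewrite normCM normC_cpowE ReD !ReN normC_real ler_piMl ?(ltW (rpw_gt0 _ _))//.
by rewrite ler_norml; apply/andP; split; lra.
Qed.

Definition psum s b L : C := \sum_(n < L) Eterm s (b + n%:R).

Lemma psum_tail s b L L' : 0 < b -> s != 1 -> 0 < Re s -> (L <= L')%N ->
  normC (psum s b L' - psum s b L) <= normC s / Re s * rpw (b + L%:R) (- Re s).
Proof.
move=> b0 s1 s0 LL.
have k0 : 0 <= normC s / Re s by rewrite divr_ge0 ?normC_ge0 ?ltW.
suff H : normC (psum s b L' - psum s b L) <=
    normC s / Re s * (rpw (b + L%:R) (- Re s) - rpw (b + L'%:R) (- Re s)).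
  rewrite (le_trans H)// ler_wpM2l// gerBl ltW// rpw_gt0//.
elim: L' LL => [|L' IH]; first by rewrite leqn0 => /eqP ->; rewrite !subrr mulr0 normC0.
rewrite leq_eqVlt => /predU1P[->|]; first by rewrite !subrr mulr0 normC0.
rewrite ltnS => /IH {}IH; rewrite /psum big_ord_recr /= -/(psum s b L') addrAC.
rewrite (le_trans (normCD _ _))// -/(psum s b L).
have bL : 0 < b + L'%:R by rewrite ltr_wpDr.
have := Eterm_bound bL s1 s0; rewrite -addrA -(natr1 L') => H.
have -> : normC s / Re s * (rpw (b + L%:R) (- Re s) - rpw (b + (L'%:R + 1)) (- Re s)) =
  normC s / Re s * (rpw (b + L%:R) (- Re s) - rpw (b + L'%:R) (- Re s)) +
  normC s / Re s * (rpw (b + L'%:R) (- Re s) - rpw (b + (L'%:R + 1)) (- Re s)) by ring.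
exact: lerD.
Qed.

Lemma rpw_small b r : 0 < b -> 0 < r -> forall e : R, 0 < e ->
  exists n0 : nat, forall n, (n0 <= n)%N -> rpw (b + n%:R) (- r) <= e.
Proof.
move=> b0 r0 e e0.
exists (Num.bound (expR (- ln e / r))) => n nn.
have : expR (- ln e / r) < b + n%:R.
  rewrite (@lt_trans _ _ n%:R) ?ltrDr// (lt_le_trans (archi_boundP (expR_ge0 _)))// ler_nat//.
move=> /ltW H; rewrite /rpw -(lnK e0) ler_expR mulNr lerNl mulrC -ler_pdivrMr//.
by rewrite -[leLHS]expRK ler_ln ?posrE ?expR_gt0// ltr_wpDr.
Qed.

Definition Zser s b : C := xget 0 [set l | cvgC (psum s b) l].
(** For [1 < Re s] the terms subtracted in [Eterm] telescope to [cpow b (1 - s) / (s - 1)]. Adding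
    this back restores the Hurwitz series in a form that is meaningful for [0 < Re s], away from
    [s = 1]. *)
Definition Zh s b : C := cpow b (1 - s) / (s - 1) + Zser s b.

Lemma psum_cvg s b : 0 < b -> s != 1 -> 0 < Re s -> cvgC (psum s b) (Zser s b).
Proof.
move=> b0 s1 s0; have [|l lP] := @cvgC_cauchy _ (psum s b); last first.
  by rewrite /Zser; apply: (@xgetI _ 0 [set l | cvgC (psum s b) l] l).
move=> e e0; have k0 : 0 < normC s / Re s + 1 by rewrite ltr_wpDl// divr_ge0 ?normC_ge0 ?ltW.
have [n0 nP] := rpw_small b0 s0 (divr_gt0 e0 k0).
exists n0.
have aux n m : (n0 <= n)%N -> (n <= m)%N -> normC (psum s b m - psum s b n) <= e.
  move=> h1 h2; rewrite (le_trans (psum_tail b0 s1 s0 h2))//.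
  rewrite (@le_trans _ _ ((normC s / Re s + 1) * (e / (normC s / Re s + 1))))//.
    by rewrite ler_pM ?nP ?divr_ge0 ?normC_ge0 ?(ltW s0) ?ltW ?rpw_gt0 ?ltrDl.
  by rewrite mulrC divfK// lt0r_neq0.
move=> n m h1 h2; have [nm|/ltnW nm] := leqP n m; last exact: aux.
by rewrite normC_distC; exact: aux.
Qed.

Lemma Zser_tail s b L : 0 < b -> s != 1 -> 0 < Re s ->
  normC (psum s b L - Zser s b) <= normC s / Re s * rpw (b + L%:R) (- Re s).
Proof.
move=> b0 s1 s0; rewrite normC_distC addrC.
apply: (@cvgC_le _ (fun n => - psum s b L + psum s b n) _ _ L).
  by apply: cvgC_addl; exact: psum_cvg.
by move=> n nL; rewrite addrC; exact: psum_tail.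
Qed.

Lemma Zser_bound s b : 0 < b -> s != 1 -> 0 < Re s ->
  normC (Zser s b) <= normC s / Re s * rpw b (- Re s).
Proof.
move=> b0 s1 s0; have := Zser_tail 0 b0 s1 s0.
by rewrite /psum big_ord0 sub0r normCN addr0.
Qed.

Lemma Zh_bound s b : 0 < b -> s != 1 -> 0 < Re s ->
  normC (Zh s b) <= rpw b (1 - Re s) / normC (s - 1) + normC s / Re s * rpw b (- Re s).
Proof.
move=> b0 s1 s0; rewrite (le_trans (normCD _ _))// lerD ?Zser_bound//.
by rewrite normCM normCV normC_cpowE ReD ReN.
Qed.

Lemma Zh_shift s b : 0 < b -> s != 1 -> 0 < Re s -> Zh s b = cpow b (- s) + Zh s (b + 1).
Proof.
move=> b0 s1 s0; have s10 : s - 1 != 0 by rewrite subr_eq0.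
have b10 : 0 < b + 1 by rewrite addr_gt0.
have E : Zser s b = Eterm s b + Zser s (b + 1).
  apply: (@cvgC_unique _ (psum s b)); first exact: psum_cvg.
  apply/(cvgC_shift _ _ 1); have := cvgC_addl (Eterm s b) (psum_cvg b10 s1 s0).
  congr cvgC; apply/funext => n; rewrite addn1 /psum big_ord_recl /= addr0; congr (_ + _).
  by apply: eq_bigr => i _; rewrite /bump /= natrD addrA.
by rewrite /Zh E /Eterm; field.
Qed.

Lemma Zh_shiftn s b L : 0 < b -> s != 1 -> 0 < Re s ->
  Zh s b = \sum_(n < L) cpow (b + n%:R) (- s) + Zh s (b + L%:R).
Proof.
move=> b0 s1 s0; elim: L => [|L IH]; first by rewrite big_ord0 add0r addr0.
rewrite IH big_ord_recr /= -addrA; congr (_ + _).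
have bL : 0 < b + L%:R by rewrite ltr_wpDr.
rewrite (Zh_shift bL s1 s0); congr (_ + Zh s _).
by rewrite -addrA natr1.
Qed.

Lemma Zh_series s b : 0 < b -> 1 < Re s -> cvgC (fun L => \sum_(n < L) cpow (b + n%:R) (- s)) (Zh s b).
Proof.
move=> b0 s1 e e0.
have s0 : 0 < Re s by exact: lt_trans s1.
have sn1 : s != 1 by apply: contraTneq s1 => -> /=; rewrite ltxx.
have n1 : 0 < normC (s - 1) by rewrite normC_gt0 subr_eq0.
have s1' : 0 < Re s - 1 by rewrite subr_gt0.
have k0 : 0 < normC s / Re s + 1 by rewrite ltr_wpDl// divr_ge0 ?normC_ge0 ?ltW.
have [n nP] := rpw_small b0 s1' (divr_gt0 (mulr_gt0 e0 n1) (ltr0n _ 2)).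
have [m mP] := rpw_small b0 s0 (divr_gt0 (divr_gt0 e0 (ltr0n _ 2)) k0).
exists (maxn n m) => k; rewrite geq_max => /andP[/nP h1 /mP h2].
rewrite (Zh_shiftn k b0 sn1 s0) opprD addrA subrr sub0r normCN.
have bk : 0 < b + k%:R by rewrite ltr_wpDr.
rewrite (le_trans (Zh_bound bk sn1 s0))// [leRHS](splitr e) lerD//.
  by rewrite ler_pdivrMr// mulrAC (_ : 1 - Re s = - (Re s - 1)) // opprB.
rewrite (@le_trans _ _ ((normC s / Re s + 1) * (e / 2 / (normC s / Re s + 1))))//.
  by rewrite ler_pM ?h2 ?divr_ge0 ?normC_ge0 ?(ltW s0) ?ltW ?rpw_gt0 ?ltrDl.
by rewrite mulrC divfK// lt0r_neq0.
Qed.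

Lemma cpow_hol x (f : C -> C) s : holat f s -> holat (fun u => cpow x (f u)) s.
Proof.
move=> H; apply: (@holat_comp _ (@cexp R) (fun u => f u * (ln x)%:C)).
  by apply: holatM => //; exact: holat_cst.
by eexists; exact: cderiv_cexp.
Qed.

Lemma Eterm_hol x s : s != 1 -> holat (fun u => Eterm u x) s.
Proof.
move=> s1; have H : holat (fun u : C => u - 1) s by apply: holatB; [exact: holat_id|exact: holat_cst].
have H1 : holat (fun u : C => 1 - u) s by apply: holatB; [exact: holat_cst|exact: holat_id].
have HN : holat (fun u : C => - u) s.
  by have [D HD] := holatB (holat_cst 0 s) (holat_id s); exists D; move: HD; congr cderiv; apply/funext => u; rewrite sub0r.
apply: holatB; first exact: cpow_hol.
apply: holatM; last by apply: holatV => //; rewrite subr_eq0.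
by apply: holatB; exact: cpow_hol.
Qed.

Lemma psum_hol b L s : s != 1 -> holat (fun u => psum u b L) s.
Proof.
move=> s1; have H n := cDP (Eterm_hol (b + n%:R) s1).
by eexists; exact: (cderiv_fsum (F := fun n u => Eterm u (b + n%:R)) L H).
Qed.

Lemma Zh_hol b s : 0 < b -> s != 1 -> 0 < Re s -> holat (fun u => Zh u b) s.
Proof.
move=> b0 s1 s0.
have n1 : 0 < normC (s - 1) by rewrite normC_gt0 subr_eq0.
have [D1 H1] : holat (fun u : C => cpow b (1 - u) / (u - 1)) s.
  apply: holatM; first by apply: cpow_hol; apply: holatB; [exact: holat_cst|exact: holat_id].
  apply: (@holatV _ (fun u => u - 1)); last by rewrite subr_eq0.
  by apply: holatB; [exact: holat_id|exact: holat_cst].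
suff [D2 H2] : holat (fun u => Zser u b) s by eexists; exact: cderivD H1 H2.
(* The closed disc of radius [r] avoids the pole and keeps [Re u >= Re s / 2]. *)
pose r := Num.min (normC (s - 1) / 2) (Re s / 2).
have r0 : 0 < r by rewrite lt_min !divr_gt0.
have rR : r <= Re s / 2 by rewrite ge_min lexx orbT.
have rN : r <= normC (s - 1) / 2 by rewrite ge_min lexx.
have dR u : normC (u - s) <= r -> [/\ u != 1, Re s / 2 <= Re u & normC u <= normC s + r].
  move=> us; split.
  - apply: contraTneq us => ->; rewrite normC_distC -ltNge; lra.
  - have := normC_Re (u - s); rewrite ReD ReN ler_norml => /andP[+ _]; lra.
  - have {1}-> : u = s + (u - s) by ring.
    by rewrite (le_trans (normCD _ _))// lerD2l.
pose K := (normC s + r) / (Re s / 2).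
have K0 : 0 <= K by rewrite divr_ge0 ?addr_ge0 ?normC_ge0 ?ltW// divr_gt0.
have uK u : normC (u - s) <= r -> normC u / Re u <= K.
  move=> /dR[_ h1 h2]; rewrite ler_pM ?normC_ge0 ?invr_ge0//.
    by rewrite (le_trans _ h1)// divr_ge0// ltW.
  by rewrite lef_pV2// posrE ?divr_gt0// (lt_le_trans _ h1)// divr_gt0.
have upos u : normC (u - s) <= r -> 0 < Re u by move=> /dR[_ h1 _]; rewrite (lt_le_trans _ h1)// divr_gt0.
(* The index [n.+1] puts the base above 1, so the exponent [- Re u] may be replaced by
   [- (Re s / 2)], uniformly in [u]. *)
pose ep n := K * rpw (b + n.+1%:R) (- (Re s / 2)).
have epE u n : normC (u - s) <= r -> normC (psum u b n.+1 - Zser u b) <= ep n.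
  move=> us; have [u1 h1 h2] := dR _ us.
  rewrite (le_trans (Zser_tail n.+1 b0 u1 (upos _ us)))//.
  rewrite ler_pM ?uK ?(ltW (rpw_gt0 _ _))//.
    by rewrite divr_ge0 ?normC_ge0// ltW// upos.
  apply: ler_rpw_exp; last by rewrite lerN2.
  by rewrite -natr1 addrA lerDr addr_ge0// ltW.
have Zb u : normC (u - s) <= r -> normC (Zser u b) <= ep 0%N + normC (psum u b 1).
  move=> us; have -> : Zser u b = psum u b 1 - (psum u b 1 - Zser u b) by ring.
  by rewrite (le_trans (normCB _ _))// addrC lerD2r epE.
have H : exists r' M, [/\ 0 < r', r' <= r & forall u, normC (u - s) <= r' -> normC (psum u b 1) <= M].
  have [|r' [M [h1 h2 _ h4]]] := @hol_bounded _ (fun u => psum u b 1) s r r0.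
    by move=> u /dR[u1 _ _]; exact: psum_hol.
  by exists r', M.
have [r' [M [r'0 r'r PM]]] := H.
apply: (@weierstrass _ _ (fun n u => psum u b n.+1) s r' (ep 0%N + (ep 0%N + M)) ep) => //.
- by move=> n u ur; apply: psum_hol; have [] := dR _ (le_trans ur r'r).
- move=> n u ur; have -> : psum u b n.+1 = (psum u b n.+1 - Zser u b) + Zser u b by ring.
  rewrite (le_trans (normCD _ _))// lerD//.
    rewrite (le_trans (epE _ _ (le_trans ur r'r)))// ler_wpM2l//.
    apply: ler_rpwN; rewrite ?ltr_wpDr// ?lerD2l ?ler_nat// divr_ge0// ltW//.
  by rewrite (le_trans (Zb _ (le_trans ur r'r)))// lerD2l PM.
- move=> e e0; have k1 : 0 < K + 1 by rewrite ltr_wpDl.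
  have s20 : 0 < Re s / 2 by rewrite divr_gt0.
  have [n0 nP] := rpw_small b0 s20 (divr_gt0 e0 k1).
  exists n0 => n nn; rewrite /ep (@le_trans _ _ ((K + 1) * (e / (K + 1))))//.
    apply: ler_pM => //; [exact/ltW/rpw_gt0|by rewrite lerDl|exact: (nP n.+1 (leqW nn))].
  by rewrite mulrC divfK// lt0r_neq0.
- by move=> n u ur; apply: epE; exact: le_trans ur r'r.
Qed.

Lemma cvgC_top (u : nat -> C) l : cvgC u l <-> (u : nat -> R[i]^o) @ \oo --> (l : R[i]^o).
Proof.
split=> [H|/cvgrPdist_le H].
  apply/cvgrPdist_le => e e0; have eR : e = (Re e)%:C by move/gtr0_real : e0 => /RRe_real.
  move: e0; rewrite eR ltcR => /H[n0 nP]; exists n0 => // n /nP.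
  by rewrite distrC normC_norm lecR.
move=> e e0; have /H[n0 _ nP] : 0 < e%:C by rewrite ltcR.
by exists n0 => n /nP; rewrite distrC normC_norm lecR.
Qed.

(** [Zh] is one admissible continuation; any other agrees with it at [s] by the identity theorem on
    a disc that reaches from the half-plane of convergence to [s]. *)
Lemma hurwitz_zetaE (a : R) s : 0 < a -> 0 < Re s <= 1 -> 1 <= `|Im s| -> hurwitz_zeta a s = Zh s a.
Proof.
move=> a0 /andP[s0 s1] t1.
have ser w : 1 < Re w -> series (fun n : nat => cpow (n%:R + a) (- w)) @ \oo --> (Zh w a : R[i]^o).
  move=> w1; apply/cvgC_top; have := Zh_series a0 w1; congr cvgC.
  apply/funext => L; rewrite /series /= big_mkord; apply: eq_bigr => i _.
  by rewrite addrC.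
apply: xget_unique.
  exists 0, (fun w => Zh w a); split=> //; split=> // w w0 w1.
  by have [D /cderiv_derivable[]] := Zh_hol a0 w1 w0.
move=> _ [x [F [xs [Fd Fs] <-]]].
apply/eqP; rewrite -subr_eq0; apply/eqP.
(* The disc of radius [r0] about [c] contains [s], stays to the right of [x] and of 0, and misses
   the pole because [r0 <= 1 <= |Im s|]. The smaller disc of radius [d] lies in [1 < Re w], where
   both functions are the sum of the series. *)
pose d := Re s / 2; have d0 : 0 < d by rewrite divr_gt0.
pose c := (1 + d) +i* Im s.
pose r0 := Num.min 1 (1 + d - Num.max x 0).
have dist w : normC (w - c) < r0 -> [/\ x < Re w, 0 < Re w & w != 1].
  rewrite lt_min => /andP[w1 w2].
  have := le_lt_trans (normC_Re (w - c)) w2; rewrite ReD ReN /= ltr_norml => /andP[h1 _].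
  have h2 : Num.max x 0 < Re w by lra.
  move: h2; rewrite gt_max => /andP[-> ->]; split=> //.
  apply: contraTneq w1 => ->; rewrite -leNgt (le_trans t1)//.
  by rewrite (le_trans _ (normC_Im _))// ImD ImN /= sub0r normrN.
apply: (@identity_disc _ (fun w => F w - Zh w a) c r0 d) => //.
- move=> w /dist[w1 w2 w3]; apply: holatB; last exact: Zh_hol.
  exact: derivable_cderiv (Fd w w1 w3).
- move=> w wd; have w1 : 1 < Re w.
    have := le_lt_trans (normC_Re (w - c)) wd; rewrite ReD ReN /= ltr_norml => /andP[+ _]; lra.
  apply/eqP; rewrite subr_eq0; apply/eqP.
  have /cvgC_top c1 := Fs w w1; have /cvgC_top c2 := ser w w1.
  exact: cvgC_unique c1 c2.
have -> : normC (s - c) = 1 + d - Re s.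
  rewrite (_ : s - c = (Re s - (1 + d))%:C); last first.
    by apply: eqC; rewrite !ReImE /= ?subrr.
  by rewrite normC_real ler0_norm ?opprB// /d; lra.
rewrite lt_min; apply/andP; split; first by rewrite /d; lra.
by rewrite ltrD2l ltrN2 gt_max xs s0.
Qed.

(** An open set away from the pole, as [cDn_eq] needs for passing from equal functions to equal
    derivatives. *)
Definition Om s := 0 < Re s < 1 /\ 1 < Im s.

Lemma Om_open : copen Om.
Proof.
move=> s [/andP[s0 s1] s2].
exists (Num.min (Num.min (Re s) (1 - Re s)) (Im s - 1) / 2).
  by rewrite divr_gt0// !lt_min s0 !subr_gt0 s1 s2.
move=> w; rewrite ler_pdivlMr// !le_min => /andP[/andP[h1 h2] h3].
have := normC_Re (w - s); have := normC_Im (w - s).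
rewrite !ReImE !ler_norml => /andP[a1 _] /andP[a3 a4].
by rewrite /Om; split; [apply/andP; split|]; lra.
Qed.

Lemma Om_neq1 s : Om s -> s != 1.
Proof. by move=> [_]; apply: contraTneq => -> /=; rewrite -leNgt ler01. Qed.

Lemma hurwitz_hol a s : 0 < a -> Om s -> holat (fun u => Zh u a) s.
Proof. by move=> a0 H; apply: Zh_hol => //; [exact: Om_neq1|have [/andP[]] := H]. Qed.

Lemma hurwitz_zeta_deriveE n (a : R) s L : 0 < a -> Om s ->
  hurwitz_zeta_derive n a s =
  \sum_(i < L) (- (ln (a + i%:R))%:C) ^+ n * cpow (a + i%:R) (- s) +
  iter n (@cD R) (fun u => Zh u (a + L%:R)) s.
Proof.
move=> a0 Us; rewrite /hurwitz_zeta_derive cDn_derive1n.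
have eqz w : Om w -> Zh w a = hurwitz_zeta a w.
  move=> [/andP[w0 w1] w2]; rewrite hurwitz_zetaE// ?w0 ?ltW//.
  by rewrite (lt_le_trans w2)// ler_norm.
have hz w : Om w -> holat (fun u => Zh u a) w by exact: hurwitz_hol.
have aL : 0 < a + L%:R by rewrite ltr_wpDr.
have hL w : Om w -> holat (fun u => Zh u (a + L%:R)) w by exact: hurwitz_hol.
rewrite -(cDn_eq n Om_open hz eqz Us).
have hs w : Om w -> holat (fun u => \sum_(i < L) cpow (a + i%:R) (- u)) w.
  move=> _; eexists; apply: (@cderiv_fsum _ L (fun i u => cpow (a + i%:R) (- u))) => i.
  exact: cderiv_cpow.
rewrite -(cDn_sum_cpow (fun i => a + i%:R)) -(cDnD n Om_open hs hL Us).
apply: (cDn_eq n Om_open hz) Us => w Uw.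
by apply: Zh_shiftn => //; [exact: Om_neq1|have [/andP[]] := Uw].
Qed.

End Hurwitz.

#[local] Opaque Zser Zh.

(** * The tail of the Dirichlet series *)

Section Growth.
Variable R : realType.
Notation C := R[i].
Implicit Types (s w : C) (x b X T : R).

Lemma rder_shift (F : R -> C) x t d : rder F (x + t) d -> rder (fun v => F (x + v)) t d.
Proof.
have D : is_derive t 1 (fun v : R => x + v) 1.
  rewrite -[X in is_derive _ _ _ X]add0r; apply: is_deriveD.
move=> [H1 H2]; split.
  rewrite -[Re d]mulr1; exact: (is_derive1_comp H1 D).
rewrite -[Im d]mulr1; exact: (is_derive1_comp H2 D).
Qed.

Lemma ccont_1v : ccontab 0 1 (fun v : R => (1 - v)%:C : C).
Proof.
apply: ccontP; last exact: contab_cst.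
apply: contabD; first exact: contab_cst.
by apply: contabN => t _; exact: cvg_id.
Qed.

Lemma cpow_shift_cont x w : 0 < x -> ccontab 0 1 (fun v => cpow (x + v) w).
Proof.
move=> x0 t /andP[t0 _].
have xt : 0 < x + t by exact: ltr_wpDr.
exact: rder_cont (rder_shift (rder_cpow w xt)).
Qed.

(** [Eterm_int] moved to the fixed interval [[0, 1]], so that the sum over the shifts [x = X + n]
    can be taken under a single integral. *)
Lemma Eterm_int01 s x : 0 < x -> s != 1 ->
  Eterm s x = s * cint 0 1 (fun v => (1 - v)%:C * cpow (x + v) (- (s + 1))).
Proof.
move=> x0 s1; have s10 : s - 1 != 0 by rewrite subr_eq0.
pose F v := (- (x + 1)%:C) * cpow (x + v) (- s) + (s / (s - 1)) * cpow (x + v) (1 - s).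
have pE y : 0 < y -> cpow y (- s) = y%:C * cpow y (- (s + 1)).
  by move=> y0; rewrite -(cpow1 y0) -cpowD; congr cpow; ring.
have p1E y : 0 < y -> cpow y (1 - s) = y%:C * cpow y (- s).
  by move=> y0; rewrite -(cpow1 y0) -cpowD.
have cc : ccontab 0 1 (fun v => (1 - v)%:C * cpow (x + v) (- (s + 1))).
  by apply: ccontM; [exact: ccont_1v|exact: cpow_shift_cont].
rewrite -cintZ// (@rder_FTC _ _ _ F).
- rewrite /F /Eterm addr0 (p1E _ x0) rmorphD /= (p1E (x + 1)) ?addr_gt0// rmorphD /=; field.
  exact: s10.
- exact: ler01.
- exact: ccontZ.
move=> v /andP[v0 _]; have y0 : 0 < x + v by exact: ltr_wpDr.
have -> : s * ((1 - v)%:C * cpow (x + v) (- (s + 1))) = (- (x + 1)%:C) * (- s * cpow (x + v) (- s - 1)) +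
    s / (s - 1) * ((1 - s) * cpow (x + v) (1 - s - 1)).
  rewrite (_ : 1 - s - 1 = - s); last by ring.
  rewrite (_ : - s - 1 = - (s + 1)); last by ring.
  by rewrite (pE _ y0) !rmorphD rmorphN /=; field.
by apply: rderD; apply: rderZ; [exact: (rder_shift (rder_cpow (- s) y0))|exact: (rder_shift (rder_cpow (1 - s) y0))].
Qed.

(* Integrating by parts, [Zser s X = s * int_0^1 (1 - v) Zh (s + 1) (X + v) dv]. *)
Lemma Zser_rec s X (B : R) : 0 < X -> s != 1 -> 0 < Re s ->
  (forall v, 0 <= v <= 1 -> normC (Zh (s + 1) (X + v)) <= B) ->
  normC (Zser s X) <= normC s * B.
Proof.
move=> X0 s1 s0 HB.
have Xn (n : nat) : 0 < X + n%:R by rewrite ltr_wpDr.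
pose g L v := (1 - v)%:C * (\sum_(n < L) cpow (X + n%:R + v) (- (s + 1))) : C.
have cg L : ccontab 0 1 (g L).
  apply: ccontM; first exact: ccont_1v.
  by apply: (@ccont_sum _ _ _ _ _ (fun (n : 'I_L) v => cpow (X + n%:R + v) (- (s + 1)))) => n; exact: cpow_shift_cont.
have pE L : psum s X L = s * cint 0 1 (g L).
  rewrite /psum (eq_bigr (fun n : 'I_L => s * cint 0 1 (fun v => (1 - v)%:C * cpow (X + n%:R + v) (- (s + 1))))); last first.
    by move=> n _; rewrite Eterm_int01.
  rewrite -big_distrr /= -cint_sum; last first.
    by move=> n; apply: ccontM; [exact: ccont_1v|exact: cpow_shift_cont].
  by congr (_ * _); apply: eq_cint => v _; rewrite /g big_distrr.
have s11 : 1 < Re (s + 1) by rewrite ReD /= ltrDr.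
have s1n : s + 1 != 1 by apply: contraTneq s11 => -> /=; rewrite ltxx.
have s1p : 0 < Re (s + 1) by exact: lt_trans s11.
have ns : 0 < normC s by rewrite normC_gt0; apply: contraTneq s0 => ->; rewrite ltxx.
apply: lt_eps => e e0.
set K := normC (s + 1) / Re (s + 1).
have K0 : 0 <= K by rewrite divr_ge0 ?normC_ge0 ?ltW.
have e1 : 0 < e / 2 / normC s by rewrite !divr_gt0.
have e2 : 0 < e / 2 / normC s / (K + 1) by rewrite !divr_gt0// ltr_wpDl.
have [n nP] := rpw_small X0 s0 (mulr_gt0 e1 ns).
have [m mP] := rpw_small X0 s1p e2.
apply: (@cvgC_le _ (psum s X) _ _ (maxn n m)); first exact: psum_cvg.
move=> L; rewrite geq_max => /andP[/nP h1 /mP h2].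
rewrite pE normCM -(divfK (lt0r_neq0 ns) e) [_ * normC s]mulrC -mulrDr ler_wpM2l ?normC_ge0//.
have := @cint_bound _ 0 1 (g L) (B + e / normC s) ler01 (cg L).
rewrite subr0 mulr1; apply => v /andP[v0 v1].
have Xv : 0 < X + v by exact: ltr_wpDr.
have -> : g L v = (1 - v)%:C * (Zh (s + 1) (X + v) - Zh (s + 1) (X + v + L%:R)).
  rewrite /g (Zh_shiftn L Xv s1n s1p) addrK; congr (_ * _).
  by apply: eq_bigr => i _; rewrite addrAC.
rewrite normCM normC_real ger0_norm ?subr_ge0//.
apply: (@le_trans _ _ (normC (Zh (s + 1) (X + v) - Zh (s + 1) (X + v + L%:R)))).
  by rewrite ler_piMl ?normC_ge0// gerBl.
apply: (le_trans (normCB _ _)); apply: lerD; first by apply: HB; rewrite v0 v1.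
have XL : X + L%:R <= X + v + L%:R by rewrite lerD2r lerDl.
have XvL : 0 < X + v + L%:R by exact: lt_le_trans XL.
rewrite (le_trans (Zh_bound XvL s1n s1p))//.
have -> : e / normC s = e / 2 / normC s + e / 2 / normC s by field; exact: lt0r_neq0.
rewrite lerD//.
  rewrite addrK ler_pdivrMr// (le_trans _ h1)//.
  rewrite ReD (_ : 1 - (Re s + Re 1) = - Re s) /=; last by ring.
  by apply: ler_rpwN => //; exact: ltW.
rewrite -/K (@le_trans _ _ ((K + 1) * (e / 2 / normC s / (K + 1))))//; last first.
  by rewrite mulrC divfK// lt0r_neq0// ltr_wpDl.
apply: ler_pM => //; [exact/ltW/rpw_gt0|by rewrite lerDl|rewrite (le_trans _ h2)//].
by apply: ler_rpwN => //; exact: ltW.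
Qed.

(** Each use of [Zser_rec] passes from [s] to [s + 1] and gains a factor [normC s / X <= Q / X]; the
    summand [k.+1] in the hypothesis on [Q] keeps the shifted arguments below [Q]. The pole terms
    give [T^-1] because [normC (s - 1) >= T], and each step adds 1 to the constant. *)
Lemma Zh_growth (sg T Q : R) k s X : 0 < sg <= 1 -> 0 < T -> sg <= Re s -> T <= `|Im s| ->
  normC s + k.+1%:R <= Q -> Q <= X -> 0 < X ->
  normC (Zh s X) <= (k%:R + sg^-1) * rpw X (1 - Re s) * (T^-1 + (Q / X) ^+ k.+1).
Proof.
move=> /andP[sg0 sg1] T0; elim: k s X => [|k IH] s X sgs Ts sQ QX X0.
  have s0 : 0 < Re s by exact: lt_le_trans sgs.
  have sT : T <= normC (s - 1).
    by rewrite (le_trans Ts)// (le_trans _ (normC_Im _))// ImD ImN /= subr0.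
  have s1 : s != 1.
    by rewrite -subr_eq0 -normC_gt0 (lt_le_trans T0).
  rewrite add0r expr1 (le_trans (Zh_bound X0 s1 s0))// mulrDr.
  have sg1V : 1 <= sg^-1 by rewrite invf_ge1.
  rewrite lerD//.
    rewrite mulrAC mulrC; apply: ler_wpM2r; first exact/ltW/rpw_gt0.
    rewrite -[leLHS]mul1r; apply: ler_pM => //; first by rewrite invr_ge0 normC_ge0.
    by rewrite lef_pV2 ?posrE// (lt_le_trans T0).
  rewrite rpwD (rpw1 X0).
  have -> : sg^-1 * (X * rpw X (- Re s)) * (Q / X) = sg^-1 * Q * rpw X (- Re s).
    by field; rewrite lt0r_neq0// lt0r_neq0.
  rewrite ler_wpM2r ?(ltW (rpw_gt0 _ _))// [leRHS]mulrC ler_pM ?normC_ge0 ?invr_ge0 ?(ltW s0)//.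
    by rewrite (le_trans _ sQ)// lerDl.
  by rewrite lef_pV2 ?posrE.
have s0 : 0 < Re s by exact: lt_le_trans sgs.
have sT : T <= normC (s - 1).
  by rewrite (le_trans Ts)// (le_trans _ (normC_Im _))// ImD ImN /= subr0.
have s1 : s != 1.
  by rewrite -subr_eq0 -normC_gt0 (lt_le_trans T0).
have Q0 : 0 <= Q by rewrite (le_trans _ sQ)// addr_ge0 ?normC_ge0.
have q0 : 0 <= Q / X by rewrite divr_ge0// ltW.
have q1 : Q / X <= 1 by rewrite ler_pdivrMr// mul1r.
set c := k%:R + sg^-1.
have c0 : 0 <= c by rewrite addr_ge0// invr_ge0 ltW.
have Rn : 0 < Num.sqrt 1 :> R by rewrite sqrtr1.
have H : normC (Zser s X) <= normC s * (c * rpw X (- Re s) * (T^-1 + (Q / X) ^+ k.+1)).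
  apply: Zser_rec => // v /andP[v0 v1].
  have XXv : X <= X + v by rewrite lerDl.
  have Xv : 0 < X + v by exact: lt_le_trans XXv.
  apply: (@le_trans _ _ (c * rpw (X + v) (- Re s) * (T^-1 + (Q / (X + v)) ^+ k.+1))).
    have := IH (s + 1) (X + v).
    rewrite ReD ImD /= addr0 (_ : 1 - (Re s + 1) = - Re s); last by ring.
    apply => //.
    + by rewrite (le_trans sgs)// lerDl.
    + by have := normCD s 1; rewrite normC1; move: sQ; rewrite -[k.+2%:R]natr1; lra.
    + exact: le_trans QX XXv.
  have qv : 0 <= Q / (X + v) by rewrite divr_ge0// ltW.
  apply: ler_pM.
  - by rewrite mulr_ge0// ltW// rpw_gt0.
  - by rewrite addr_ge0 ?exprn_ge0// invr_ge0 ltW.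
  - by rewrite ler_wpM2l// ler_rpwN// ltW.
  - by rewrite lerD2l ler_pXn2r ?nnegrE// ler_wpM2l// lef_pV2 ?posrE.
rewrite (le_trans (normCD _ _))// normCM normCV normC_cpowE ReD ReN /=.
have rp : 0 < rpw X (1 - Re s) by exact: rpw_gt0.
have E : rpw X (- Re s) = rpw X (1 - Re s) / X.
  by rewrite rpwD (rpw1 X0); field; exact: lt0r_neq0.
have H1 : rpw X (1 - Re s) / normC (s - 1) <= rpw X (1 - Re s) * T^-1.
  by rewrite ler_wpM2l ?(ltW rp)// lef_pV2 ?posrE// (lt_le_trans T0).
have H2 : normC s * (c * rpw X (- Re s) * (T^-1 + (Q / X) ^+ k.+1)) <=
   c * rpw X (1 - Re s) * (T^-1 + (Q / X) ^+ k.+2).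
  rewrite E; have -> : normC s * (c * (rpw X (1 - Re s) / X) * (T^-1 + (Q / X) ^+ k.+1)) =
    c * rpw X (1 - Re s) * (normC s / X * (T^-1 + (Q / X) ^+ k.+1)) by field; rewrite !lt0r_neq0.
  rewrite ler_wpM2l ?mulr_ge0 ?(ltW rp)//.
  have sX : normC s / X <= Q / X.
    by rewrite ler_wpM2r ?invr_ge0 ?(ltW X0)// (le_trans _ sQ)// lerDl.
  have t0 : 0 <= T^-1 by rewrite invr_ge0 ltW.
  have sX0 : 0 <= normC s / X by rewrite divr_ge0 ?normC_ge0// ltW.
  have p0 : 0 <= (Q / X) ^+ k.+1 by rewrite exprn_ge0.
  rewrite mulrDr [(Q / X) ^+ k.+2]exprS lerD//; last by rewrite ler_wpM2r.
  by rewrite ler_piMl// (le_trans sX).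
rewrite (le_trans (lerD H1 (le_trans H H2)))//.
rewrite (_ : k.+1%:R + sg^-1 = c + 1); last by rewrite -natr1 /c; ring.
rewrite -subr_ge0 (_ : _ - _ = rpw X (1 - Re s) * (Q / X) ^+ k.+2); last by ring.
by rewrite mulr_ge0 ?(ltW rp)// exprn_ge0.
Qed.

Lemma rpwM x y r : 0 < x -> 0 < y -> rpw (x * y) r = rpw x r * rpw y r.
Proof. by move=> x0 y0; rewrite /rpw lnM ?posrE// mulrDr expRD. Qed.

Lemma rpw_rpw x r r' : rpw (rpw x r) r' = rpw x (r * r').
Proof. by rewrite {1}/rpw /rpw expRK; congr expR; ring. Qed.

Lemma rpw0 x : rpw x 0 = 1.
Proof. by rewrite /rpw mul0r expR0. Qed.

Lemma rpwX x r n : rpw x r ^+ n = rpw x (r * n%:R).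
Proof. by rewrite /rpw -expRM_natr; congr expR; ring. Qed.

Lemma rpw_vanish (r K : R) : 0 < r -> forall e, 0 < e ->
  exists2 T0, 1 <= T0 & forall T, T0 <= T -> K * rpw T (- r) <= e.
Proof.
move=> r0 e e0; have k0 : 0 < `|K| + 1 by rewrite ltr_wpDl.
have [n nP] := rpw_small ltr01 r0 (divr_gt0 e0 k0).
exists (1 + n%:R); first by rewrite lerDl.
move=> T nT; have n1 : 0 < 1 + n%:R :> R by rewrite ltr_wpDr.
rewrite (@le_trans _ _ ((`|K| + 1) * (e / (`|K| + 1))))//; last first.
  by rewrite mulrC divfK// lt0r_neq0.
apply: (@le_trans _ _ ((`|K| + 1) * rpw T (- r))).
  by rewrite ler_wpM2r ?(ltW (rpw_gt0 _ _))// (le_trans (ler_norm _))// lerDl.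
rewrite ler_wpM2l ?(ltW k0)// (le_trans _ (nP n (leqnn n)))//.
by apply: ler_rpwN => //; exact: ltW.
Qed.

(** On a disc of radius [r] kept inside [1 / 2 <= Re s < 1], [Zh_growth] gives a bound of order
    [X ^ (1 / 2) / T], hence [T ^ (g / 2 - 1)], which vanishes because [g < 2]. The Cauchy estimate
    on this disc carries the bound over to the derivatives. *)
Lemma far_small (sg0 g : R) n : 1 / 2 < sg0 < 1 -> 1 < g < 2 -> forall e : R, 0 < e ->
  exists2 T0 : R, 1 <= T0 & forall T a tau (L : nat), T0 <= T -> 0 < a <= 1 ->
    rpw T g <= L%:R <= 2 * rpw T g -> T <= tau <= 2 * T ->
    normC (iter n (@cD R) (fun u => Zh u (a + L%:R)) (sg0 +i* tau)) <= e.
Proof.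
move=> /andP[sg1 sg2] /andP[g1 g2] e e0.
pose r := Num.min (sg0 - 1 / 2) (1 - sg0) / 2.
have r0 : 0 < r by rewrite divr_gt0// lt_min !subr_gt0 sg1 sg2.
have [r1 r2] : sg0 - r >= 1 / 2 /\ sg0 + r < 1.
  rewrite /r; have h1 : Num.min (sg0 - 1 / 2) (1 - sg0) <= sg0 - 1 / 2 by rewrite ge_min lexx.
  have h2 : Num.min (sg0 - 1 / 2) (1 - sg0) <= 1 - sg0 by rewrite ge_min lexx orbT.
  split; lra.
(* So many steps that [(3 * T / X) ^+ k.+1] is of order [1 / T] once [X >= T ^ g]; this is where
   [g > 1] enters. *)
pose k := Num.bound (2 / (g - 1)).
have kg : 2 <= (g - 1) * k.+1%:R.
  rewrite mulrC -ler_pdivrMr ?subr_gt0// ltW// (lt_le_trans (archi_boundP _))//.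
    by rewrite divr_ge0// subr_ge0 ltW.
  by rewrite ler_nat.
pose c := k%:R + (1 / 2)^-1 : R.
have c0 : 0 <= c by rewrite addr_ge0// invr_ge0.
pose K := Kc n r * (c * 3 * (2 + 3 ^+ k.+1)).
have p1 : 0 < 1 - g / 2 by lra.
have [T1 T11 T1P] := rpw_vanish K p1 e0.
have g10 : 0 < g - 1 by rewrite subr_gt0.
(* Gives [3 * T <= rpw T g <= X], the condition [Q <= X] of [Zh_growth] with [Q = 3 * T]. *)
have [T2 T21 T2P] := rpw_vanish 3 g10 (@ltr01 R).
exists (T1 + T2 + (k.+1%:R + 4)).
  by have : 0 <= k.+1%:R :> R; [|lra].
move=> T a tau L TT /andP[a0 a1] /andP[L1 L2] /andP[t1 t2].
have k10 : 0 <= k.+1%:R :> R by [].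
have T4 : k.+1%:R + 4 <= T by lra.
have T1' : 1 <= T by lra.
have T0 : 0 < T by lra.
have Tg : T <= rpw T g by rewrite -{1}(rpw1 T0) ler_rpw_exp// ltW.
set X := a + L%:R.
have X0 : 0 < X by rewrite /X; lra.
have X1 : rpw T g <= X by rewrite /X; lra.
have X3 : X <= 3 * rpw T g by rewrite /X; lra.
have aL : 0 < a + L%:R by [].
rewrite (le_trans _ (T1P T _))//; last by lra.
rewrite /K -mulrA; apply: cDn_bound => //.
  move=> s sr; have hR := le_trans (normC_Re _) sr; have hI := le_trans (normC_Im _) sr.
  move: hR hI; rewrite !ReImE /= !ler_norml => /andP[h1 h2] /andP[h3 h4].
  apply: Zh_hol => //; last by lra.
  by apply: contraTneq h3 => ->; rewrite -ltNge /= ; lra.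
move=> s sr; have hR := le_trans (normC_Re _) sr; have hI := le_trans (normC_Im _) sr.
move: hR hI; rewrite !ReImE /= !ler_norml => /andP[h1 h2] /andP[h3 h4].
have R1 : 1 / 2 <= Re s by lra.
have I1 : T / 2 <= Im s by lra.
have nsQ : normC s + k.+1%:R <= 3 * T.
  have : normC s <= `|Re s| + `|Im s| by exact: normC_le_ReIm.
  rewrite !ger0_norm; lra.
have T20 : 0 < T / 2 by rewrite divr_gt0.
have QX : 3 * T <= X.
  rewrite (le_trans _ X1)//; have := T2P T; rewrite rpwN => T2P'; have {T2P'} : 3 / rpw T (g - 1) <= 1 by apply: T2P'; lra.
  rewrite ler_pdivrMr ?rpw_gt0// mul1r => h; rewrite -{1}(rpw1 T0) (_ : g = (g - 1) + 1); last by ring.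
  by rewrite rpwD ler_wpM2r ?(ltW (rpw_gt0 _ _)).
have half : 0 < (1 / 2 : R) <= 1 by rewrite divr_gt0//= ler_pdivrMr// mul1r ler1n.
have := @Zh_growth (1 / 2) (T / 2) (3 * T) k s X half T20 R1.
rewrite ger0_norm; last by lra.
move=> /(_ I1 nsQ QX X0) H; rewrite (le_trans H)//.
have E1 : rpw X (1 - Re s) <= 3 * rpw T (g / 2).
  apply: (@le_trans _ _ (rpw X (1 / 2))).
    by apply: ler_rpw_exp; lra.
  apply: (@le_trans _ _ (rpw (3 * rpw T g) (1 / 2))).
    by apply: ler_rpw; lra.
  rewrite rpwM ?rpw_gt0// rpw_rpw mulrA mulr1 ler_wpM2r ?(ltW (rpw_gt0 _ _))//.
  by rewrite -[leRHS](rpw1 (ltr0n _ 3)) ler_rpw_exp//; lra.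
have E2 : (3 * T / X) ^+ k.+1 <= 3 ^+ k.+1 * rpw T (- 1).
  apply: (@le_trans _ _ ((3 * rpw T (- (g - 1))) ^+ k.+1)).
    have A1 : 0 <= 3 * T / X by rewrite divr_ge0 ?(ltW X0)// mulr_ge0// ltW.
    have A2 : 0 <= 3 * rpw T (- (g - 1)) by rewrite mulr_ge0// ltW// rpw_gt0.
    rewrite ler_pXn2r ?nnegrE//.
    rewrite -mulrA ler_wpM2l// opprB rpwD (rpw1 T0) ler_wpM2l ?(ltW T0)//.
    by rewrite rpwN lef_pV2 ?posrE ?rpw_gt0.
  rewrite exprMn ler_wpM2l ?exprn_ge0// rpwX ler_rpw_exp//; lra.
have E3 : (T / 2)^-1 = 2 * rpw T (-1).
  by rewrite rpwN (rpw1 T0) invfM invrK mulrC.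
have r1p := rpw_gt0 T (-1).
rewrite E3.
apply: (@le_trans _ _ (c * (3 * rpw T (g / 2)) * (2 * rpw T (-1) + 3 ^+ k.+1 * rpw T (-1)))).
  apply: ler_pM.
  - by rewrite mulr_ge0// ltW// rpw_gt0.
  - apply: addr_ge0; first by rewrite mulr_ge0// ltW.
    by apply: exprn_ge0; rewrite divr_ge0 ?(ltW X0)// mulr_ge0// ltW.
  - by rewrite ler_wpM2l.
  - by rewrite lerD2l.
rewrite le_eqVlt; apply/orP; left; apply/eqP.
have -> : - (1 - g / 2) = g / 2 + -1 by ring.
by rewrite rpwD; ring.
Qed.

End Growth.

(** * Mean squares of Dirichlet sums *)

Section MeanSquare.
Variable R : realType.
Notation C := R[i].
Implicit Types (x T : R).

Definition chr x (tau : R) : C := cexp (0 +i* (- (tau * ln x))).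

Lemma cpow_chr x (sg tau : R) : cpow x (- (sg +i* tau)) = (rpw x (- sg))%:C * chr x tau.
Proof.
rewrite /cpow /chr /rpw -cexp_real -cexpD; congr cexp.
by apply: eqC; rewrite !ReImE /=; ring.
Qed.

Definition osc (la tau : R) : C := cexp (0 +i* (tau * la)).

Lemma normC_osc la tau : normC (osc la tau) = 1.
Proof. by rewrite normC_cexp /= expR0. Qed.

Lemma oscD la mu tau : osc la tau * osc mu tau = osc (la + mu) tau.
Proof. by rewrite -cexpD; congr cexp; apply: eqC; rewrite !ReImE /=; ring. Qed.

Lemma osc0 tau : osc 0 tau = 1.
Proof. by rewrite /osc mulr0 cexp0. Qed.

Lemma conjCM (z w : C) : (cconj (z * w)) = cconj z * (cconj w).
Proof. by case: z => a b; case: w => c d; simpc; apply: eqC => /=; ring. Qed.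

Lemma conjC_sum (I : Type) (s : seq I) (F : I -> C) :
  (cconj (\sum_(i <- s) F i)) = \sum_(i <- s) (cconj (F i)).
Proof.
elim: s => [|i s IH]; first by rewrite !big_nil; apply: eqC; rewrite /= ?oppr0.
rewrite !big_cons -IH; case: (F i) => a b; case: (\sum_(_ <- _) _) => c d.
by simpc; apply: eqC => //=; ring.
Qed.

Lemma osc_conj la tau : (cconj (osc la tau)) = osc (- la) tau.
Proof. by rewrite cexp_conj; congr cexp; apply: eqC; rewrite /= ?mulrN. Qed.

Lemma chr_osc x tau : chr x tau = osc (- ln x) tau.
Proof. by rewrite /chr /osc mulrN. Qed.

Lemma osc_path la (u : R) : osc la u = cexp (0 + u%:C * (0 +i* la)).
Proof. by rewrite /osc add0r; congr cexp; apply: eqC; rewrite !ReImE /=; ring. Qed.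

Lemma osc_cont la a b : ccontab a b (osc la).
Proof.
move=> t _; have -> : osc la = (fun u => cexp (0 + u%:C * (0 +i* la))).
  by apply/funext => u; exact: osc_path.
exact: cderiv_path_cont (cderiv_cexp _).
Qed.

Lemma osc_int la a b : a <= b -> la != 0 -> normC (cint a b (osc la)) <= 2 / `|la|.
Proof.
move=> ab la0; set v : C := 0 +i* la.
have v0 : v != 0 by rewrite eq_complex /= negb_and la0 orbT.
have nv : normC v = `|la| by rewrite /v /ComplexField.Normc.normc expr0n add0r sqrtr_sqr.
have H : cint a b (fun t => cexp (0 + t%:C * v) * v) = cexp (0 + b%:C * v) - cexp (0 + a%:C * v).
  apply: (@cint_deriv_path _ (@cexp R) (@cexp R) 0 v) => //.
    by move=> t _; exact: cderiv_cexp.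
  by move=> t _; exact: cderiv_path_cont (cderiv_cexp _).
have E : v * cint a b (osc la) = osc la b - osc la a.
  rewrite -cintZ; last exact: osc_cont.
  by rewrite !osc_path -H; apply: eq_cint => t _; rewrite osc_path mulrC.
rewrite ler_pdivlMr ?normr_gt0// mulrC -nv -normCM E.
by rewrite (le_trans (normCB _ _))// !normC_osc.
Qed.

Lemma rpw_step x r : 1 < x -> 0 < r <= 1 -> r * rpw x (r - 1) <= rpw x r - rpw (x - 1) r.
Proof.
move=> x1 /andP[r0 r1]; have xm : 0 < x - 1 by rewrite subr_gt0.
have xx : x - 1 <= x by lra.
rewrite -(rpw_FTC r xm xx).
have E : r * rpw x (r - 1) = Int (x - 1) x (fun=> r * rpw x (r - 1)).
  by rewrite Int_cst// (_ : x - (x - 1) = 1) ?mulr1//; ring.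
rewrite E; apply: Int_le; first exact: contab_cst.
  apply: contabM; first exact: contab_cst.
  have := @cpow_cont R (x - 1) x (r - 1)%:C xm => /ccont_norm; congr contab.
  by apply/funext => u; rewrite normC_cpowE.
move=> t /andP[t0 t1]; rewrite ler_wpM2l ?(ltW r0)//.
rewrite -opprB; apply: ler_rpwN; [exact: lt_le_trans t0|exact: t1|lra].
Qed.

Lemma sum_rpw (r : R) L : 0 < r <= 1 -> \sum_(1 <= i < L.+1) rpw i%:R (r - 1) <= 1 + rpw L%:R r / r.
Proof.
move=> r01; have /andP[r0 r1] := r01.
case: L => [|L]; first by rewrite big_geq// addr_ge0// divr_ge0// ltW// rpw_gt0.
elim: L => [|L IH].
  by rewrite big_nat1 /rpw ln1 !mulr0 expR0 lerDl divr_ge0// ltW.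
rewrite big_nat_recr//= (le_trans (lerD IH (lexx _)))// -addrA lerD2l.
rewrite -lerBrDl -mulrBl ler_pdivlMr// mulrC.
have := @rpw_step L.+2%:R r; rewrite r01 ltr1n => /(_ isT isT).
by rewrite -[in X in _ <= _ - rpw X _]natr1 addrK.
Qed.

Lemma rpw_stepN (r : R) k : 0 < r -> (0 < k)%N ->
  rpw k.+1%:R (- (1 + r)) <= (rpw k%:R (- r) - rpw k.+1%:R (- r)) / r.
Proof.
move=> r0 k0; rewrite ler_pdivlMr// mulrC.
have pl : 0 < k%:R :> R by rewrite ltr0n.
have ll : k%:R <= k.+1%:R :> R by rewrite ler_nat.
have E1 : k.+1%:R - k%:R = 1 :> R by rewrite -natr1; ring.
have cc : contab k%:R k.+1%:R (fun u : R => rpw u (- r - 1)).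
  have := @cpow_cont R _ k.+1%:R (- r - 1)%:C pl => /ccont_norm; congr contab.
  by apply/funext => u; rewrite normC_cpowE.
have -> : r * rpw k.+1%:R (- (1 + r)) = Int k%:R k.+1%:R (fun=> r * rpw k.+1%:R (- (1 + r))).
  by rewrite Int_cst// E1 mulr1.
have -> : rpw k%:R (- r) - rpw k.+1%:R (- r) = Int k%:R k.+1%:R (fun u => r * rpw u (- r - 1)).
  rewrite -opprB -(rpw_FTC (- r) pl ll) !IntZ//; ring.
apply: Int_le; first exact: contab_cst.
  by apply: contabM => //; exact: contab_cst.
move=> t /andP[t0 t1]; rewrite ler_wpM2l ?(ltW r0)//.
rewrite (_ : - r - 1 = - (1 + r)); last by ring.
by apply: ler_rpwN => //; [exact: lt_le_trans t0|rewrite addr_ge0// ltW].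
Qed.

Lemma sum_rpwN_tail (r : R) M L : 0 < r -> (0 < M)%N ->
  \sum_(M.+1 <= i < L) rpw i%:R (- (1 + r)) <= rpw M%:R (- r) / r.
Proof.
move=> r0 M0.
have [LM|ML] := leqP L M.+1.
  by rewrite big_geq// divr_ge0// ltW// rpw_gt0.
suff H : \sum_(M.+1 <= i < L) rpw i%:R (- (1 + r)) <= (rpw M%:R (- r) - rpw L.-1%:R (- r)) / r.
  by rewrite (le_trans H)// ler_wpM2r ?invr_ge0 ?(ltW r0)// gerBl ltW// rpw_gt0.
elim: L ML => [//|L IH]; rewrite ltnS leq_eqVlt => /predU1P[<-|ML].
  by rewrite big_nat1; exact: rpw_stepN.
have L0 : (0 < L)%N by exact: leq_ltn_trans ML.
have L1 : (0 < L.-1)%N by rewrite -ltnS prednK// (leq_ltn_trans _ ML).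
rewrite big_nat_recr//=; last exact: ltnW.
rewrite (le_trans (lerD (IH ML) (lexx _)))//.
have := rpw_stepN r0 L1; rewrite prednK// => H.
rewrite (le_trans (lerD (lexx _) H))//.
by rewrite le_eqVlt; apply/orP; left; apply/eqP; ring.
Qed.

(** Expand the square: the diagonal integrates to [b - a], and each off-diagonal frequency
    [la i - la j] is nonzero by injectivity, so [osc_int] applies. *)
Lemma int_sq_sum (I : finType) (c : I -> C) (la : I -> R) a b : a <= b -> injective la ->
  Int a b (fun tau => normC (\sum_i c i * osc (la i) tau) ^+ 2) <=
  (b - a) * \sum_i normC (c i) ^+ 2 +
  2 * \sum_i \sum_(j | j != i) normC (c i) * normC (c j) / `|la i - la j|.
Proof.
move=> ab inj.
pose D tau := \sum_i c i * osc (la i) tau : C.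
have cD1 i : ccontab a b (fun tau => c i * osc (la i) tau).
  by apply: ccontZ; exact: osc_cont.
have cDD : ccontab a b D by apply: ccont_sum.
pose e i j tau := c i * (cconj (c j)) * osc (la i - la j) tau : C.
have ce i j : ccontab a b (e i j) by apply: ccontZ; exact: osc_cont.
have E tau : (normC (D tau) ^+ 2)%:C = \sum_i \sum_j e i j tau.
  rewrite -mul_conj /D conjC_sum big_distrlr /=; apply: eq_bigr => i _; apply: eq_bigr => j _.
  by rewrite conjCM osc_conj /e -oscD; ring.
have EI : (Int a b (fun tau => normC (D tau) ^+ 2))%:C = \sum_i \sum_j cint a b (e i j).
  transitivity (cint a b (fun tau => \sum_i \sum_j e i j tau)).
    apply: eqC; rewrite /cint /=.
      by apply: eq_Int => t _; rewrite -E.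
    rewrite (_ : Int a b _ = Int a b (fun=> 0)); last by apply: eq_Int => t _; rewrite -E.
    by rewrite Int_cst// mul0r.
  rewrite cint_sum; last by move=> i; exact: ccont_sum.
  by apply: eq_bigr => i _; rewrite cint_sum.
have -> : Int a b (fun tau => normC (D tau) ^+ 2) = normC (Int a b (fun tau => normC (D tau) ^+ 2))%:C.
  rewrite normC_real ger0_norm//; have <- : Int a b (fun=> 0) = 0 by rewrite Int_cst// mul0r.
  apply: Int_le; first exact: contab_cst.
    by have cn := ccont_norm cDD; have := contabM cn cn; congr contab.
  by move=> t _; rewrite sqr_ge0.
have eb i j : normC (cint a b (e i j)) = normC (c i) * normC (c j) * normC (cint a b (osc (la i - la j))).
  by rewrite cintZ; [rewrite !normCM normC_conj|exact: osc_cont].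
rewrite EI (le_trans (normC_sum _ _ _))// !mulr_sumr -big_split /= ler_sum// => i _.
rewrite (le_trans (normC_sum _ _ _))// (bigD1 i)//= lerD//.
  rewrite eb subrr (_ : cint a b (osc 0) = (b - a)%:C); last first.
    by rewrite (@eq_cint _ a b _ (fun=> 1)) ?cint_cst// ?mul1r// => t _; rewrite osc0.
  by rewrite normC_real ger0_norm ?subr_ge0// mulrC expr2.
rewrite mulr_sumr ler_sum// => j ji.
rewrite eb mulrCA -!mulrA ler_wpM2l ?normC_ge0// ler_wpM2l ?normC_ge0//.
by rewrite osc_int// subr_eq0; apply: contraNneq ji => /inj ->.
Qed.

Definition harm (L : nat) : R := \sum_(0 <= k < L) k.+1%:R^-1.

Lemma harm_le m n : (m <= n)%N -> harm m <= harm n.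
Proof.
move=> mn; rewrite /harm (big_cat_nat (leq0n m) mn)//= lerDl; apply: sumr_ge0 => k _.
by rewrite invr_ge0.
Qed.

Lemma harm_ge0 L : 0 <= harm L.
Proof. by rewrite sumr_ge0// => k _; rewrite invr_ge0. Qed.

(** A small power stands in for the logarithm, so that later only exponents of [rpw] have to be
    compared. *)
Lemma harm_rpw (e : R) L : 0 < e <= 1 -> harm L <= 1 + rpw L%:R e / e.
Proof.
move=> e01; have /andP[e0 e1] := e01.
rewrite (le_trans _ (sum_rpw L e01))// /harm big_add1 /= ler_sum_nat// => k _.
have k0 : 0 < k.+1%:R :> R by [].
rewrite -[X in X^-1](rpw1 k0) -rpwN.
by rewrite ler_rpw_exp ?ler1n//; lra.
Qed.

Lemma harm_inner L (i : 'I_L) :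
  \sum_(j < L | j != i) `|(i : nat)%:R - (j : nat)%:R|^-1 <= 2 * harm L.
Proof.
have iL := ltn_ord i.
rewrite (eq_bigl (fun j : 'I_L => (j : nat) != i)); last by move=> j.
rewrite -(big_mkord (fun j => j != i) (fun j => `|(i : nat)%:R - j%:R|^-1)).
rewrite (big_cat_nat (leq0n i) (ltnW iL))//= mulr_natl mulr2n lerD//.
  rewrite (big_nat_rev _ _ 0 i)/= add0n.
  rewrite (le_trans _ (harm_le (ltnW iL)))// /harm big_mkcond /= ler_sum_nat// => k /andP[_ ki].
  case: ifP => _; last by rewrite invr_ge0.
  rewrite natrB// opprB addrC subrK ger0_norm//.
rewrite big_ltn_cond// eqxx /= -{1}(add0n i.+1) big_addn.
rewrite (le_trans _ (harm_le (leq_subr i.+1 L)))// /harm big_mkcond /= ler_sum_nat// => k _.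
case: ifP => _; last by rewrite invr_ge0.
rewrite distrC natrD -natr1 (_ : k%:R + (i%:R + 1) - i%:R = k.+1%:R); last by rewrite -natr1; ring.
by rewrite ger0_norm.
Qed.

Lemma ln_diff x y : 0 < x -> x < y -> (y - x) / y <= ln y - ln x.
Proof.
move=> x0 xy; have y0 : 0 < y by exact: lt_trans xy.
have := expR_ge1Dx (ln x - ln y); rewrite expRD expRN !lnK ?posrE// => H.
by rewrite mulrBl divff ?lt0r_neq0//; lra.
Qed.

(** From [ln y - ln x >= (y - x) / y] with [y] the larger argument; the factor 2 comes from
    [a + j <= 2 * j]. *)
Lemma ln_ratio (a : R) i j : 0 < a <= 1 -> (0 < i)%N -> (0 < j)%N -> i != j ->
  `|ln (a + i%:R) - ln (a + j%:R)|^-1 <= 2 * (maxn i j)%:R * `|i%:R - j%:R|^-1.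
Proof.
move=> /andP[a0 a1]; wlog ij : i j / (i < j)%N.
  move=> H i0 j0 ij; have := ij; rewrite neq_ltn => /orP[h|h]; first exact: H.
  by rewrite distrC maxnC [`|i%:R - _|]distrC H// eq_sym.
move=> i0 j0 _; rewrite (maxn_idPr (ltnW ij)).
have xi : 0 < a + i%:R by rewrite ltr_wpDr.
have xij : a + i%:R < a + j%:R by rewrite ltrD2l ltr_nat.
have xj : 0 < a + j%:R by exact: lt_trans xij.
have ji : 0 < j%:R - i%:R :> R by rewrite subr_gt0 ltr_nat.
have L := ln_diff xi xij.
have E : a + j%:R - (a + i%:R) = j%:R - i%:R by ring.
rewrite E in L; have Lp : 0 < ln (a + j%:R) - ln (a + i%:R).
  by rewrite (lt_le_trans _ L)// divr_gt0.
rewrite distrC gtr0_norm// [`|i%:R - _|]distrC gtr0_norm//.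
apply: (@le_trans _ _ (((j%:R - i%:R) / (a + j%:R))^-1)).
  by rewrite lef_pV2 ?posrE// divr_gt0.
rewrite invfM invrK mulrC ler_wpM2r ?invr_ge0 ?(ltW ji)//.
have : 1 <= j%:R :> R by rewrite ler1n.
lra.
Qed.

(* The off-diagonal terms are at most [2 K^2 (i j)^(- sp) max(i, j) / |i - j|],
   and [max(i, j)^(1 - sp) <= L^(1 - sp)]. *)
Lemma dirichlet_ms (a sp K A B : R) (M L : nat) (c : nat -> C) : 0 < a <= 1 -> 1 / 2 < sp < 1 ->
  0 <= K -> A <= B -> (0 < M)%N ->
  (forall n, (0 < n)%N -> normC (c n) <= K * rpw n%:R (- sp)) ->
  Int A B (fun tau => normC (\sum_(i < L) (if (M < i)%N then c i else 0) * osc (- ln (a + (i : nat)%:R)) tau) ^+ 2) <=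
  (B - A) * (K ^+ 2 * (rpw M%:R (- (2 * sp - 1)) / (2 * sp - 1))) +
  16 * (K ^+ 2 * (rpw L%:R (1 - sp) * (1 + rpw L%:R (1 - sp) / (1 - sp)) * harm L)).
Proof.
move=> a01 /andP[s1 s2] K0 AB M0 cK; have /andP[a0 a1] := a01.
have inj : injective (fun i : 'I_L => - ln (a + (i : nat)%:R)).
  move=> i j /oppr_inj /ln_inj; rewrite !posrE !ltr_wpDr// => /(_ isT isT) /addrI /eqP.
  by rewrite eqr_nat => /eqP/val_inj.
rewrite (le_trans (int_sq_sum _ AB inj))// lerD//.
  rewrite ler_wpM2l ?subr_ge0//.
  have r0 : 0 < 2 * sp - 1 by lra.
  rewrite (le_trans _ (ler_wpM2l (sqr_ge0 K) (sum_rpwN_tail L r0 M0)))//.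
  rewrite mulr_sumr -(big_mkord xpredT (fun i => normC (if (M < i)%N then c i else 0) ^+ 2)).
  have [ML|LM] := leqP M.+1 L; last first.
    rewrite [leRHS]big_geq; last exact: ltnW.
    rewrite big_nat big1// => i /andP[_ iL].
    by rewrite ltnNge (leq_trans (ltnW iL)) // normC0 expr0n.
  rewrite (big_cat_nat (leq0n M.+1) ML)//= big_nat big1 ?add0r; last first.
    by move=> i /andP[_ iM]; rewrite ltnNge -ltnS iM normC0 expr0n.
  rewrite ler_sum_nat// => i /andP[Mi _]; rewrite Mi.
  have i0 : (0 < i)%N by exact: leq_ltn_trans Mi.
  apply: (@le_trans _ _ ((K * rpw i%:R (- sp)) ^+ 2)).
    by rewrite ler_pXn2r ?nnegrE ?normC_ge0 ?cK// mulr_ge0// ltW// rpw_gt0.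
  by rewrite exprMn rpwX ler_wpM2l ?sqr_ge0// (_ : - sp * 2 = - (1 + (2 * sp - 1))) //; ring.
pose d (i : nat) := if (M < i)%N then c i else 0.
(* Index 0 is dropped because [sum_rpw] starts at 1; the factors [d] vanish there anyway. *)
pose w (i : nat) := if (0 < i)%N then rpw i%:R (- sp) else 0.
have w0 i : 0 <= w i by rewrite /w; case: ifP => // _; rewrite ltW// rpw_gt0.
have L0 : 0 <= rpw L%:R (1 - sp) by rewrite ltW// rpw_gt0.
have dij (i j : 'I_L) : j != i ->
  normC (d i) * normC (d j) / `|- ln (a + (i : nat)%:R) - - ln (a + (j : nat)%:R)| <=
  2 * K ^+ 2 * rpw L%:R (1 - sp) * (w i * `|(i : nat)%:R - (j : nat)%:R|^-1 + w j * `|(i : nat)%:R - (j : nat)%:R|^-1).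
  move=> ji.
  have rhs0 : 0 <= 2 * K ^+ 2 * rpw L%:R (1 - sp) * (w i * `|(i : nat)%:R - (j : nat)%:R|^-1 + w j * `|(i : nat)%:R - (j : nat)%:R|^-1).
    by rewrite !mulr_ge0 ?sqr_ge0// addr_ge0// mulr_ge0// invr_ge0.
  rewrite {1}/d; case: (ltnP M i) => Mi; last by rewrite normC0 !mul0r.
  rewrite {1}/d; case: (ltnP M j) => Mj; last by rewrite normC0 mulr0 mul0r.
  have i0 : (0 < i)%N by exact: leq_ltn_trans Mi.
  have j0 : (0 < j)%N by exact: leq_ltn_trans Mj.
  rewrite /w i0 j0.
  have E : `|- ln (a + (i : nat)%:R) - - ln (a + (j : nat)%:R)| = `|ln (a + (i : nat)%:R) - ln (a + (j : nat)%:R)|.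
    by rewrite -opprD normrN.
  rewrite E -mulrDl.
  have P1 : normC (c i) * normC (c j) <= K ^+ 2 * (rpw (i : nat)%:R (- sp) * rpw (j : nat)%:R (- sp)).
    rewrite (_ : K ^+ 2 * _ = (K * rpw (i : nat)%:R (- sp)) * (K * rpw (j : nat)%:R (- sp))); last by ring.
    by rewrite ler_pM ?normC_ge0 ?cK.
  have ij : (i : nat) != j by rewrite eq_sym; exact: ji.
  have P2 := @ln_ratio a i j a01 i0 j0 ij.
  apply: (@le_trans _ _ ((K ^+ 2 * (rpw (i : nat)%:R (- sp) * rpw (j : nat)%:R (- sp))) *
     (2 * (maxn i j)%:R * `|(i : nat)%:R - (j : nat)%:R|^-1))).
    by apply: ler_pM => //; rewrite mulr_ge0// normC_ge0.
  have inv0 : 0 <= `|(i : nat)%:R - (j : nat)%:R|^-1 :> R by rewrite invr_ge0.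
  have key : rpw (i : nat)%:R (- sp) * rpw (j : nat)%:R (- sp) * (maxn i j)%:R <=
     rpw L%:R (1 - sp) * (rpw (i : nat)%:R (- sp) + rpw (j : nat)%:R (- sp)).
    have B1 (k : 'I_L) : (0 < k)%N -> rpw (k : nat)%:R (- sp) * (k : nat)%:R <= rpw L%:R (1 - sp).
      move=> k0; have kp : 0 < (k : nat)%:R :> R by rewrite ltr0n.
      rewrite -{2}(rpw1 kp) -rpwD addrC ler_rpw// ?ler_nat; [exact: ltnW|lra].
    have p1 := rpw_gt0 (i : nat)%:R (- sp); have p2 := rpw_gt0 (j : nat)%:R (- sp).
    rewrite mulrDr /maxn; case: ifP => _.
      have := B1 _ j0 => h; rewrite -mulrA mulrC (le_trans (ler_wpM2r (ltW p1) h))// lerDl mulr_ge0// ltW//.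
    have := B1 _ i0 => h; rewrite mulrAC (le_trans (ler_wpM2r (ltW p2) h))// lerDr mulr_ge0// ltW//.
  rewrite (_ : _ * (2 * (maxn i j)%:R * _) = 2 * K ^+ 2 * (`|(i : nat)%:R - (j : nat)%:R|^-1 *
    (rpw (i : nat)%:R (- sp) * rpw (j : nat)%:R (- sp) * (maxn i j)%:R))); last by ring.
  rewrite (_ : 2 * K ^+ 2 * rpw L%:R (1 - sp) * _ = 2 * K ^+ 2 * (`|(i : nat)%:R - (j : nat)%:R|^-1 *
    (rpw L%:R (1 - sp) * (rpw (i : nat)%:R (- sp) + rpw (j : nat)%:R (- sp))))); last by ring.
  rewrite ler_wpM2l ?mulr_ge0 ?sqr_ge0//; exact: ler_wpM2l.
have S1 : \sum_(i < L) \sum_(j < L | j != i) (w i * `|(i : nat)%:R - (j : nat)%:R|^-1) <=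
   (1 + rpw L%:R (1 - sp) / (1 - sp)) * (2 * harm L).
  apply: (@le_trans _ _ (\sum_(i < L) w i * (2 * harm L))).
    by apply: ler_sum => i _; rewrite -mulr_sumr ler_wpM2l// harm_inner.
  rewrite -mulr_suml ler_wpM2r ?mulr_ge0 ?harm_ge0//.
  have r1 : 0 < 1 - sp <= 1 by apply/andP; split; lra.
  rewrite (le_trans _ (sum_rpw L r1))// -(big_mkord xpredT w).
  case: (L) => [|L']; first by rewrite !big_geq.
  rewrite big_ltn//= {1}/w /= add0r [leRHS]big_nat_recr//= ler_wpDr ?(ltW (rpw_gt0 _ _))//.
  rewrite ler_sum_nat// => i /andP[i0 _]; rewrite /w i0 (_ : 1 - sp - 1 = - sp)//; ring.
have S2 : \sum_(i < L) \sum_(j < L | j != i) (w j * `|(i : nat)%:R - (j : nat)%:R|^-1) <=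
   (1 + rpw L%:R (1 - sp) / (1 - sp)) * (2 * harm L).
  rewrite (exchange_big_dep xpredT)//= (le_trans _ S1)//.
  apply: ler_sum => i _; rewrite le_eqVlt; apply/orP; left; apply/eqP.
  by apply: eq_big => [j|j _]; [rewrite eq_sym|rewrite distrC].
have K20 : 0 <= 2 * K ^+ 2 * rpw L%:R (1 - sp) by rewrite !mulr_ge0 ?sqr_ge0.
apply: (@le_trans _ _ (2 * (2 * K ^+ 2 * rpw L%:R (1 - sp) *
   ((1 + rpw L%:R (1 - sp) / (1 - sp)) * (2 * harm L) + (1 + rpw L%:R (1 - sp) / (1 - sp)) * (2 * harm L))))).
  rewrite ler_wpM2l//.
  apply: (@le_trans _ _ (\sum_(i < L) \sum_(j < L | j != i) 2 * K ^+ 2 * rpw L%:R (1 - sp) *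
     (w i * `|(i : nat)%:R - (j : nat)%:R|^-1 + w j * `|(i : nat)%:R - (j : nat)%:R|^-1))).
    by apply: ler_sum => i _; apply: ler_sum => j ji; exact: dij.
  under eq_bigr do rewrite -mulr_sumr big_split.
  by rewrite -mulr_sumr big_split /= ler_wpM2l// lerD.
by rewrite le_eqVlt; apply/orP; left; apply/eqP; ring.
Qed.

End MeanSquare.

(** * Relations between the logarithms *)

Section Relations.
Variable R : realType.

(* [a] satisfies no nontrivial relation [sum_(n < M) k_n log (n + a) = 0] with
   [k_n] an integer and [|k_n| <= K]; the exponents are [k_n = f n - g n]. *)
Definition norel (K M : nat) (a : R) := forall f g : 'I_M -> nat,
  (forall n, (f n <= K)%N) -> (forall n, (g n <= K)%N) ->
  \sum_(n < M) (f n)%:R * ln (a + (n : nat)%:R) = \sum_(n < M) (g n)%:R * ln (a + (n : nat)%:R) ->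
  forall n, f n = g n.

(* [prod_n (X + n) ^ f n]: a relation between the logarithms says that two of
   these agree at [a]. *)
Definition relpoly (M : nat) (f : 'I_M -> nat) : {poly R} :=
  \prod_(n < M) ('X - (- (n : nat)%:R)%:P) ^+ f n.

Lemma relpolyE M (f : 'I_M -> nat) a : 0 < a ->
  (relpoly f).[a] = expR (\sum_(n < M) (f n)%:R * ln (a + (n : nat)%:R)).
Proof.
move=> a0; rewrite /relpoly horner_prod expR_sum; apply: eq_bigr => n _.
by rewrite horner_exp hornerXsubC opprK expRM_natl lnK// posrE ltr_wpDr.
Qed.

(** The roots [- n] are distinct, so multiplicities recover the exponents and different exponent
    vectors give different polynomials. *)
Lemma mup_relpoly M (f : 'I_M -> nat) (n : 'I_M) : mup (- (n : nat)%:R) (relpoly f) = f n.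
Proof.
have H : relpoly f != 0 /\
  mup (- (n : nat)%:R) (relpoly f) = (\sum_(m < M) (if m == n then f m else 0))%N.
  rewrite /relpoly; elim/big_rec2 : _ => [|m s q _ [q0 qs]].
    by rewrite oner_eq0 mupNroot// root1.
  have p0 : ('X - (- (m : nat)%:R)%:P) ^+ f m != 0 :> {poly R}.
    by rewrite expf_neq0// polyXsubC_eq0.
  split; first by rewrite mulf_neq0.
  rewrite mupM// qs; congr addn; rewrite mup_XsubCX eqr_opp eqr_nat.
  by rewrite (inj_eq val_inj).
by rewrite H.2 -big_mkcond big_pred1_eq.
Qed.

Lemma relpoly_neq M (f g : 'I_M -> nat) n : f n != g n -> relpoly f != relpoly g.
Proof. by apply: contraNneq => E; rewrite -(mup_relpoly f) -(mup_relpoly g) E. Qed.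

Lemma poly_roots_seq (p : {poly R}) : p != 0 -> exists s : seq R, forall a, root p a -> a \in s.
Proof.
have [n] := ubnP (size p); elim: n p => // n IH p; rewrite ltnS => pn p0.
have [[a pa]|np] := pselect (exists a, root p a); last first.
  by exists [::] => a pa; exfalso; apply: np; exists a.
have /factor_theorem[q qE] := pa.
have q0 : q != 0 by apply: contraNneq p0 => q0; rewrite qE q0 mul0r.
have [|s sP] := IH q _ q0.
  by rewrite (leq_trans _ pn)// qE size_Mmonic ?monicXsubC// size_XsubC addn2.
exists (a :: s) => b; rewrite qE rootM root_XsubC inE => /orP[/sP ->|->//].
by rewrite orbT.
Qed.

Lemma rel_finite K M : finite_set [set a : R | 0 < a /\ ~ norel K M a].
Proof.
pose T := ({ffun 'I_M -> 'I_K.+1} * {ffun 'I_M -> 'I_K.+1})%type.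
pose P (t : T) := relpoly (fun n => t.1 n : nat) - relpoly (fun n => t.2 n : nat).
apply: (@sub_finite_set _ _ (\bigcup_(t in [set t : T | P t != 0]) [set a | root (P t) a])).
  move=> a [a0 /existsNP[f /existsNP[g]]].
  move=> /not_implyP[fK /not_implyP[gK /not_implyP[E /existsNP[n /eqP fg]]]].
  pose t : T := ([ffun n => inord (f n)], [ffun n => inord (g n)]).
  have t1 : (fun n => t.1 n : nat) = f by apply/funext => m; rewrite ffunE inordK// ltnS.
  have t2 : (fun n => t.2 n : nat) = g by apply/funext => m; rewrite ffunE inordK// ltnS.
  exists t; rewrite /= /P t1 t2.
    by rewrite subr_eq0; exact: relpoly_neq fg.
  by rewrite /root hornerD hornerN !relpolyE// E subrr.
apply: bigcup_finite; first exact: finite_finset.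
move=> t /= Pt.
have [s sP] := poly_roots_seq Pt.
apply: (@sub_finite_set _ _ [set` s]); first by move=> a /sP.
exact: finite_seq.
Qed.

End Relations.

(** * The weight *)

Section Mean.
Variable R : realType.
Notation C := R[i].

(** Averages run over [[T, 2 * T]], where [tau] is comparable with [T] as [far_small] requires. *)
Definition cmean (F : R -> C) (l : C) := forall e : R, 0 < e ->
  exists2 T0 : R, 1 <= T0 & forall T, T0 <= T -> normC (cint T (2 * T) F - T%:C * l) <= e * T.

Lemma cmeanD F G l m : (forall a b, ccontab a b F) -> (forall a b, ccontab a b G) ->
  cmean F l -> cmean G m -> cmean (fun t => F t + G t) (l + m).
Proof.
move=> cF cG HF HG e e0; have e20 : 0 < e / 2 by rewrite divr_gt0.
have [T1 T11 T1P] := HF _ e20; have [T2 T21 T2P] := HG _ e20.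
exists (Num.max T1 T2); first by rewrite le_max T11.
move=> T; rewrite ge_max => /andP[/T1P h1 /T2P h2].
rewrite cintD// (_ : _ - _ = (cint T (2 * T) F - T%:C * l) + (cint T (2 * T) G - T%:C * m)); last by ring.
by rewrite (le_trans (normCD _ _))// (le_trans (lerD h1 h2))// -mulrDl -splitr.
Qed.

Lemma cmeanZ (k : C) F l : (forall a b, ccontab a b F) -> cmean F l -> cmean (fun t => k * F t) (k * l).
Proof.
move=> cF H e e0; have k0 : 0 < normC k + 1 by rewrite ltr_wpDl ?normC_ge0.
have [T0 T01 TP] := H _ (divr_gt0 e0 k0); exists T0 => // T TT.
rewrite cintZ// (_ : _ - _ = k * (cint T (2 * T) F - T%:C * l)); last by ring.
rewrite normCM (le_trans (ler_wpM2l (normC_ge0 _) (TP T TT)))//.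
have T0' : 0 <= T by rewrite (le_trans _ TT)// (le_trans _ T01).
rewrite mulrA ler_wpM2r// mulrCA ler_piMr ?(ltW e0)// ler_pdivrMr// mul1r lerDl//.
Qed.

Lemma cmean_sum (I : Type) (s : seq I) (F : I -> R -> C) (l : I -> C) :
  (forall i a b, ccontab a b (F i)) -> (forall i, cmean (F i) (l i)) ->
  cmean (fun t => \sum_(i <- s) F i t) (\sum_(i <- s) l i).
Proof.
move=> cF H; elim: s => [|i s IH].
  rewrite big_nil => e e0; exists 1 => // T T1.
  rewrite (@eq_cint _ _ _ _ (fun=> 0)); last by move=> t _; rewrite big_nil.
  rewrite cint_cst ?mul0r ?mulr0 ?subrr ?normC0; last by lra.
  by rewrite mulr_ge0 ?(ltW e0)//; lra.
rewrite big_cons (_ : (fun t => _) = (fun t => F i t + \sum_(i <- s) F i t)); last first.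
  by apply/funext => t; rewrite big_cons.
by apply: cmeanD => // a b; exact: ccont_sum.
Qed.

Lemma cmean_osc la : cmean (osc la) (la == 0)%:R.
Proof.
have [->|la0] := eqVneq la 0.
  move=> e e0; exists 1 => // T T1; rewrite mulr1.
  rewrite (@eq_cint _ _ _ _ (fun=> 1)); last by move=> t _; rewrite osc0.
  rewrite cint_cst; last by lra.
  rewrite mul1r (_ : 2 * T - T = T) ?subrr ?normC0; last by ring.
  by rewrite mulr_ge0 ?(ltW e0)//; lra.
move=> e e0; exists (1 + 2 / `|la| / e); first by rewrite lerDl !divr_ge0// ltW.
move=> T TT; rewrite mulr0 subr0.
have T1 : 1 <= T by rewrite (le_trans _ TT)// lerDl !divr_ge0// ltW.
rewrite (le_trans (osc_int _ la0))//; first by lra.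
rewrite -ler_pdivrMl// mulrC (le_trans _ TT)// lerDr//.
Qed.

(** A trigonometric polynomial of degree at most [K], stored as an ordinary polynomial shifted by
    [K]: the constant term is the central coefficient, at index [K]. *)
Definition tp (K : nat) (P : {poly C}) (la tau : R) : C :=
  \sum_(k < K.*2.+1) P`_k * osc (((k : nat)%:R - K%:R) * la) tau.

Lemma tp_cont K P la a b : ccontab a b (tp K P la).
Proof. by apply: ccont_sum => i; apply: ccontZ; exact: osc_cont. Qed.

Lemma oscX (la tau : R) n : osc la tau ^+ n = osc (n%:R * la) tau.
Proof.
elim: n => [|n IH]; first by rewrite expr0 mul0r osc0.
by rewrite exprS IH oscD -natr1; congr osc; ring.
Qed.

Lemma osc_neq0 (la tau : R) : osc la tau != 0.
Proof. exact: cexp_neq0. Qed.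

Lemma oscV (la tau : R) : (osc la tau)^-1 = osc (- la) tau.
Proof.
by apply: (mulfI (osc_neq0 la tau)); rewrite mulfV ?osc_neq0// oscD subrr osc0.
Qed.

Lemma tpE K (P : {poly C}) la tau : (size P <= K.*2.+1)%N ->
  tp K P la tau = P.[osc la tau] * (osc la tau)^-1 ^+ K.
Proof.
move=> sP; rewrite (horner_coef_wide _ sP) mulr_suml; apply: eq_bigr => k _.
rewrite -mulrA oscX oscV oscX oscD; congr (_ * osc _ _); ring.
Qed.

(** Multiplying out gives one oscillation for each choice [f] of exponents. A vanishing frequency is
    a relation between [f] and the constant exponent [K], so [norel] leaves only [f = K], that is,
    the product of the central coefficients. *)
Lemma tp_mean_prod (K M : nat) (a : R) (P : 'I_M -> {poly C}) : norel K.*2 M a ->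
  cmean (fun tau => \prod_(n < M) tp K (P n) (- ln (a + (n : nat)%:R)) tau) (\prod_(n < M) (P n)`_K).
Proof.
move=> nr; pose la (n : 'I_M) : R := - ln (a + (n : nat)%:R).
pose L (f : {ffun 'I_M -> 'I_K.*2.+1}) := \sum_n ((f n : nat)%:R - K%:R) * la n.
have E tau : \prod_(n < M) tp K (P n) (la n) tau =
    \sum_(f : {ffun 'I_M -> 'I_K.*2.+1}) (\prod_n (P n)`_(f n)) * osc (L f) tau.
  rewrite /tp bigA_distr_bigA /=; apply: eq_bigr => f _.
  rewrite big_split /=; congr (_ * _); rewrite /L.
  elim/big_rec2 : _ => [|n x y _ ->]; first by rewrite osc0.
  by rewrite oscD.
have KK : (K < K.*2.+1)%N by rewrite ltnS -addnn leq_addr.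
pose f0 : {ffun 'I_M -> 'I_K.*2.+1} := [ffun=> Ordinal KK].
have L0 f : (L f == 0) = (f == f0).
  apply/eqP/eqP => [Lf|->]; last first.
    by rewrite /L big1// => n _; rewrite ffunE subrr mul0r.
  apply/ffunP => n; rewrite ffunE; apply/val_inj => /=.
  apply: (nr (fun n => f n : nat) (fun=> K)).
  - by move=> m; rewrite -ltnS ltn_ord.
  - by move=> m; rewrite -addnn leq_addr.
  apply/eqP; rewrite -subr_eq0 -sumrB -oppr_eq0 -sumrN.
  rewrite -[X in _ == X]Lf /L; apply/eqP; apply: eq_bigr => m _.
  by rewrite /la; ring.
have -> : (fun tau => \prod_(n < M) tp K (P n) (- ln (a + (n : nat)%:R)) tau) =
   (fun tau => \sum_(f : {ffun 'I_M -> 'I_K.*2.+1}) (\prod_n (P n)`_(f n)) * osc (L f) tau).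
  by apply/funext => tau; rewrite -E.
have -> : \prod_(n < M) (P n)`_K =
   \sum_(f : {ffun 'I_M -> 'I_K.*2.+1}) (\prod_n (P n)`_(f n)) * (L f == 0)%:R.
  rewrite (bigD1 f0)//= L0 eqxx mulr1 [X in _ + X]big1 ?addr0; last first.
    by move=> f ff; rewrite L0 (negPf ff) mulr0.
  by apply: eq_bigr => n _; rewrite ffunE.
have H := (@cmean_sum _ (index_enum {ffun 'I_M -> 'I_K.*2.+1}) (fun f tau => (\prod_n (P n)`_(f n)) * osc (L f) tau)
   (fun f => (\prod_n (P n)`_(f n)) * (L f == 0)%:R)).
apply: H.
  by move=> f x y; apply: ccontZ; exact: osc_cont.
by move=> f; apply: cmeanZ; [move=> x y; exact: osc_cont|exact: cmean_osc].
Qed.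

(* [B.[e] / e ^ K] is the density of a probability measure on the unit circle
   with mean [mu], bounded by [W]. *)
Definition density (K : nat) (B : {poly C}) (mu : C) (W : R) := [/\ (0 < K)%N,
  [/\ (size B <= K.*2.+1)%N, B`_K = 1, B`_K.-1 = mu & B`_K.+1 = cconj mu] &
  forall e, normC e = 1 -> exists2 r : R, 0 <= r <= W & B.[e] * e^-1 ^+ K = r%:C].

Section weight.
Variables (K M : nat) (a : R) (B : 'I_M -> {poly C}) (mu : 'I_M -> C) (W : 'I_M -> R).
Hypothesis nr : norel K.+1.*2 M a.
Hypothesis dB : forall n, density K (B n) (mu n) (W n).

Let la (n : 'I_M) : R := - ln (a + (n : nat)%:R).

Definition wgt (tau : R) : C := \prod_(n < M) ((B n).[osc (la n) tau] * (osc (la n) tau)^-1 ^+ K).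

Definition rwgt (tau : R) : R := Re (wgt tau).

Lemma wgt_real tau : wgt tau = (rwgt tau)%:C /\ 0 <= rwgt tau <= \prod_(n < M) W n.
Proof.
have [f fP] : exists f : 'I_M -> R, forall n, 0 <= f n <= W n /\
    (B n).[osc (la n) tau] * (osc (la n) tau)^-1 ^+ K = (f n)%:C.
  have H n : exists r : R, 0 <= r <= W n /\ (B n).[osc (la n) tau] * (osc (la n) tau)^-1 ^+ K = r%:C.
    by have [_ _ /(_ (osc (la n) tau))] := dB n; rewrite normC_osc => /(_ erefl)[r ? ?]; exists r.
  by exists (fun n => projT1 (cid (H n))) => n; case: cid.
have E : wgt tau = (\prod_(n < M) f n)%:C.
  by rewrite /wgt rmorph_prod; apply: eq_bigr => n _; have [_ ->] := fP n.
rewrite /rwgt E /=; split=> //; apply/andP; split.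
  by apply: prodr_ge0 => n _; have [/andP[]] := fP n.
by apply: ler_prod => n _; have [] := fP n.
Qed.

Lemma sizeMl (P Q : {poly C}) k : (size P <= k)%N -> (size Q <= 2)%N -> (size (P * Q)%R <= k.+1)%N.
Proof.
move=> h hQ; rewrite (leq_trans (size_polyMleq _ _))// -subn1 leq_subLR add1n.
by rewrite (leq_trans (leq_add h hQ))// addn2.
Qed.

Definition lfac n : {poly C} := 'X - (mu n)%:P.
Definition rfac n : {poly C} := 1 - cconj (mu n) *: 'X.

Lemma size_lfac n : (size (lfac n) <= 2)%N. Proof. by rewrite size_XsubC. Qed.

Lemma size_rfac n : (size (rfac n) <= 2)%N.
Proof.
rewrite (leq_trans (size_polyD _ _))// geq_max size_poly1 size_polyN /=.
by rewrite (leq_trans (size_scale_leq _ _))// size_polyX.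
Qed.

Lemma size2 k : (k.+1.*2.+1 = k.*2.+1.+2)%N. Proof. by rewrite doubleS. Qed.

(* The densities multiplied by [1], [e - mu], [conj (e - mu)] and
   [|e - mu| ^ 2], all brought to the common denominator [e ^ (K + 1)]. *)
Definition sel (l r : bool) n : {poly C} :=
  (if l then B n * lfac n else B n) * (if r then rfac n else 'X).

Lemma size_sel l r n : (size (sel l r n) <= K.+1.*2.+1)%N.
Proof.
have [_ [sB _ _ _] _] := dB n; rewrite size2 /sel.
have h : (size (if l then (B n * lfac n)%R else B n) <= K.*2.+2)%N.
  by case: l; [apply: sizeMl => //; exact: size_lfac|exact: leq_trans sB _].
by case: r; apply: sizeMl => //; [exact: size_rfac|rewrite size_polyX].
Qed.

(** Central coefficients are means: [e - mu] and its conjugate have mean 0, and on the unit circle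
    their product has mean [1 - |mu| ^ 2]. *)
Lemma sel_coef l r n : (sel l r n)`_K.+1 =
  if l then (if r then 1 - mu n * cconj (mu n) else 0) else (if r then 0 else 1).
Proof.
have [K0 [_ B0 B1 B2] _] := dB n.
have cX (P : {poly C}) k : (P * 'X)`_k.+1 = P`_k by rewrite coefMX.
have cr (P : {poly C}) k : (P * rfac n)`_k.+1 = P`_k.+1 - cconj (mu n) * P`_k.
  by rewrite mulrBr mulr1 coefB -scalerAr coefZ cX.
have cl k : (B n * lfac n)`_k.+1 = (B n)`_k - mu n * (B n)`_k.+1.
  by rewrite mulrBr coefB cX mulrC coefCM.
have clK : (B n * lfac n)`_K = 0.
  by rewrite -(prednK K0) cl prednK// B0 B1 mulr1 subrr.
rewrite /sel; case: l; case: r; rewrite ?cX ?cr ?clK ?B0 ?B2.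
- by rewrite cl B0 B2 mulr0 subr0.
- by [].
- by rewrite mulr1 subrr.
- by [].
Qed.

Lemma sel_tp l r n tau : tp K.+1 (sel l r n) (la n) tau =
  ((B n).[osc (la n) tau] * (osc (la n) tau)^-1 ^+ K) *
  ((if l then osc (la n) tau - mu n else 1) * (if r then cconj (osc (la n) tau - mu n) else 1)).
Proof.
rewrite tpE ?size_sel//; set e := osc (la n) tau; have e0 : e != 0 by exact: osc_neq0.
have ce : cconj e = e^-1 by rewrite /e osc_conj oscV.
have conjB : cconj (e - mu n) = e^-1 - cconj (mu n).
  by rewrite -ce; case: (e) => x y; case: (mu n) => z w; rewrite /cconj /=; simpc; apply: eqC => //=; ring.
have hl : (lfac n).[e] = e - mu n by rewrite hornerXsubC.
have hr : (rfac n).[e] = 1 - cconj (mu n) * e by rewrite hornerD hornerN hornerZ hornerX hornerC.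
rewrite /sel exprS conjB; case: l; case: r; rewrite !hornerM ?hl ?hr ?hornerX; field; exact: e0.
Qed.

Lemma prod_if (n : 'I_M) (x : 'I_M -> C) : \prod_k (if k == n then x k else 1) = x n.
Proof. by rewrite -big_mkcond big_pred1_eq. Qed.

(** The phases are uncorrelated under the weight: for [n != m] the factor at [n] already has mean 0.
    A factor may be multiplied by both [e - mu] and its conjugate, which raises the degree from [K]
    to [K.+1] and explains the size of the relations in [nr]. *)
Lemma wgt_mean_pair n m :
  cmean (fun tau => wgt tau * ((osc (la n) tau - mu n) * cconj (osc (la m) tau - mu m)))
    (if n == m then 1 - mu n * cconj (mu n) else 0).
Proof.
have := tp_mean_prod (fun k => sel (k == n) (k == m) k) nr.
have -> : \prod_(k < M) (sel (k == n) (k == m) k)`_K.+1 = if n == m then 1 - mu n * cconj (mu n) else 0.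
  under eq_bigr do rewrite sel_coef.
  case: eqVneq => [<-|nm].
    rewrite -[RHS](prod_if n (fun k => 1 - mu k * cconj (mu k))); apply: eq_bigr => k _.
    by case: eqP.
  by rewrite (bigD1 n)//= eqxx (negPf nm) mul0r.
congr cmean; apply/funext => tau; under eq_bigr do rewrite sel_tp.
rewrite big_split /= [X in _ * X]big_split /= -/(wgt tau).
rewrite (prod_if n (fun k => osc (la k) tau - mu k)).
by rewrite (prod_if m (fun k => cconj (osc (la k) tau - mu k))).
Qed.

Lemma wgt_mean : cmean wgt 1.
Proof.
have := tp_mean_prod (fun k => sel false false k) nr.
under eq_bigr do rewrite sel_coef.
rewrite big1//; congr cmean; apply/funext => tau; apply: eq_bigr => k _.
by rewrite sel_tp !mulr1.
Qed.

Lemma wgt_cont x y : ccontab x y wgt.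
Proof.
have -> : wgt = (fun tau => \prod_(k < M) tp K (B k) (la k) tau).
  apply/funext => tau; apply: eq_bigr => k _; rewrite tpE//.
  by have [_ []] := dB k.
by apply: ccont_prod => k; exact: tp_cont.
Qed.

Lemma rwgt_cont x y : contab x y rwgt. Proof. exact: ccontRe (@wgt_cont x y). Qed.

(** The variance of a sum of uncorrelated variables: by [wgt_mean_pair] only the diagonal of the
    expanded square survives in the mean. *)
Lemma second_moment (v : 'I_M -> C) (e : R) : 0 < e -> exists2 T0 : R, 1 <= T0 & forall T, T0 <= T ->
  Int T (2 * T) (fun tau => rwgt tau * normC (\sum_(n < M) v n * (osc (la n) tau - mu n)) ^+ 2) <=
  T * (\sum_(n < M) normC (v n) ^+ 2 * (1 - normC (mu n) ^+ 2) + e).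
Proof.
move=> e0.
pose F (p : 'I_M * 'I_M) tau := v p.1 * cconj (v p.2) *
   (wgt tau * ((osc (la p.1) tau - mu p.1) * cconj (osc (la p.2) tau - mu p.2))) : C.
have co n x y : ccontab x y (fun tau => osc (la n) tau - mu n).
  by apply: ccontB; [exact: osc_cont|exact: ccont_cst].
have cg p x y : ccontab x y (fun tau => wgt tau * ((osc (la p.1) tau - mu p.1) * cconj (osc (la p.2) tau - mu p.2)) : C).
  apply: ccontM; first exact: wgt_cont.
  by apply: ccontM; [exact: co|apply: ccont_conj; exact: co].
have cF p x y : ccontab x y (F p) by apply: ccontZ; exact: cg.
have := @cmean_sum _ (enum {: 'I_M * 'I_M}) F (fun p => v p.1 * cconj (v p.2) * (if p.1 == p.2 then 1 - mu p.1 * cconj (mu p.1) else 0)) cF.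
move=> /(_ _ e e0)[].
  by move=> p; apply: cmeanZ; [move=> x y; exact: cg|exact: wgt_mean_pair].
move=> T0 T01 TP; exists T0 => // T TT; have {TP} := TP T TT.
rewrite !big_enum /=.
have -> : \sum_p v p.1 * cconj (v p.2) * (if p.1 == p.2 then 1 - mu p.1 * cconj (mu p.1) else 0) =
   (\sum_(n < M) normC (v n) ^+ 2 * (1 - normC (mu n) ^+ 2))%:C :> C.
  rewrite -(pair_bigA _ (fun n m => v n * cconj (v m) * (if n == m then 1 - mu n * cconj (mu n) else 0))) /=.
  rewrite rmorph_sum; apply: eq_bigr => n _; rewrite (bigD1 n)//= eqxx big1 ?addr0.
    by rewrite !mul_conj; apply: eqC; rewrite !ReImE /=; ring.
  by move=> m mn; rewrite eq_sym (negPf mn) mulr0.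
set S := \sum_(n < M) _.
have -> : cint T (2 * T) (fun tau => \sum_(p <- enum {: 'I_M * 'I_M}) F p tau) =
  (Int T (2 * T) (fun tau => rwgt tau * normC (\sum_(n < M) v n * (osc (la n) tau - mu n)) ^+ 2))%:C.
  have E tau : \sum_(p <- enum {: 'I_M * 'I_M}) F p tau =
     (rwgt tau * normC (\sum_(n < M) v n * (osc (la n) tau - mu n)) ^+ 2)%:C.
    have hQ (r : R) (Q : C) : (r * normC Q ^+ 2)%:C = r%:C * (Q * cconj Q).
      by rewrite mul_conj; apply: eqC; rewrite !ReImE /=; ring.
    rewrite hQ conjC_sum big_distrlr /= -(wgt_real tau).1 big_enum /=.
    rewrite (pair_bigA _ (fun i j => v i * (osc (la i) tau - mu i) * cconj (v j * (osc (la j) tau - mu j)))) /=.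
    rewrite big_distrr /=; apply: eq_bigr => -[n m] _; rewrite /F /= conjCM; ring.
  apply: eqC; rewrite /cint /=.
    by apply: eq_Int => t _; rewrite E.
  have T0' : T <= 2 * T by move: T01 TT; lra.
  rewrite (_ : Int T _ _ = Int T (2 * T) (fun=> 0)); last by apply: eq_Int => t _; rewrite E.
  by rewrite Int_cst// mul0r.
rewrite -rmorphM -rmorphB normC_real => /(le_trans (ler_norm _)); lra.
Qed.

Lemma rwgt_mass (e : R) : 0 < e -> exists2 T0 : R, 1 <= T0 & forall T, T0 <= T ->
  (1 - e) * T <= Int T (2 * T) rwgt.
Proof.
move=> e0; have [T0 T01 TP] := wgt_mean e0; exists T0 => // T /TP.
rewrite mulr1 => h; have := le_trans (normC_Re _) h.
rewrite ReD ReN /= -/rwgt => /(le_trans (ler_norm _)) => _.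
have := le_trans (normC_Re _) h; rewrite ReD ReN /= ler_norml => /andP[+ _].
rewrite -[Int T (2 * T) (fun t => Re (wgt t))]/(Int T (2 * T) rwgt); lra.
Qed.

End weight.

End Mean.

(** * Choice of the Riesz coefficients *)

Section Interp.
Variable R : realType.
Notation C := R[i].

Lemma coef_mulX_bound (P : {poly C}) (al be : C) (B A : R) : 0 <= A ->
  (forall j, normC P`_j <= B) -> normC al + normC be <= A ->
  forall j, normC (P * (al *: 'X + be%:P))`_j <= B * A.
Proof.
move=> A0 HB HA j; rewrite mulrDr coefD -scalerAr coefZ coefMX coefMC.
have B0 : 0 <= B by rewrite (le_trans (normC_ge0 _) (HB 0%N)).
rewrite (le_trans (normCD _ _))// (le_trans _ (ler_wpM2l B0 HA))// mulrDr lerD//.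
  rewrite normCM mulrC ler_wpM2r ?normC_ge0//.
  by case: (j == 0)%N; rewrite ?normC0.
by rewrite normCM ler_wpM2r ?normC_ge0.
Qed.

Lemma coef_prod_bound (I : Type) (s : seq I) (P : pred I) (al be : I -> C) (A : R) : 1 <= A ->
  (forall i, P i -> normC (al i) + normC (be i) <= A) ->
  forall j, normC (\prod_(i <- s | P i) (al i *: 'X + (be i)%:P))`_j <= A ^+ size s.
Proof.
move=> A1 HA; have A0 : 0 <= A by rewrite (le_trans _ A1).
elim: s => [|i s IH] j.
  rewrite big_nil coef1 expr0; case: (j == 0)%N; rewrite ?normC1 ?normC0//.
rewrite big_cons; case: ifP => Pi; last by rewrite (le_trans (IH j))// ler_weXn2l/=.
by rewrite mulrC exprSr; exact: coef_mulX_bound (HA _ Pi) _.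
Qed.

(* The solution is [s i = sum_j b_j (l_i)_j] for the Lagrange polynomials [l_i] of the nodes. *)
Lemma vandermonde_solve (N : nat) (x : 'I_N.+1 -> C) (X d B : R) (b : 'I_N.+1 -> C) :
  0 < d <= 1 -> 0 <= X -> (forall i, normC (x i) <= X) ->
  (forall i k, i != k -> d <= normC (x i - x k)) -> (forall j, normC (b j) <= B) ->
  exists2 s : 'I_N.+1 -> C, forall j : 'I_N.+1, \sum_i s i * x i ^+ j = b j &
    forall i, normC (s i) <= N.+1%:R * B * ((1 + X) / d) ^+ N.+1.
Proof.
move=> /andP[d0 d1] X0 xX xd bB.
pose al i k : C := (x i - x k)^-1; pose be i k : C := - x k / (x i - x k).
pose l i : {poly C} := \prod_(k < N.+1 | k != i) (al i k *: 'X + (be i k)%:P).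
have xn i k : k != i -> x i - x k != 0.
  by move=> ki; rewrite -normC_eq0 gt_eqF// (lt_le_trans d0)// xd// eq_sym.
have A1 : 1 <= (1 + X) / d by rewrite ler_pdivlMr// mul1r (le_trans d1)// lerDl.
have A0 : 0 <= (1 + X) / d by rewrite (le_trans _ A1).
have lb i j : normC (l i)`_j <= ((1 + X) / d) ^+ N.+1.
  rewrite /l (le_trans (coef_prod_bound _ A1 _ _))//.
    move=> k ki; rewrite normCM normCN normCV -[X in X + _]mul1r -mulrDl.
    rewrite ler_pM//; first by rewrite addr_ge0// normC_ge0.
    - by rewrite invr_ge0 normC_ge0.
    - by rewrite lerD2l.
    by rewrite lef_pV2 ?posrE ?normC_gt0 ?xn// xd// eq_sym.
  by rewrite /index_enum -enumT size_enum_ord.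
have lE i m : (l i).[x m] = (m == i)%:R.
  rewrite horner_prod; case: eqVneq => [->|mi].
    rewrite big1// => k ki; rewrite hornerD hornerZ hornerX hornerC /al /be.
    by rewrite mulrC -mulrDl mulfV// xn.
  have h0 : (al i m *: 'X + (be i m)%:P).[x m] = 0.
    by rewrite hornerD hornerZ hornerX hornerC /al /be mulrC mulNr subrr.
  by rewrite (bigD1 m)//= h0 mul0r.
have ls i : (size (l i) <= N.+1)%N.
  rewrite /l (leq_trans (size_poly_prod_leq _ _))// leq_subLR.
  have c1 (Q : pred 'I_N.+1) : Q =1 predC1 i -> (#|Q| = N)%N.
    by move=> QE; rewrite (eq_card QE); have := cardC1 i; rewrite card_ord.
  have hs : (\sum_(k | k != i) size (al i k *: 'X + (be i k)%:P)%R <= \sum_(k < N.+1 | k != i) 2)%N.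
    apply: leq_sum => k _.
    rewrite (leq_trans (size_polyD _ _))// geq_max (leq_trans (size_scale_leq _ _)) ?size_polyX//=.
    by rewrite (leq_trans (size_polyC_leq1 _)).
  rewrite (leq_ltn_trans hs)// sum_nat_const !c1//; lia.
have interp (j : 'I_N.+1) : \sum_i x i ^+ j *: l i = 'X^j.
  apply/eqP; rewrite -subr_eq0; apply/eqP.
  set D := _ - _.
  have sD : (size D <= N.+1)%N.
    rewrite (leq_trans (size_polyD _ _))// geq_max size_polyN size_polyXn ltn_ord andbT.
    rewrite (leq_trans (size_sum _ _ _))//; apply/bigmax_leqP => i _.
    by rewrite (leq_trans (size_scale_leq _ _)).
  apply/eqP; case: (eqVneq D 0) => // Dn0.
  have ux : uniq [seq x i | i <- enum 'I_N.+1].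
    rewrite map_inj_uniq ?enum_uniq// => i k ik; apply/eqP; apply: contraTT isT => ne.
    by have := xn k i ne; rewrite ik subrr eqxx.
  have rx : all (root D) [seq x i | i <- enum 'I_N.+1].
    apply/allP => _ /mapP[m _ ->]; rewrite /root /D hornerD hornerN hornerXn horner_sum.
    rewrite (bigD1 m)//= hornerZ lE eqxx mulr1 big1 ?addr0 ?subrr// => i im.
    by rewrite hornerZ lE eq_sym (negPf im) mulr0.
  have := max_poly_roots Dn0 rx ux; rewrite size_map size_enum_ord => h.
  by have := leq_trans h sD; rewrite ltnn.
exists (fun i => \sum_(j < N.+1) b j * (l i)`_j) => [j|i].
  under eq_bigr do rewrite mulr_suml.
  rewrite exchange_big /= (bigD1 j)//= [X in _ + X]big1 ?addr0.
    have h : \sum_i (x i ^+ j *: l i)`_j = 1 by rewrite -coef_sum interp coefXn eqxx.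
    rewrite -[RHS]mulr1 -h mulr_sumr; apply: eq_bigr => i _; rewrite coefZ -mulrA; congr (_ * _).
    exact: mulrC.
  move=> k kj.
  have h : \sum_i (x i ^+ j *: l i)`_k = 0.
    by rewrite -coef_sum interp coefXn (_ : (k == j :> nat) = false)//; apply/negbTE; exact: kj.
  transitivity (b k * \sum_i (x i ^+ j *: l i)`_k); last by rewrite h mulr0.
  rewrite mulr_sumr; apply: eq_bigr => i _.
  by rewrite coefZ -mulrA; congr (_ * _); exact: mulrC.
rewrite (le_trans (normC_sum _ _ _))//.
have -> : N.+1%:R * B * ((1 + X) / d) ^+ N.+1 = \sum_(j < N.+1) B * ((1 + X) / d) ^+ N.+1.
  by rewrite sumr_const card_ord -mulrA mulr_natl.
by apply: ler_sum => j _; rewrite normCM ler_pM ?normC_ge0.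
Qed.

Lemma ln_rpw (Y e : R) : 1 <= Y -> 0 < e <= 1 -> 1 + ln Y <= 2 / e * rpw Y e.
Proof.
move=> Y1 /andP[e0 e1]; have := expR_ge1Dx (e * ln Y); rewrite -/(rpw Y e) => h.
have l0 : 0 <= ln Y by exact: ln_ge0.
rewrite mulrAC ler_pdivlMr// mulrDl mul1r [ln Y * e]mulrC.
have := mulr_ge0 (ltW e0) l0; move: h e1; set u := e * ln Y; set w := rpw _ _; lra.
Qed.

Definition dcoef (a sg : R) (j n : nat) : C :=
  (- ln (a + n%:R))%:C ^+ j * (rpw (a + n%:R) (- sg))%:C.

Section blocks.
Variables (c sg : R) (N : nat) (y : 'I_N.+1 -> C).
Hypotheses (c01 : 0 < c < 1) (sg01 : 0 < sg < 1).

Let Y0 : R := \sum_j normC (y j).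
(** Chosen so that [rpw Y e ^+ N.+1 = rpw Y ((1 - sg) / 2)]: the logarithms cost half of the
    available gain [rpw Y (1 - sg)]. *)
Let e : R := (1 - sg) / (2 * N.+1%:R).
Let cst : R := N.+1%:R * Y0 * (2 * 4 ^+ N) * (2 / e / ln 2) ^+ N.+1.

Variable G : nat.
Hypotheses (G0 : (0 < G)%N) (HG : cst * rpw (2 * 4 ^+ N * G%:R) (- ((1 - sg) / 2)) <= 1).

Let Y : R := 2 * 4 ^+ N * G%:R.
(* [p.1] fixes the scale [4 ^ p.1], so that at fixed [p.2] the logarithms of the
   nodes are separated by at least [ln 2]. *)
Let node (p : 'I_N.+1 * 'I_G) : nat := (4 ^ p.1 * G + p.2)%N.

Lemma node_bound (p : 'I_N.+1 * 'I_G) : 4 ^+ (p.1 : nat) * G%:R <= c + (node p)%:R <= 2 * 4 ^+ (p.1 : nat) * G%:R.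
Proof.
case/andP: c01 => c0 c1; rewrite /node natrD natrM natrX.
have h : ((p.2 : nat)%:R + 1 <= G%:R :> R) by rewrite natr1 ler_nat.
have h4 : 1 <= 4 ^+ (p.1 : nat) :> R by rewrite exprn_ege1// ler1n.
have hG : 0 <= G%:R :> R by [].
have := ler_wpM2r hG h4; have : 0 <= (p.2 : nat)%:R :> R by [].
move: h c0 c1; set u := 4 ^+ _; set v := G%:R; set w := p.2%:R; rewrite -mulrA; set uv := u * v; lra.
Qed.

Lemma node_ge1 p : 1 <= c + (node p)%:R.
Proof.
have /andP[h _] := node_bound p; rewrite (le_trans _ h)//.
by rewrite -natrX -natrM ler1n muln_gt0 expn_gt0.
Qed.

Lemma node_leY p : c + (node p)%:R <= Y.
Proof.
have /andP[_ h] := node_bound p; rewrite (le_trans h)// ler_wpM2r// ler_wpM2l//.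
by rewrite ler_weXn2l ?ler1n// -ltnS.
Qed.

Lemma node_sep (p q : 'I_N.+1 * 'I_G) : (p.1 < q.1)%N -> 2 * (c + (node p)%:R) <= c + (node q)%:R.
Proof.
move=> pq; have /andP[_ h1] := node_bound p; have /andP[h2 _] := node_bound q.
rewrite (le_trans _ h2)// (le_trans (ler_wpM2l _ h1))//.
rewrite !mulrA (_ : 2 * 2 = 4); last by ring.
by rewrite -exprS ler_wpM2r// ler_weXn2l ?ler1n.
Qed.

Lemma node_inj : injective node.
Proof.
have lt (p q : 'I_N.+1 * 'I_G) : (p.1 < q.1)%N -> node p <> node q.
  move=> pq E; have := node_sep pq; rewrite E; have := node_ge1 q; lra.
move=> p q E; case: (ltngtP p.1 q.1) => [/lt//|/lt/nesym//|].
move: E; case: p q => p1 p2 [q1 q2] /= + /val_inj E; rewrite /node /= E.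
by move=> /addnI/val_inj ->.
Qed.

Lemma ln2_le1 : 0 < ln (2 : R) <= 1.
Proof.
rewrite ln_gt0 ?ltr1n//=; have := @le_ln1Dx R 1 (lt_trans (ltrN10 R) ltr01).
by rewrite (_ : 1 + 1 = 2)//.
Qed.

Lemma ln_sep (p q : 'I_N.+1 * 'I_G) : p.1 != q.1 -> ln 2 <= `|ln (c + (node p)%:R) - ln (c + (node q)%:R)|.
Proof.
have lt (p' q' : 'I_N.+1 * 'I_G) : (p'.1 < q'.1)%N -> ln 2 <= ln (c + (node q')%:R) - ln (c + (node p')%:R).
  move=> pq; have h := node_sep pq; have h1 := node_ge1 p'; have h2 := node_ge1 q'.
  rewrite lerBrDr -lnM ?posrE//; last by lra.
  by rewrite ler_ln ?posrE//; lra.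
move=> pq; have : (p.1 != q.1 :> nat) by [].
rewrite neq_ltn => /orP[]/lt h; last by rewrite (le_trans h)// ler_norm.
by rewrite distrC (le_trans h)// ler_norm.
Qed.

Lemma Y_ge1 : 1 <= Y.
Proof.
rewrite /Y -natrX -!natrM ler1n !muln_gt0 expn_gt0 //=.
Qed.

Lemma e_bounds : 0 < e <= 1.
Proof.
case/andP: sg01 => s0 s1; have n0 : 1 <= N.+1%:R :> R by rewrite ler1n.
have n2 : 0 < 2 * N.+1%:R :> R by lra.
rewrite /e divr_gt0 ?subr_gt0//= ler_pdivrMr//; lra.
Qed.

(** The target is shared equally among [G] blocks of [N.+1] nodes, one node per scale. A block has
    to supply only [y j / G], of order [1 / Y], while the factor [(c + n) ^ (- sg)] is at least
    [Y ^ (- sg)]; as [sg < 1], the solution of the Vandermonde system stays below 1 for large [G],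
    powers of [ln Y] included. *)
Lemma block_solve (g : 'I_G) : exists t : 'I_N.+1 -> C,
  (forall j : 'I_N.+1, \sum_i t i * dcoef c sg j (node (i, g)) = y j / G%:R%:C) /\
  forall i, normC (t i) <= 1.
Proof.
pose x (i : 'I_N.+1) : C := (- ln (c + (node (i, g))%:R))%:C.
have GR : 0 < G%:R :> R by rewrite ltr0n.
have [||||s sE sB] := @vandermonde_solve N x (ln Y) (ln 2) (Y0 / G%:R) (fun j => y j / G%:R%:C) ln2_le1.
- by rewrite ln_ge0// Y_ge1.
- move=> i; rewrite normC_real normrN ger0_norm ?ln_ge0 ?node_ge1//.
  rewrite ler_ln ?posrE ?node_leY ?(lt_le_trans ltr01) ?node_ge1 ?Y_ge1//.
- move=> i k ik; rewrite -rmorphB normC_real -opprB opprK addrC.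
  by rewrite normrN; exact: (@ln_sep (i, g) (k, g)).
- move=> j; rewrite normCM normCV normC_real ger0_norm// ler_wpM2r ?invr_ge0//.
  by rewrite /Y0 (bigD1 j)//= lerDl sumr_ge0// => i _; exact: normC_ge0.
exists (fun i => s i * (rpw (c + (node (i, g))%:R) sg)%:C); split=> [j|i].
  rewrite -sE; apply: eq_bigr => i _; rewrite /dcoef -/(x i) mulrCA !mulrA -mulrA.
  rewrite -rmorphM -rpwD subrr rpw0 mulr1 mulrC//.
rewrite normCM normC_real ger0_norm ?(ltW (rpw_gt0 _ _))//.
have Y1 := Y_ge1; have YR : 0 < Y by rewrite (lt_le_trans ltr01).
case/andP: sg01 => s0 s1; case/andP: e_bounds => e0 e1; case/andP: ln2_le1 => l0 l1.
have h1 : rpw (c + (node (i, g))%:R) sg <= rpw Y sg.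
  by rewrite ler_rpw ?node_leY ?(lt_le_trans ltr01) ?node_ge1// ltW.
have Y00 : 0 <= Y0 by apply: sumr_ge0 => j _; exact: normC_ge0.
have h2 : ((1 + ln Y) / ln 2) ^+ N.+1 <= (2 / e / ln 2) ^+ N.+1 * rpw Y ((1 - sg) / 2).
  have -> : rpw Y ((1 - sg) / 2) = rpw Y e ^+ N.+1.
    rewrite rpwX; congr (rpw _ _); rewrite /e.
    have : N.+1%:R != 0 :> R by rewrite pnatr_eq0.
    by set w := N.+1%:R => w0; field.
  rewrite -exprMn lerXn2r ?nnegrE//.
  - by rewrite divr_ge0 ?(ltW l0)// addr_ge0// ln_ge0.
  - apply: mulr_ge0; last exact: ltW (rpw_gt0 _ _).
    by apply: divr_ge0; [apply: divr_ge0; [|exact: ltW]|exact: ltW].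
  by rewrite mulrAC ler_wpM2r ?invr_ge0 ?(ltW l0)// ln_rpw// e0.
rewrite (le_trans (ler_pM (normC_ge0 _) (ltW (rpw_gt0 _ _)) (sB i) h1))//.
have k0 : 0 <= N.+1%:R * (Y0 / G%:R) by rewrite !mulr_ge0 ?invr_ge0.
rewrite (le_trans (ler_wpM2r (ltW (rpw_gt0 _ _)) (ler_wpM2l k0 h2)))//.
rewrite (le_trans _ HG)// -/Y /cst.
(* Here [1 / G = 2 * 4 ^+ N / Y], and the exponents of [Y] add up to [- 1 + (1 - sg) / 2 + sg = -
   ((1 - sg) / 2)], the one in [HG]. *)
have -> : Y0 / G%:R = Y0 * (2 * 4 ^+ N) * rpw Y (- 1).
  rewrite rpwN rpw1// /Y; field; rewrite expf_neq0 ?pnatr_eq0// -lt0n G0//.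
have -> : rpw Y (- ((1 - sg) / 2)) = rpw Y (- 1) * rpw Y ((1 - sg) / 2) * rpw Y sg.
  by rewrite -!rpwD; congr rpw; field.
by rewrite le_eqVlt; apply/orP; left; apply/eqP; ring.
Qed.

Lemma blocks_solve : exists t : nat -> C, [/\ forall n, normC (t n) <= 1,
  forall n, (n < G)%N || (4 ^ N.+1 * G <= n)%N -> t n = 0 &
  forall j : 'I_N.+1, \sum_(n < 4 ^ N.+1 * G) t n * dcoef c sg j n = y j].
Proof.
pose s g := projT1 (cid (block_solve g)).
have sP g : (forall j : 'I_N.+1, \sum_i s g i * dcoef c sg j (node (i, g)) = y j / G%:R%:C) /\
  forall i, normC (s g i) <= 1 by rewrite /s; case: cid.
(* By [node_inj] at most one [p] contributes; off the nodes the sum is empty and [t n] is 0. *)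
pose t n : C := \sum_(p | node p == n) s p.2 p.1.
have nodelt p : (node p < 4 ^ N.+1 * G)%N.
  have h : (4 ^ p.1 <= 4 ^ N)%N by rewrite leq_exp2l// -ltnS.
  rewrite /node expnS; have := ltn_ord p.2; nia.
exists t; split=> [n|n nG|j].
- rewrite /t; have [[p /eqP pn]|no] := pselect (exists p, node p == n).
    rewrite (big_pred1 p); first by have [_] := sP p.2.
    by move=> q; rewrite -pn (inj_eq node_inj).
  by rewrite big1 ?normC0// => p pn; case: no; exists p.
- rewrite /t big1// => p /eqP pn; move: nG; rewrite -pn [(4 ^ _ * G <= _)%N]leqNgt nodelt orbF.
  have : (0 < 4 ^ p.1)%N by rewrite expn_gt0.
  by rewrite /node; nia.
under eq_bigr => n _. rewrite /t mulr_suml. over.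
rewrite (exchange_big_dep xpredT)//=.
rewrite (eq_bigr (fun p => s p.2 p.1 * dcoef c sg j (node p))); last first.
  move=> p _; rewrite (big_pred1 (Ordinal (nodelt p)))// => n.
rewrite -(pair_bigA _ (fun i g => s g i * dcoef c sg j (node (i, g)))) /= exchange_big /=.
under eq_bigr do rewrite (sP _).1.
rewrite sumr_const card_ord -[LHS]mulr_natr -mulrA.
rewrite rmorph_nat mulVf ?mulr1// pnatr_eq0 -lt0n//.
Qed.

End blocks.

Lemma phases_exist (c sg : R) (N M1 : nat) (y : 'I_N.+1 -> C) : 0 < c < 1 -> 0 < sg < 1 ->
  exists M (t : nat -> C), [/\ forall n, normC (t n) <= 1,
    forall n, (n < M1)%N || (M <= n)%N -> t n = 0 &
    forall j : 'I_N.+1, \sum_(n < M) t n * dcoef c sg j n = y j].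
Proof.
move=> c01 sg01; have d0 : 0 < (1 - sg) / 2 by case/andP: sg01; lra.
pose Y0 : R := \sum_j normC (y j).
pose e : R := (1 - sg) / (2 * N.+1%:R).
have [T0 T01 TP] := rpw_vanish (N.+1%:R * Y0 * (2 * 4 ^+ N) * (2 / e / ln 2) ^+ N.+1) d0 ltr01.
(* Every node is at least [G], so [G >= M1] keeps the support of [t] beyond [M1], and [G >= T0]
   secures the size condition of [blocks_solve]. *)
pose G := (M1 + (Num.truncn T0).+1)%N.
have G0 : (0 < G)%N by rewrite /G addnS.
have GT : T0 <= G%:R.
  by rewrite /G natrD (le_trans (ltW (truncnS_gt _)))// lerDr.
have GT' : T0 <= 2 * 4 ^+ N * G%:R.
  rewrite (le_trans GT)// ler_peMl// -natrX -natrM ler1n muln_gt0 expn_gt0//.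
have [t [t1 t2 t3]] := blocks_solve c01 sg01 G0 (TP _ GT').
exists (4 ^ N.+1 * G)%N, t; split=> // n /orP[nM|nM]; apply: t2; last by rewrite nM orbT.
by rewrite (leq_trans nM)// /G leq_addr.
Qed.

End Interp.

(** * Riesz factors and concentrating factors as densities on the circle *)

Section Densities.
Variable R : realType.
Notation C := R[i].

Lemma unit_circle_inv (e : C) : normC e = 1 -> e != 0 /\ e^-1 = cconj e.
Proof.
move=> e1; have e0 : e != 0 by rewrite -normC_eq0 e1 oner_neq0.
split=> //; apply: (mulfI e0); rewrite mulfV// mul_conj e1 expr1n.
by apply: eqC.
Qed.

(** The shift by ['X^K] gives the Riesz factor the same degree parameter as [power_poly K], so one
    [K] serves the whole product. The coefficient below the centre shows that the mean of [e] is
    [t / 2]. *)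
Definition riesz_poly K (t : C) : {poly C} :=
  'X^K + (cconj t / 2) *: 'X^(K.+1) + (t / 2) *: 'X^(K.-1).

Lemma riesz_density K t : (0 < K)%N -> normC t <= 1 ->
  density K (riesz_poly K t) (t / 2) (1 + normC t).
Proof.
case: K => // K _ t1; split=> //; first split.
- rewrite /riesz_poly (leq_trans (size_polyD _ _))// geq_max; apply/andP; split.
    rewrite (leq_trans (size_polyD _ _))// geq_max size_polyXn; apply/andP; split; first lia.
    by rewrite (leq_trans (size_scale_leq _ _))// size_polyXn; lia.
  by rewrite (leq_trans (size_scale_leq _ _))// size_polyXn/=; lia.
- rewrite /riesz_poly !coefD !coefZ !coefXn eqxx /=.
  by rewrite ltn_eqF// [K.+1 == K]gtn_eqF// !mulr0 !addr0.
- rewrite /riesz_poly !coefD !coefZ !coefXn eqxx /=.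
  by rewrite ltn_eqF// [K == K.+2]ltn_eqF// mulr0 !add0r mulr1.
- rewrite /riesz_poly !coefD !coefZ !coefXn eqxx /=.
  rewrite gtn_eqF// [K.+2 == K]gtn_eqF// mulr0 add0r mulr1 addr0.
  case: (t) => x y; apply: eqC; rewrite ?ReImE /cconj /=; simpc; rewrite ?ReImE /=; ring.
move=> e e1; have [e0 eV] := unit_circle_inv e1.
have rt : `|Re (cconj t * e)| <= normC t.
  by rewrite (le_trans (normC_Re _))// normCM normC_conj e1 mulr1.
exists (1 + Re (cconj t * e)).
  by move: rt; rewrite ler_norml => /andP[]; lra.
rewrite /riesz_poly !hornerD !hornerZ !hornerXn /=.
have -> : (e ^+ K.+1 + cconj t / 2 * e ^+ K.+2 + t / 2 * e ^+ K) * (e^-1) ^+ K.+1 =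
   1 + (cconj t * e + t * e^-1) / 2.
  rewrite exprVn !exprS; field; rewrite e0 expf_neq0//.
rewrite eV; case: (t) => x y; case: (e) => u v; apply: eqC; rewrite ?ReImE /cconj /=; by field.
Qed.

Definition power_poly K : {poly C} := ('C(K.*2, K)%:R)^-1 *: ('X + 1) ^+ K.*2.

Lemma coef_X1n n i : (('X + 1) ^+ n : {poly C})`_i = 'C(n, i)%:R.
Proof.
rewrite addrC exprDn coef_sum; case: (leqP i n) => ni; last first.
  rewrite bin_small// big1// => j _; rewrite expr1n mul1r coefMn coefXn.
  by rewrite gtn_eqF ?mul0rn// (leq_ltn_trans _ ni)// -ltnS.
rewrite (bigD1 (Ordinal (ni : (i < n.+1)%N)))//= expr1n mul1r coefMn coefXn eqxx.
rewrite big1 ?addr0// => j ji; rewrite expr1n mul1r coefMn coefXn.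
by rewrite (_ : (i == j) = false) ?mul0rn//; apply/negbTE; rewrite eq_sym; exact: ji.
Qed.

(** On the circle [(1 + e) ^+ 2 / e = |1 + e| ^ 2], which gives positivity and the bound [4 ^+ K].
    The mean is a quotient of adjacent binomial coefficients, ['C(2 K, K - 1) / 'C(2 K, K) = K / (K
    + 1)]. *)
Lemma power_density K : (0 < K)%N -> density K (power_poly K) (K%:R / K.+1%:R)%:C (4 ^+ K).
Proof.
move=> K0; have C0 : (0 < 'C(K.*2, K))%N by rewrite bin_gt0 -addnn leq_addr.
have CR : 'C(K.*2, K)%:R != 0 :> C by rewrite pnatr_eq0 -lt0n.
have E1 : ('C(K.*2, K.+1) = 'C(K.*2, K.-1))%N.
  rewrite -bin_sub; last by lia.
  congr binomial; lia.
have E2 : (K * 'C(K.*2, K) = K.+1 * 'C(K.*2, K.-1))%N.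
  by have := mul_bin_left K.*2 K.-1; rewrite prednK// => ->; congr muln; lia.
have E3 : 'C(K.*2, K)%:R^-1 * 'C(K.*2, K.-1)%:R = (K%:R / K.+1%:R)%:C :> C.
  have -> : (K%:R / K.+1%:R)%:C = K%:R / K.+1%:R :> C by rewrite rmorphM fmorphV !rmorph_nat.
  apply: (mulfI CR); rewrite mulrA mulfV// mul1r.
  have K1 : K.+1%:R != 0 :> C by rewrite pnatr_eq0.
  by apply: (mulIf K1); rewrite mulrA mulfVK// -!natrM; congr (_%:R); rewrite mulnC -E2 mulnC.
have real_conj (r : R) : cconj r%:C = r%:C by apply: eqC; rewrite /cconj /= ?oppr0.
split=> //; first split.
- rewrite /power_poly (leq_trans (size_scale_leq _ _))//.
  rewrite (leq_trans (size_poly_exp_leq _ _))//.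
  by rewrite (_ : ('X + 1) = ('X - (- 1)%:P))%R ?size_XsubC//= ?mul1n// polyCN opprK.
- by rewrite coefZ coef_X1n mulVf.
- by rewrite coefZ coef_X1n.
- by rewrite coefZ coef_X1n E1 real_conj.
move=> e e1; have [e0 eV] := unit_circle_inv e1.
exists (normC (1 + e) ^+ K.*2 / 'C(K.*2, K)%:R).
  rewrite divr_ge0 ?exprn_ge0 ?normC_ge0//= ler_pdivrMr ?ltr0n//.
  have h : normC (1 + e) ^+ K.*2 <= 4 ^+ K.
    rewrite -mul2n exprM lerXn2r ?nnegrE ?sqr_ge0//.
    have -> : (4 : R) = (1 + 1) ^+ 2 by ring.
    by rewrite lerXn2r ?nnegrE ?normC_ge0// (le_trans (normCD _ _))// normC1 e1.
  by rewrite (le_trans h)// ler_peMr ?exprn_ge0// ler1n.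
rewrite /power_poly hornerZ horner_exp hornerD hornerX hornerC -mul2n exprM -mulrA -exprMn.
have -> : (e + 1) ^+ 2 * e^-1 = (normC (1 + e) ^+ 2)%:C.
  rewrite -mul_conj [cconj _](_ : _ = 1 + e^-1); last first.
    by rewrite eV; case: (e) => u v; apply: eqC; rewrite ?ReImE /cconj /= ?ReImE /= ?add0r.
  by field.
rewrite mulrC -rmorphXn /= -exprM.
have -> : ('C(2 * K, K)%:R : C)^-1 = ('C(2 * K, K)%:R^-1)%:C by rewrite fmorphV rmorph_nat.
by rewrite -rmorphM.
Qed.

End Densities.

(** * Estimates uniform in the parameter *)

Section Coef.
Variable R : realType.
Notation C := R[i].

Lemma normC_dcoef (a sg : R) j n : normC (dcoef a sg j n) = `|ln (a + n%:R)| ^+ j * rpw (a + n%:R) (- sg).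
Proof. by rewrite /dcoef normCM normCX !normC_real normrN [X in _ * X]ger0_norm// ltW// rpw_gt0. Qed.

Lemma ler_exp1D (x : R) j N : 0 <= x -> (j <= N)%N -> x ^+ j <= (1 + x) ^+ N.
Proof.
move=> x0 jN; have x1 : 0 <= 1 + x by rewrite addr_ge0.
rewrite (le_trans (_ : _ <= (1 + x) ^+ j))//; last by rewrite ler_weXn2l// lerDl.
by rewrite lerXn2r ?nnegrE// lerDr.
Qed.

(** The gap [sg - sp] is divided into [N.+1] equal parts [e], each of which absorbs one power of the
    logarithm through [ln_rpw]. *)
Lemma dcoef_bound (sg sp : R) N : 0 < sp < sg -> sg < 1 -> exists2 K : R, 0 <= K &
  forall a j n, 0 < a <= 1 -> (j <= N)%N -> (0 < n)%N ->
    normC (dcoef a sg j n) <= K * rpw n%:R (- sp).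
Proof.
move=> /andP[sp0 spsg] sg1; pose e := (sg - sp) / N.+1%:R.
have N1 : 1 <= N.+1%:R :> R by rewrite ler1n.
have N0 : 0 < N.+1%:R :> R by rewrite ltr0n.
have e01 : 0 < e <= 1.
  rewrite /e divr_gt0 ?subr_gt0//= ler_pdivrMr//; lra.
have /andP[e0 e1] := e01.
exists ((2 / e) ^+ N.+1); first by rewrite exprn_ge0// divr_ge0// ltW.
move=> a j n /andP[a0 a1] jN n0; rewrite normC_dcoef; set y := a + n%:R.
have n1 : 1 <= n%:R :> R by rewrite ler1n.
have ny : n%:R <= y by rewrite /y lerDr ltW.
have y1 : 1 <= y by rewrite (le_trans n1).
have l0 := ln_ge0 y1; rewrite (ger0_norm l0).
have h : ln y ^+ j <= (2 / e) ^+ N.+1 * rpw y (sg - sp).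
  rewrite (le_trans (ler_exp1D l0 (leqW jN)))//.
  have -> : rpw y (sg - sp) = rpw y e ^+ N.+1.
    by rewrite rpwX; congr (rpw _ _); rewrite /e mulfVK// gt_eqF.
  rewrite -exprMn lerXn2r ?nnegrE ?addr_ge0 ?ln_rpw//.
  by apply: mulr_ge0; [apply: divr_ge0 => //; exact: ltW|exact: ltW (rpw_gt0 _ _)].
rewrite (le_trans (ler_wpM2r (ltW (rpw_gt0 _ _)) h))// -mulrA -rpwD.
rewrite (_ : sg - sp - sg = - sp); last by ring.
apply: ler_wpM2l; first by rewrite exprn_ge0// divr_ge0// ltW.
by rewrite ler_rpwN// ?(lt_le_trans ltr01)// ltW.
Qed.

(** The term of index 0 is unbounded as [a] tends to 0 and needs its own bound, uniform for
    [a >= b]. *)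
Lemma dcoef_bound0 (sg b : R) N : 0 < sg -> 0 < b <= 1 -> exists2 K : R, 0 <= K &
  forall a j, b <= a <= 1 -> (j <= N)%N -> normC (dcoef a sg j 0) <= K.
Proof.
move=> sg0 /andP[b0 b1]; have lb : 0 <= - ln b by rewrite oppr_ge0 ln_le0.
exists ((1 + - ln b) ^+ N * rpw b (- sg)).
  by rewrite mulr_ge0 ?(ltW (rpw_gt0 _ _))// exprn_ge0// addr_ge0.
move=> a j /andP[ba a1] jN; rewrite normC_dcoef addr0.
have a0 := lt_le_trans b0 ba.
have la : `|ln a| <= - ln b.
  by rewrite ler0_norm ?ln_le0// lerN2 ler_ln ?posrE.
rewrite ler_pM ?exprn_ge0 ?(ltW (rpw_gt0 _ _))//; last by rewrite ler_rpwN// ltW.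
rewrite (le_trans (ler_exp1D _ jN))// lerXn2r ?nnegrE ?addr_ge0//.
by rewrite lerD2l.
Qed.

Lemma dcoef_cont (c sg e : R) j n : 0 < c -> 0 < e ->
  \forall a \near c, normC (dcoef a sg j n - dcoef c sg j n) < e.
Proof.
move=> c0 e0; pose f (a : R) := (- ln (a + n%:R)) ^+ j * rpw (a + n%:R) (- sg).
have fE a : dcoef a sg j n = (f a)%:C by rewrite /dcoef /f rmorphM rmorphXn.
have cl : {for c, continuous (fun a : R => ln (a + n%:R))}.
  apply: (@continuous_comp _ _ _ (fun a : R => a + n%:R) (@ln R)).
    by apply: cvgD; [exact: cvg_id|exact: cvg_cst].
  by apply: continuous_ln; rewrite ltr_wpDr.
have c1 : {for c, continuous (fun a : R => (- ln (a + n%:R)) ^+ j)}.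
  apply: (@continuous_comp R R R (fun a : R => - ln (a + n%:R)) (fun u : R => u ^+ j)).
    by apply: cvgN; exact: cl.
  exact: exprn_continuous.
have c2 : {for c, continuous (fun a : R => rpw (a + n%:R) (- sg))}.
  apply: (@continuous_comp R R R (fun a : R => - sg * ln (a + n%:R)) (@expR R)).
    by apply: cvgM; [exact: cvg_cst|exact: cl].
  exact: continuous_expR.
have cf : {for c, continuous f} by exact: cvgM c1 c2.
have /cvgrPdist_lt/(_ e e0) := cf; apply: filterS => a.
by rewrite !fE -rmorphB normC_real distrC.
Qed.

Lemma dcoef_unif (c sg e : R) N M : 0 < c -> 0 < e -> exists2 rho : R, 0 < rho &
  forall a, `|a - c| <= rho -> forall (n : 'I_M) (j : 'I_N), normC (dcoef a sg j n - dcoef c sg j n) < e.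
Proof.
move=> c0 e0.
have : \forall a \near c, forall p : 'I_M * 'I_N, normC (dcoef a sg p.2 p.1 - dcoef c sg p.2 p.1) < e.
  pose P (p : 'I_M * 'I_N) (a : R) := (normC (dcoef a sg p.2 p.1 - dcoef c sg p.2 p.1) < e) : Prop.
  have hP p : nbhs c (P p) by exact: dcoef_cont.
  have := @filter_forall R _ P (nbhs c) _ hP.
  exact.
move=> /nbhs_ballP[r /= r0 H]; exists (r / 2); first by rewrite divr_gt0.
move=> a ac n j; apply: (H a _ (n, j)); rewrite /ball /= distrC (le_lt_trans ac)//; lra.
Qed.

Lemma exists_length (g T : R) : 0 < g -> 1 <= T -> exists L : nat, rpw T g <= L%:R <= 2 * rpw T g.
Proof.
move=> g0 T1; have h1 : 1 <= rpw T g by rewrite -(rpw0 T) ler_rpw_exp// ltW.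
exists (Num.truncn (rpw T g)).+1; rewrite (ltW (truncnS_gt _)) /=.
have : (Num.truncn (rpw T g))%:R <= rpw T g by rewrite truncn_le// ltW// rpw_gt0.
by rewrite -natr1; lra.
Qed.

(** With [x = sp - 1 / 2] and the harmonic sum bounded through [L ^ x], the left side is of order
    [L ^ (2 * (1 - sp) + x) = L ^ (1 - x)]. For [L] of size [T ^ (1 + x / 2)] the exponent of [T] is
    [(1 + x / 2) * (1 - x) <= 1 - x / 2], below 1. *)
Lemma off_diagonal (sp : R) : 1 / 2 < sp < 1 -> exists2 A : R, 0 <= A & forall T L, 1 <= T ->
  rpw T (1 + (sp - 1 / 2) / 2) <= L%:R <= 2 * rpw T (1 + (sp - 1 / 2) / 2) ->
  rpw L%:R (1 - sp) * (1 + rpw L%:R (1 - sp) / (1 - sp)) * harm R L <= A * rpw T (1 - (sp - 1 / 2) / 2).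
Proof.
move=> /andP[sp0 sp1]; set x := sp - 1 / 2; have x0 : 0 < x by rewrite /x; lra.
have x1 : x < 1 / 2 by rewrite /x; lra.
pose A := (2 / (1 - sp)) * (2 / x) * rpw 2 (1 - x).
have d0 : 0 <= 2 / (1 - sp) by rewrite divr_ge0//; lra.
have d1 : 0 <= 2 / x by rewrite divr_ge0//; lra.
exists A; first by rewrite /A; apply: mulr_ge0; [exact: mulr_ge0|exact: ltW (rpw_gt0 _ _)].
move=> T L T1 /andP[L1 L2].
have T0 : 0 < T by rewrite (lt_le_trans ltr01).
have LR : 1 <= L%:R :> R.
  by rewrite (le_trans _ L1)// -[leLHS](rpw0 T) ler_rpw_exp//; lra.
have L0 : 0 < L%:R :> R by rewrite (lt_le_trans ltr01).
have h (r : R) : 0 < r <= 1 -> 1 + rpw L%:R r / r <= 2 / r * rpw L%:R r.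
  move=> /andP[r0 r1]; have k1 : 1 <= rpw L%:R r by rewrite -[leLHS](rpw0 L%:R) ler_rpw_exp// ltW.
  rewrite mulrAC ler_pdivlMr// mulrDl mul1r mulfVK ?gt_eqF//; lra.
have hs : 0 < 1 - sp <= 1 by apply/andP; split; lra.
have hx : 0 < x <= 1 by apply/andP; split; lra.
have H1 := h _ hs; have H2 := le_trans (harm_rpw L hx) (h _ hx).
have p0 (r : R) : 0 <= rpw L%:R r by rewrite ltW// rpw_gt0.
have hh : 0 <= harm R L by apply: sumr_ge0 => k _; rewrite invr_ge0.
apply: (@le_trans _ _ (rpw L%:R (1 - sp) * (2 / (1 - sp) * rpw L%:R (1 - sp)) * (2 / x * rpw L%:R x))).
  have h1 : 0 <= 1 + rpw L%:R (1 - sp) / (1 - sp) by rewrite addr_ge0// divr_ge0//; lra.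
  apply: ler_pM => //; first exact: mulr_ge0.
  exact: ler_wpM2l.
have -> : rpw L%:R (1 - sp) * (2 / (1 - sp) * rpw L%:R (1 - sp)) * (2 / x * rpw L%:R x) =
    2 / (1 - sp) * (2 / x) * rpw L%:R (1 - x).
  have -> : rpw L%:R (1 - x) = rpw L%:R (1 - sp) * rpw L%:R (1 - sp) * rpw L%:R x.
    by rewrite -!rpwD; congr (rpw _ _); rewrite /x; field.
  by ring.
rewrite /A -!mulrA !ler_wpM2l//; [lra..|].
have -> : rpw 2 (1 - x) * rpw T (1 - x / 2) >= rpw L%:R (1 - x) = true => //.
have x2 : 0 <= 1 - x by lra.
rewrite (le_trans (ler_rpw L0 L2 x2))// rpwM ?rpw_gt0// ler_wpM2l ?(ltW (rpw_gt0 _ _))//.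
rewrite rpw_rpw ler_rpw_exp//; have := sqr_ge0 x; rewrite expr2; lra.
Qed.

(** Half of [e] pays for the diagonal, which depends on [M] alone, and half for the off-diagonal
    terms, which are controlled by [T] alone. Neither threshold depends on [a] or on the
    coefficients. *)
Lemma middle_ms (sp K : R) : 1 / 2 < sp < 1 -> 0 <= K -> forall e : R, 0 < e ->
  exists2 M0 : nat, (0 < M0)%N & forall M, (M0 <= M)%N -> exists2 T0 : R, 1 <= T0 &
  forall T a L (c : nat -> C), T0 <= T -> 0 < a <= 1 ->
    rpw T (1 + (sp - 1 / 2) / 2) <= L%:R <= 2 * rpw T (1 + (sp - 1 / 2) / 2) ->
    (forall n, (0 < n)%N -> normC (c n) <= K * rpw n%:R (- sp)) ->
    Int T (2 * T) (fun tau => normC (\sum_(i < L) (if (M < i)%N then c i else 0) *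
       osc (- ln (a + (i : nat)%:R)) tau) ^+ 2) <= e * T.
Proof.
move=> sp01 K0 e e0; have /andP[sp0 sp1] := sp01.
have r0 : 0 < 2 * sp - 1 by lra.
have x0 : 0 < (sp - 1 / 2) / 2 by lra.
have e2 : 0 < e / 2 by lra.
have [T1 T11 T1P] := rpw_vanish (K ^+ 2 / (2 * sp - 1)) r0 e2.
have [A A0 HA] := off_diagonal sp01.
have [T2 T21 T2P] := rpw_vanish (16 * K ^+ 2 * A) x0 e2.
exists (Num.truncn T1).+1 => // M MM; exists T2 => // T a L c TT a01 LT Hc.
have M0 : (0 < M)%N by rewrite (leq_trans _ MM).
have T1' : 1 <= T by rewrite (le_trans T21).
have TR : 0 < T by rewrite (lt_le_trans ltr01).
have TT2 : T <= 2 * T by lra.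
have := dirichlet_ms L a01 sp01 K0 TT2 M0 Hc => /le_trans; apply.
have -> : 2 * T - T = T by ring.
have h1 : K ^+ 2 * (rpw M%:R (- (2 * sp - 1)) / (2 * sp - 1)) <= e / 2.
  rewrite mulrCA mulrC T1P// (le_trans (ltW (truncnS_gt _)))// ler_nat//.
have h2 : 16 * (K ^+ 2 * (rpw L%:R (1 - sp) * (1 + rpw L%:R (1 - sp) / (1 - sp)) * harm R L)) <= T * (e / 2).
  have k16 : 0 <= 16 * K ^+ 2 by rewrite mulr_ge0// sqr_ge0.
  rewrite mulrA (le_trans (ler_wpM2l k16 (HA T L T1' LT)))//.
  rewrite mulrA rpwD rpw1// mulrCA ler_wpM2l ?(ltW TR)//; exact: T2P.
rewrite (_ : e * T = T * (e / 2) + T * (e / 2)); last by field.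
by rewrite lerD// ler_wpM2l// ltW.
Qed.

End Coef.

(** * From weighted integrals to Lebesgue measure *)

Section Measure.
Variable R : realType.
Notation C := R[i].
Notation mu := (@lebesgue_measure R).

(* Lebesgue measure is an outer measure on all sets, so [G] need not be measurable. *)
Lemma Int_measure (g : R -> R) (A B Q : R) (G : set R) : contab A B g -> 0 < Q ->
  (forall t, A <= t <= B -> g t <= Q) -> (forall t, A <= t <= B -> 0 < g t -> G t) ->
  ((Int A B g / Q)%:E <= mu G)%E.
Proof.
move=> cg Q0 gQ gG; pose I : set (measurableTypeR R) := `[A, B]%classic.
have mI : measurable I by exact: measurable_itv.
have ig := contab_integrable cg.
pose D : set (measurableTypeR R) := I `&` g @^-1` `]0, +oo[%classic.
have mD : measurable D.
  have mg : measurable_fun I g by apply/measurable_EFinP; exact: measurable_int ig.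
  exact: mg.
have DG : D `<=` G.
  move=> t [It /=]; rewrite in_itv /= andbT; apply: gG; by move: It; rewrite /I /= in_itv.
have ID : (mu D <= mu G)%E.
  exact: le_outer_measure.
apply: le_trans ID.
pose h1 (t : measurableTypeR R) : \bar R := (Q%:E * (\1_D t)%:E)%E.
have intI : mu.-integrable I h1.
  have iQ : mu.-integrable I (EFin \o (fun=> Q)) by exact: contab_integrable (@contab_cst _ A B Q).
  have mh : measurable_fun I h1.
    by apply: measurable_funeM; apply/measurable_EFinP; exact: measurable_indic.
  apply: (le_integrable mI mh _ iQ) => t _; rewrite /h1 /=; 
  rewrite lee_fin normrM ler_piMr// indicE.
  by case: (t \in D); rewrite /= ?normr1 ?normr0.
have h : ((Int A B g)%:E <= Q%:E * mu D)%E.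
  rewrite /Int /Rintegral fineK; last exact: integral_fune_fin_num.
  apply: le_trans (@le_integral _ _ _ mu I mI _ _ ig intI _) _.
    move=> t; rewrite inE => It; rewrite /h1 /= lee_fin indicE.
    case: (ltrP 0 (g t)) => gt0.
      rewrite mem_set ?mulr1; last by split => //=; rewrite in_itv /= andbT.
      by apply: gQ; move: It; rewrite /I /= in_itv.
    by rewrite (le_trans gt0)// mulr_ge0// ltW.
  rewrite /h1 ge0_integralZl_EFin ?(ltW Q0)//; last first.
    by apply/measurable_EFinP; exact: measurable_indic.
  rewrite integral_indic// (_ : D `&` I = D)//.
  by rewrite /D setIAC setIid.
by rewrite mulrC EFinM lee_pdivrMl.
Qed.

Lemma limf_einf_gt0 (f : R -> \bar R) (d T0 : R) : 0 < d -> (forall T, T0 <= T -> (d%:E <= f T)%E) ->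
  (0 < limf_einf f +oo%R)%E.
Proof.
move=> d0 H; rewrite limf_einfE; apply: (@lt_le_trans _ _ d%:E); first by rewrite lte_fin.
apply: ereal_sup_ge; exists (ereal_inf (f @` [set T | T0 <= T])).
  by exists [set T | T0 <= T] => //; apply: nbhs_pinfty_ge; exact: num_real.
by apply: le_ereal_inf_tmp => _ [T /H ? <-].
Qed.

Lemma contab_sum (x y : R) (I : Type) (s : seq I) (F : I -> R -> R) :
  (forall i, contab x y (F i)) -> contab x y (fun t => \sum_(i <- s) F i t).
Proof.
move=> cF; elim: s => [|i s IH].
  by apply: (contab_eq _ (@contab_cst _ x y 0)) => t; rewrite big_nil.
by apply: (contab_eq _ (contabD (cF i) IH)) => t; rewrite big_cons.
Qed.

Lemma Int_sum (x y : R) (I : Type) (s : seq I) (F : I -> R -> R) : x <= y ->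
  (forall i, contab x y (F i)) ->
  Int x y (fun t => \sum_(i <- s) F i t) = \sum_(i <- s) Int x y (F i).
Proof.
move=> xy cF; elim: s => [|i s IH].
  rewrite big_nil (_ : (fun t => _) = (fun=> 0)) ?Int_cst ?mul0r//.
  by apply/funext => t; rewrite big_nil.
rewrite big_cons -IH -IntD//; last exact: contab_sum.
by apply: eq_Int => t _; rewrite big_cons.
Qed.

(* Pigeonhole with respect to the weight [w]: where the integrand of the
   conclusion is positive, the error terms are small. *)
Lemma weighted_mass (J : nat) (T W ka : R) (w : R -> R) (D E : 'I_J -> R -> C) :
  0 <= T -> 0 <= W -> (forall x y, contab x y w) ->
  (forall j x y, ccontab x y (D j)) -> (forall j x y, ccontab x y (E j)) ->
  (forall t, 0 <= w t <= W) -> (1 - 1 / 8) * T <= Int T (2 * T) w ->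
  0 <= ka ->
  \sum_j Int T (2 * T) (fun t => w t * normC (D j t) ^+ 2) <= ka / 8 * T ->
  W * \sum_j Int T (2 * T) (fun t => normC (E j t) ^+ 2) <= ka / 8 * T ->
  ka / 2 * T <= Int T (2 * T) (fun t => w t * (ka - \sum_j (normC (D j t) ^+ 2 + normC (E j t) ^+ 2))).
Proof.
move=> T0 W0 cw cD cE wW mw ka0 hD hE.
have TT : T <= 2 * T by lra.
have csq (F : R -> C) : (forall x y, ccontab x y F) -> contab T (2 * T) (fun t => normC (F t) ^+ 2).
  move=> cF; apply: (@contab_eq _ _ _ (fun t => normC (F t) * normC (F t))); first by move=> t; rewrite expr2.
  by apply: contabM; exact: ccont_norm.
have csum (F : 'I_J -> R -> R) : (forall j, contab T (2 * T) (F j)) -> contab T (2 * T) (fun t => \sum_j F j t).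
  exact: contab_sum.
have Isum (F : 'I_J -> R -> R) : (forall j, contab T (2 * T) (F j)) ->
    Int T (2 * T) (fun t => \sum_j F j t) = \sum_j Int T (2 * T) (F j) by exact: Int_sum.
have cwD j : contab T (2 * T) (fun t => w t * normC (D j t) ^+ 2) by apply: contabM; [exact: cw|exact: csq].
have cE2 j : contab T (2 * T) (fun t => normC (E j t) ^+ 2) by exact: csq.
(* A lower bound for the integrand: [D] keeps the weight, while for [E], whose mean square is known
   only without weight, [w] is replaced by [W]. *)
pose H t := ka * w t + (- 1 * (\sum_j w t * normC (D j t) ^+ 2) + - W * \sum_j normC (E j t) ^+ 2).
have cH1 : contab T (2 * T) (fun t => - 1 * (\sum_j w t * normC (D j t) ^+ 2)).
  by apply: contabM; [exact: contab_cst|exact: csum].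
have cH2 : contab T (2 * T) (fun t => - W * \sum_j normC (E j t) ^+ 2).
  by apply: contabM; [exact: contab_cst|exact: csum].
have cH0 : contab T (2 * T) (fun t => ka * w t) by apply: contabM; [exact: contab_cst|exact: cw].
have IH : Int T (2 * T) H = ka * Int T (2 * T) w - \sum_j Int T (2 * T) (fun t => w t * normC (D j t) ^+ 2)
   - W * \sum_j Int T (2 * T) (fun t => normC (E j t) ^+ 2).
  rewrite /H IntD//; last exact: contabD.
  rewrite IntD// !IntZ//; [|exact: csum..]; rewrite !Isum//; ring.
(* The fractions of [ka * T] are [7 / 8 - 1 / 8 - 1 / 8 = 5 / 8], above the required [1 / 2]. *)
apply: (@le_trans _ _ (Int T (2 * T) H)).
  by rewrite IH; have := ler_wpM2l ka0 mw; have := mulr_ge0 ka0 T0; lra.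
apply: Int_le; first by apply: contabD => //; exact: contabD.
  apply: contabM; first exact: cw.
  apply: contabD; first exact: contab_cst.
  by apply: contabN; apply: csum => j; apply: contabD; exact: csq.
move=> t _; rewrite /H mulrBr big_split /= mulrDr [w t * ka]mulrC lerD2l.
rewrite -mulr_sumr mulN1r opprD lerD2l mulNr lerN2 ler_wpM2r//; last by have /andP[] := wW t.
by apply: sumr_ge0 => j _; exact: sqr_ge0.
Qed.

End Measure.

(** * The chosen densities, their means and their variances *)

Section Family.
Variable R : realType.
Notation C := R[i].

Lemma eventually_all (N : nat) (P : 'I_N -> R -> Prop) :
  (forall j, exists2 T0 : R, 1 <= T0 & forall T, T0 <= T -> P j T) ->
  exists2 T0 : R, 1 <= T0 & forall T, T0 <= T -> forall j, P j T.
Proof.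
move=> H; pose f j := projT1 (cid2 (H j)).
have fP j : 1 <= f j /\ forall T, f j <= T -> P j T by rewrite /f; case: cid2.
exists (1 + \sum_j f j).
  by rewrite lerDl sumr_ge0// => j _; rewrite (le_trans ler01)// (fP j).1.
move=> T TT j; apply: (fP j).2; rewrite (le_trans _ TT)// (bigD1 j)//= addrCA lerDl.
by rewrite addr_ge0// sumr_ge0// => k _; rewrite (le_trans ler01)// (fP k).1.
Qed.

Lemma sum_ord_split (V : nmodType) (F : nat -> V) M L : (M < L)%N ->
  \sum_(i < L) F i = \sum_(i < M.+1) F i + \sum_(i < L) (if (M < i)%N then F i else 0).
Proof.
move=> ML; rewrite -!(big_mkord xpredT F) (big_cat_nat (leq0n M.+1) ML) /=; congr (_ + _).
rewrite -(big_mkord xpredT (fun i => if (M < i)%N then F i else 0)).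
rewrite [RHS](big_cat_nat (leq0n M.+1) ML) /= [X in X + _]big_nat [X in X + _]big1 ?add0r.
  by rewrite big_nat [RHS]big_nat; apply: eq_bigr => i /andP[-> _].
by move=> i /andP[_ iM]; rewrite ltnNge -ltnS iM.
Qed.

Lemma hurwitz_split (a sg tau : R) j M L : 0 < a -> 0 < sg < 1 -> 1 < tau -> (M < L)%N ->
  hurwitz_zeta_derive j a (sg +i* tau) =
  \sum_(n < M.+1) dcoef a sg j n * osc (- ln (a + (n : nat)%:R)) tau +
  \sum_(i < L) (if (M < i)%N then dcoef a sg j i else 0) * osc (- ln (a + (i : nat)%:R)) tau +
  iter j (@cD R) (fun u => Zh u (a + L%:R)) (sg +i* tau).
Proof.
move=> a0 sg01 tau1 ML; rewrite (@hurwitz_zeta_deriveE _ _ _ _ L) //; congr (_ + _).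
rewrite (eq_bigr (fun i : 'I_L => dcoef a sg j i * osc (- ln (a + (i : nat)%:R)) tau)); last first.
  by move=> i _; rewrite cpow_chr chr_osc /dcoef mulrA rmorphN.
rewrite (sum_ord_split (fun i => dcoef a sg j i * osc (- ln (a + i%:R)) tau) ML); congr (_ + _).
by apply: eq_bigr => i _; case: ifP => // _; rewrite mul0r.
Qed.

Variables (K M1 : nat) (t : nat -> C).
Hypotheses (K0 : (0 < K)%N) (t1 : forall n, normC (t n) <= 1) (t0 : forall n, (n < M1)%N -> t n = 0).

Definition fpoly n : {poly C} := if (n < M1)%N then power_poly R K else riesz_poly K (t n).
(** As [t n] vanishes for [n < M1], one of the two summands is always 0; the additive form lets
    [fmean_sum] separate the head from the Riesz part. *)
Definition fmean n : C := (if (n < M1)%N then (K%:R / K.+1%:R)%:C else 0) + t n / 2.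
Definition fbound n : R := if (n < M1)%N then 4 ^+ K else 1 + normC (t n).

Lemma fdensity n : density K (fpoly n) (fmean n) (fbound n).
Proof.
rewrite /fpoly /fmean /fbound; case: ifP => nM.
  by rewrite t0// mul0r addr0; exact: power_density.
by rewrite add0r; exact: riesz_density.
Qed.

Lemma fbound_gt0 n : 0 < fbound n.
Proof. by rewrite /fbound; case: ifP => _; [exact: exprn_gt0|rewrite ltr_pwDl ?normC_ge0]. Qed.

Lemma fmean_le1 n : normC (fmean n) <= 1.
Proof.
rewrite /fmean; case: ifP => nM.
  rewrite t0// mul0r addr0 normC_real ger0_norm ?divr_ge0// ler_pdivrMr// mul1r ler_nat//.
rewrite add0r normCM (_ : normC (2^-1 : C) = 2^-1); last first.
  by rewrite normCV; congr (_^-1); rewrite -[2]/(2%:R : C) -(rmorph_nat (real_complex R)) normC_real ger0_norm.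
have := t1 n; have := normC_ge0 (t n); lra.
Qed.

(** From [P] on the density is the constant 1, with bound 1. The bound of the weight is therefore
    settled before the number of phases is. *)
Lemma fbound_prod P M : (M1 <= P)%N -> (forall n, (P <= n)%N -> t n = 0) -> (P <= M)%N ->
  \prod_(n < M) fbound n = \prod_(n < P) fbound n.
Proof.
move=> M1P tP PM; rewrite -!(big_mkord xpredT) (big_cat_nat (leq0n P) PM) /=.
rewrite [X in _ * X]big_nat [X in _ * X]big1 ?mulr1// => n /andP[Pn _].
by rewrite /fbound ltnNge (leq_trans M1P Pn)/= tP// normC0 addr0.
Qed.

(** The hypothesis is the target handed to [phases_exist]: what the concentrated head contributes is
    subtracted from [z], and the rest is doubled because a Riesz factor has mean [t n / 2]. *)
Lemma fmean_sum P M (v : nat -> C) (z : C) : (forall n, (P <= n)%N -> t n = 0) -> (P <= M)%N -> (M1 <= M)%N ->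
  \sum_(n < P) t n * v n = 2 * (z - \sum_(n < M1) v n * (K%:R / K.+1%:R)%:C) ->
  \sum_(n < M) v n * fmean n = z.
Proof.
move=> tP PM M1M H.
have -> : \sum_(n < M) v n * fmean n = \sum_(n < M) (if (n < M1)%N then v n * (K%:R / K.+1%:R)%:C else 0) +
   (\sum_(n < M) t n * v n) / 2.
  rewrite mulr_suml -big_split /=; apply: eq_bigr => n _; rewrite /fmean.
  by move: (K%:R / K.+1%:R)%:C => q; case: ifP => _; by field.
have -> : \sum_(n < M) t n * v n = \sum_(n < P) t n * v n.
  rewrite -!(big_mkord xpredT (fun n => t n * v n)) (big_cat_nat (leq0n P) PM) /=.
  rewrite [X in _ + X]big_nat [X in _ + X]big1 ?addr0// => n /andP[Pn _].
  by rewrite tP// mul0r.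
rewrite H -(big_mkord xpredT (fun n => if (n < M1)%N then v n * (K%:R / K.+1%:R)%:C else 0)).
rewrite (big_cat_nat (leq0n M1) M1M) /= [X in _ + X + _]big_nat [X in _ + X + _]big1 ?addr0; last first.
  by move=> n /andP[M1n _]; rewrite ltnNge M1n.
rewrite big_nat (eq_bigr (fun n => v n * (K%:R / K.+1%:R)%:C)); last by move=> n /andP[_ ->].
by rewrite -big_nat big_mkord; field.
Qed.

(** In the head [1 - (K / (K + 1)) ^ 2 <= 2 / (K + 1)], small by the choice of [K]. In the tail the
    variance factor is bounded by 1 and the smallness comes from the convergent sum of
    [n ^ (- 2 sp)]. *)
Lemma variance_bound (sp Kc Bd : R) M2 M (v : nat -> C) : 1 / 2 < sp < 1 -> M1 = M2.+1 -> (0 < M2)%N ->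
  (M2 < M)%N -> 0 <= Bd -> 0 <= Kc ->
  (forall n, normC (v n) <= Bd) -> (forall n, (0 < n)%N -> normC (v n) <= Kc * rpw n%:R (- sp)) ->
  \sum_(n < M) normC (v n) ^+ 2 * (1 - normC (fmean n) ^+ 2) <=
  M1%:R * (Bd ^+ 2 * (2 / K.+1%:R)) + Kc ^+ 2 / (2 * sp - 1) * rpw M2%:R (- (2 * sp - 1)).
Proof.
move=> sp01 M1E M20 M2M Bd0 Kc0 vB vK.
have /andP[sp0 _] := sp01.
rewrite -(big_mkord xpredT (fun n => normC (v n) ^+ 2 * (1 - normC (fmean n) ^+ 2))).
rewrite (big_cat_nat (leq0n M1)) ?M1E//=; apply: lerD.
  have -> : M2.+1%:R * (Bd ^+ 2 * (2 / K.+1%:R)) = \sum_(0 <= n < M2.+1) Bd ^+ 2 * (2 / K.+1%:R).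
    by rewrite sumr_const_nat subn0 mulr_natl.
  rewrite !big_nat; apply: ler_sum => n /andP[_ nM].
  have -> : fmean n = (K%:R / K.+1%:R)%:C by rewrite /fmean M1E nM t0 ?mul0r ?addr0// M1E.
  have k1 : 0 < K.+1%:R :> R by rewrite ltr0n.
  have q0 : 0 <= K%:R / K.+1%:R :> R by rewrite divr_ge0.
  have q1 : K%:R / K.+1%:R = 1 - 1 / K.+1%:R :> R by rewrite -natr1; field; rewrite natr1 gt_eqF.
  rewrite normC_real (ger0_norm q0).
  apply: ler_pM; rewrite ?sqr_ge0//.
  - by rewrite subr_ge0 expr_le1// q1 gerBl divr_ge0.
  - by rewrite lerXn2r ?nnegrE ?normC_ge0.
  rewrite q1 (_ : 2 / K.+1%:R = 2 * (1 / K.+1%:R)); last by rewrite mul1r.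
  by move: (1 / K.+1%:R) => w; have := sqr_ge0 w; rewrite !expr2; lra.
have r0 : 0 < 2 * sp - 1 by lra.
rewrite [leRHS]mulrAC -[leRHS]mulrA.
apply: le_trans (ler_wpM2l (sqr_ge0 Kc) (sum_rpwN_tail M r0 M20)).
rewrite mulr_sumr !big_nat; apply: ler_sum => n /andP[nM _].
have n0 : (0 < n)%N by rewrite (leq_trans _ nM).
apply: (@le_trans _ _ (normC (v n) ^+ 2 * 1)).
  by rewrite ler_wpM2l ?sqr_ge0// gerBl sqr_ge0.
rewrite mulr1 (_ : - (1 + (2 * sp - 1)) = - sp * 2%:R); last by ring.
rewrite -rpwX -exprMn lerXn2r ?nnegrE ?normC_ge0//; last exact: vK.
by rewrite mulr_ge0// ltW// rpw_gt0.
Qed.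

End Family.

(** * Assembly *)

Section Assembly.
Variable R : realType.
Notation C := R[i].

(** By [(u + v) ^ 2 <= 2 * (u ^ 2 + v ^ 2)] the two random parts together stay below [eps / 2],
    which explains the threshold [eps ^+ 2 / 8]; the two deterministic parts take the other half. *)
Lemma close_of_squares (x y b f : C) (eps : R) : 0 < eps ->
  normC x ^+ 2 + normC y ^+ 2 < eps ^+ 2 / 8 -> normC b <= eps / 4 -> normC f <= eps / 4 ->
  normC (x + b + y + f) < eps.
Proof.
move=> e0 H hb hf.
have h0 : normC x + normC y < eps / 2.
  have hx := normC_ge0 x; have hy := normC_ge0 y; rewrite ltNge; apply/negP => h1.
  have h2 : (eps / 2) ^+ 2 <= (normC x + normC y) ^+ 2.
    by rewrite lerXn2r ?nnegrE ?addr_ge0// divr_ge0// ltW.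
  have := sqr_ge0 (normC x - normC y); move: H h2; rewrite !expr2; nra.
rewrite (le_lt_trans (normCD _ _))// (le_lt_trans (lerD (le_trans (normCD _ _) (lerD (normCD _ _) (lexx _))) (lexx _)))//.
lra.
Qed.

(** Everything at a single parameter [a]. The centre c acts only through the last hypothesis, which
    bounds the distance from the mean of the finite sum at [a] to the target. *)
Lemma positive_density (a sg eps sp Kc Bd q : R) (N K M M1 M2 : nat) (t : nat -> C) (W : R) (z : 'I_N.+1 -> C) :
  0 < a <= 1 -> 1 / 2 < sg < 1 -> 1 / 2 < sp < 1 -> 0 < eps -> (0 < K)%N -> M1 = M2.+1 -> (0 < M2)%N ->
  (M2 < M.+1)%N ->
  (forall n, normC (t n) <= 1) -> (forall n, (n < M1)%N -> t n = 0) ->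
  norel K.+1.*2 M.+1 a ->
  \prod_(n < M.+1) fbound K M1 t n <= W -> 0 < W ->
  0 <= Bd -> 0 <= Kc ->
  (forall (j : 'I_N.+1) n, normC (dcoef a sg j n) <= Bd) ->
  (forall (j : 'I_N.+1) n, (0 < n)%N -> normC (dcoef a sg j n) <= Kc * rpw n%:R (- sp)) ->
  0 < q -> q = eps ^+ 2 / 8 / 32 / N.+1%:R ->
  M1%:R * (Bd ^+ 2 * (2 / K.+1%:R)) <= q ->
  Kc ^+ 2 / (2 * sp - 1) * rpw M2%:R (- (2 * sp - 1)) <= q ->
  (exists2 T0 : R, 1 <= T0 & forall T b L (c : nat -> C), T0 <= T -> 0 < b <= 1 ->
    rpw T (1 + (sp - 1 / 2) / 2) <= L%:R <= 2 * rpw T (1 + (sp - 1 / 2) / 2) ->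
    (forall n, (0 < n)%N -> normC (c n) <= Kc * rpw n%:R (- sp)) ->
    Int T (2 * T) (fun tau => normC (\sum_(i < L) (if (M < i)%N then c i else 0) *
       osc (- ln (b + (i : nat)%:R)) tau) ^+ 2) <= q / W * T) ->
  (forall j : 'I_N.+1, normC (\sum_(n < M.+1) dcoef a sg j n * fmean K M1 t n - z j) <= eps / 4) ->
  (0 < limf_einf
               (fun T : R => (T^-1)%:E *
                  lebesgue_measure
                    ([set tau : R | 0 <= tau <= T /\
                       \big[Num.max/0]_(n < N.+1)
                         normC
                           (hurwitz_zeta_derive n a
                              (sg +i* tau) - z n) < eps]%R))
               +oo%R)%E.
Proof.
move=> a01 sg01 sp01 e0 K0 M1E M20 M2M t1 t0 nr Wb W0 Bd0 Kc0 cB cK q0 qE q1 q2 [T1 T11 T1P] bias.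
have /andP[a0 a1] := a01; have /andP[sg0 sg1] := sg01; have /andP[sp0 sp1] := sp01.
pose v (j : 'I_N.+1) (n : nat) := dcoef a sg j n.
pose B (n : 'I_M.+1) := fpoly K M1 t n; pose m (n : 'I_M.+1) := fmean K M1 t n.
have dB n : density K (B n) (m n) (fbound K M1 t n) by exact: fdensity.
have [T2 T21 T2P] := rwgt_mass nr dB (divr_gt0 (@ltr01 R) (ltr0n R 8)).
have := @eventually_all R N.+1 _ (fun j => second_moment nr dB (fun n => v j n) q0).
move=> [T3 T31 T3P].
have g01 : 1 < 1 + (sp - 1 / 2) / 2 < 2 by lra.
have e4 : 0 < eps / 4 by rewrite divr_gt0.
have [T4 T41 T4P] : exists2 T4 : R, 1 <= T4 & forall T, T4 <= T -> forall j : 'I_N.+1, forall tau (L : nat),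
    rpw T (1 + (sp - 1 / 2) / 2) <= L%:R <= 2 * rpw T (1 + (sp - 1 / 2) / 2) -> T <= tau <= 2 * T ->
    normC (iter j (@cD R) (fun u => Zh u (a + L%:R)) (sg +i* tau)) <= eps / 4.
  apply: eventually_all => j; have [T4 T41 H] := far_small j sg01 g01 e4.
  by exists T4 => // T TT tau L; exact: H.
pose T0 : R := 2 + M.+1%:R + T1 + T2 + T3 + T4.
(* An integral of at least [ka / 2 * T] with integrand at most [W * ka] forces measure at least
   [T / (2 * W)], and [S = 2 * T]. *)
apply: (@limf_einf_gt0 _ _ (1 / (4 * W)) (2 * T0)); first by rewrite divr_gt0 ?mulr_gt0.
move=> S TS; pose T := S / 2; have TE : S = 2 * T by rewrite /T; field.
have M0 : 0 <= M.+1%:R :> R by [].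
have TT : T0 <= T by rewrite /T; lra.
have [[h1 h2 h3 h4] h5 h6] : [/\ [/\ T1 <= T, T2 <= T, T3 <= T & T4 <= T], M.+1%:R < T & 1 < T].
  by move: TT; rewrite /T0 => TT; do ?split; lra.
have TP : 0 < T by lra.
have [L LP] := exists_length (T := T) (g := 1 + (sp - 1 / 2) / 2) ltac:(lra) (ltW h6).
have ML : (M < L)%N.
  have : (M.+1%:R <= L%:R :> R).
    have /andP[+ _] := LP; apply: le_trans; rewrite (le_trans (ltW h5))//.
    by rewrite -[leLHS](rpw1 TP) ler_rpw_exp ?(ltW h6)//; lra.
  by rewrite ler_nat.
pose w := rwgt K a B.
pose D (j : 'I_N.+1) tau := \sum_(n < M.+1) v j n * (osc (- ln (a + (n : nat)%:R)) tau - m n).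
pose E (j : 'I_N.+1) tau := \sum_(i < L) (if (M < i)%N then v j i else 0) * osc (- ln (a + (i : nat)%:R)) tau.
pose ka := eps ^+ 2 / 8.
have ka0 : 0 < ka by rewrite divr_gt0// exprn_gt0.
have N0 : 0 < N.+1%:R :> R by rewrite ltr0n.
(* Each [j] costs [3 * q] of weighted variance (head, tail and the error of [second_moment]) and [q]
   for the middle sum, so both totals stay below [ka / 8]. *)
have qka : N.+1%:R * q = ka / 32 by rewrite qE /ka; field.
have wW tau : 0 <= w tau <= W.
  by have [_ /andP[-> h]] := wgt_real a dB tau; rewrite (le_trans h).
have cD j x y : ccontab x y (D j).
  by apply: ccont_sum => n; apply: ccontZ; apply: ccontB; [exact: osc_cont|exact: ccont_cst].
have cE j x y : ccontab x y (E j).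
  by apply: ccont_sum => n; apply: ccontZ; exact: osc_cont.
have cw x y : contab x y w by exact: (@rwgt_cont R K M.+1 a B m _ dB x y).
have mass : ka / 2 * T <= Int T (2 * T) (fun tau => w tau * (ka - \sum_j (normC (D j tau) ^+ 2 + normC (E j tau) ^+ 2))).
  apply: (@weighted_mass _ _ _ W) => //; [exact: ltW|exact: ltW|exact: T2P|exact: ltW| |].
    apply: (@le_trans _ _ (\sum_(j < N.+1) T * (3 * q))).
      apply: ler_sum => j _; apply: (le_trans (T3P T h3 j)); rewrite ler_wpM2l ?(ltW TP)//.
      have := @variance_bound R K M1 t t0 sp Kc Bd M2 M.+1 (v j) sp01 M1E M20 M2M Bd0 Kc0 (cB j) (cK j).
      by move/(le_trans) => /(_ _ (lerD q1 q2)); rewrite -/(m _); lra.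
    rewrite sumr_const card_ord -[leLHS]mulr_natr (_ : T * (3 * q) * N.+1%:R = 3 * (N.+1%:R * q) * T); last by ring.
    by rewrite qka ler_wpM2r ?(ltW TP)//; lra.
  apply: (@le_trans _ _ (W * \sum_(j < N.+1) (q / W * T))).
    rewrite ler_wpM2l ?(ltW W0)//; apply: ler_sum => j _; apply: T1P => //; exact: cK.
  rewrite sumr_const card_ord -[q / W * T *+ _]mulr_natr.
  rewrite (_ : W * _ = N.+1%:R * q * T); last by field; exact: lt0r_neq0.
  by rewrite qka ler_wpM2r ?(ltW TP)//; lra.
set G := [set tau | _]; set g := (fun tau => _) in mass.
have cg x y : contab x y g.
  apply: contabM; first exact: cw.
  apply: contabD; first exact: contab_cst.
  apply: contabN; apply: contab_sum => j; apply: contabD.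
    apply: (@contab_eq _ _ _ (fun t => normC (D j t) * normC (D j t))); first by move=> u; rewrite expr2.
    by apply: contabM; exact: ccont_norm.
  apply: (@contab_eq _ _ _ (fun t => normC (E j t) * normC (E j t))); first by move=> u; rewrite expr2.
  by apply: contabM; exact: ccont_norm.
have S0 tau : 0 <= \sum_j (normC (D j tau) ^+ 2 + normC (E j tau) ^+ 2).
  by apply: sumr_ge0 => j _; rewrite addr_ge0 ?sqr_ge0.
have gW tau : g tau <= W * ka.
  have /andP[w0 w1] := wW tau; apply: (@le_trans _ _ (w tau * ka)).
    by rewrite ler_wpM2l// gerBl.
  by rewrite ler_wpM2r// ltW.
have gG tau : T <= tau <= 2 * T -> 0 < g tau -> G tau.
  move=> /andP[tT1 tT2] g0; split; first by rewrite TE tT2 andbT (le_trans (ltW TP)).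
  have sm : \sum_j (normC (D j tau) ^+ 2 + normC (E j tau) ^+ 2) < ka.
    rewrite -subr_gt0 ltNge; apply/negP => h; have /andP[w0 _] := wW tau.
    by have := mulr_ge0_le0 w0 h; rewrite leNgt g0.
  apply: bigmax_lt => // j _.
  have smj : normC (D j tau) ^+ 2 + normC (E j tau) ^+ 2 < eps ^+ 2 / 8.
    apply: le_lt_trans sm; rewrite (bigD1 j)//= lerDl sumr_ge0// => k _.
    by rewrite addr_ge0 ?sqr_ge0.
  have tT : T <= tau <= 2 * T by rewrite tT1.
  have far := T4P T h4 j tau L LP tT.
  have t1' : 1 < tau by exact: lt_le_trans h6 tT1.
  have sg01' : 0 < sg < 1 by apply/andP; split=> //; exact: lt_trans sg0.
  rewrite (hurwitz_split j a0 sg01' t1' ML).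
  move: far; set X := iter _ _ _ _ => far.
  (* The four summands are the deviation [D] from the mean, the bias of the mean, the middle sum [E]
     and the far part [X]. *)
  apply: le_lt_trans (close_of_squares e0 smj (bias j) far); rewrite le_eqVlt; apply/orP; left; apply/eqP.
  congr normC; rewrite /D; under [in RHS]eq_bigr do rewrite mulrBr.
  by rewrite sumrB /E /v /m; ring.
have WK : 0 < W * ka by exact: mulr_gt0.
have := Int_measure (cg T (2 * T)) WK (fun t _ => gW t) gG.
move=> Hm; rewrite lee_pdivlMl; last by rewrite TE mulr_gt0.
apply: le_trans Hm; rewrite -EFinM lee_fin TE ler_pdivlMr//.
apply: le_trans mass; rewrite le_eqVlt; apply/orP; left; apply/eqP; field.
exact: lt0r_neq0.
Qed.

End Assembly.

Theorem theorem1p5 (R : realType) (c : R) (hc : 0 < c < 1)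
    (sigma0 : R) (hsigma0 : 1 / 2 < sigma0 < 1)
    (N : nat) (z : 'I_N.+1 -> R[i]) (eps : R) (heps : 0 < eps) :
  exists (rho : R) (E : set R),
    [/\ 0 < rho, finite_set E, E `<=` @calA R &
      forall alpha : R, (calA_near c rho `\` E) alpha ->
        (0 < limf_einf
               (fun T : R => (T^-1)%:E *
                  lebesgue_measure
                    ([set tau : R | 0 <= tau <= T /\
                       \big[Num.max/0]_(n < N.+1)
                         ComplexField.Normc.normc
                           (hurwitz_zeta_derive n alpha
                              (sigma0 +i* tau) - z n) < eps]%R))
               +oo%R)%E].
Proof.
have /andP[c0 c1] := hc; have /andP[s0 s1] := hsigma0.
(* Below [sigma0], to absorb the logarithms, yet above 1/2, so that the sum of [n ^ (- 2 sp)]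
   converges. *)
pose sp := (sigma0 + 1 / 2) / 2.
have sp01 : 1 / 2 < sp < 1 by rewrite /sp; lra.
have /andP[sp0 sp1] := sp01.
have sps : 0 < sp < sigma0 by rewrite /sp; lra.
have s01 : 0 < sigma0 < 1 by lra.
have [Kc Kc0 KcP] := dcoef_bound N sps s1.
have c2 : 0 < c / 2 <= 1 by lra.
have sg0 : 0 < sigma0 by lra.
have [B0 B00 B0P] := dcoef_bound0 N sg0 c2.
pose Bd := Kc + B0; have Bd0 : 0 <= Bd by exact: addr_ge0.
pose q := eps ^+ 2 / 8 / 32 / N.+1%:R.
have q0 : 0 < q by rewrite !divr_gt0// exprn_gt0.
have r0 : 0 < 2 * sp - 1 by lra.
have [T1 T11 T1P] := rpw_vanish (Kc ^+ 2 / (2 * sp - 1)) r0 q0.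
pose M2 := (Num.truncn T1).+1; pose M1 := M2.+1.
have q2 : Kc ^+ 2 / (2 * sp - 1) * rpw M2%:R (- (2 * sp - 1)) <= q.
  by apply: T1P; rewrite ltW// truncnS_gt.
(* [K] follows [M1]: the total variance of the [M1] head phases, at most
   [M1 * Bd ^ 2 * 2 / (K + 1)], has to fall below [q]. *)
pose K := (Num.truncn (M1%:R * Bd ^+ 2 * 2 / q)).+1.
have q1 : M1%:R * (Bd ^+ 2 * (2 / K.+1%:R)) <= q.
  have k0 : 0 < K.+1%:R :> R by rewrite ltr0n.
  have -> : M1%:R * (Bd ^+ 2 * (2 / K.+1%:R)) = M1%:R * Bd ^+ 2 * 2 / K.+1%:R by rewrite -!mulrA.
  rewrite ler_pdivrMr// -ler_pdivrMl// [leLHS]mulrC (le_trans (ltW (truncnS_gt _)))//.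
  by rewrite ler_nat.
have [P0 [t [t1 tz tP]]] := phases_exist M1 (fun j : 'I_N.+1 =>
  2 * (z j - \sum_(n < M1) dcoef c sigma0 j n * (K%:R / K.+1%:R)%:C)) hc s01.
have t0 n : (n < M1)%N -> t n = 0 by move=> h; apply: tz; rewrite h.
have tP0 n : (P0 <= n)%N -> t n = 0 by move=> h; apply: tz; rewrite h orbT.
pose P := maxn M1 P0.
pose W := \prod_(n < P) fbound K M1 t n.
have W0 : 0 < W by apply: prodr_gt0 => n _; exact: fbound_gt0.
(* The accuracy is [q / W], because the unweighted mean square will be multiplied by [W]. *)
have [M0 M00 M0P] := middle_ms sp01 Kc0 (divr_gt0 q0 W0).
pose M := maxn M0 P.
have PM : (P <= M.+1)%N by rewrite leqW// leq_maxr.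
have M1M : (M1 <= M.+1)%N by rewrite (leq_trans _ PM)// leq_maxl.
have P0M : (P0 <= M.+1)%N by rewrite (leq_trans _ PM)// leq_maxr.
have mc (j : 'I_N.+1) : \sum_(n < M.+1) dcoef c sigma0 j n * fmean K M1 t n = z j.
  exact: (fmean_sum tP0 P0M M1M (tP j)).
have e4 : 0 < eps / 4 / M.+1%:R by rewrite !divr_gt0.
(* At c the mean of the finite sum is exactly [z j]. All [fmean] have modulus at most 1, so
   perturbing [M.+1] coefficients by [eps / 4 / M.+1] costs at most [eps / 4]. *)
have [rho rho0 rhoP] := dcoef_unif sigma0 N.+1 M.+1 c0 e4.
(* The cap [c / 2] keeps [a >= c / 2], the range in which [B0] bounds the term of index 0. *)
exists (Num.min rho (c / 2)), [set a : R | calA a /\ ~ norel K.+1.*2 M.+1 a]; split.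
- by rewrite lt_min rho0 divr_gt0.
- by apply: sub_finite_set (rel_finite R K.+1.*2 M.+1) => a [[/andP[a0 _] _ _] nr].
- by move=> a [].
move=> a [[Aa]]; rewrite le_min => /andP[ac ac2 /=] aE.
have [/andP[a0 a1] _ _] := Aa.
have nr : norel K.+1.*2 M.+1 a by apply: contrapT => h; apply: aE.
have a01 : 0 < a <= 1 by rewrite a0 ltW.
have ca : c / 2 <= a <= 1.
  by rewrite (ltW a1) andbT; move: ac2; rewrite ler_norml => /andP[]; lra.
have cK (j : 'I_N.+1) n : (0 < n)%N -> normC (dcoef a sigma0 j n) <= Kc * rpw n%:R (- sp).
  by move=> n0; apply: KcP => //; rewrite -ltnS.
have cB (j : 'I_N.+1) n : normC (dcoef a sigma0 j n) <= Bd.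
  case: n => [|n]; first by rewrite (le_trans (B0P a j ca _)) ?lerDr// -ltnS.
  rewrite (le_trans (cK j n.+1 isT))// (@le_trans _ _ Kc) ?lerDl// ler_piMr//.
  by rewrite -[leRHS](rpw0 n.+1%:R) ler_rpw_exp ?ler1n// oppr_le0 ltW//; case/andP: sps.
have bias (j : 'I_N.+1) : normC (\sum_(n < M.+1) dcoef a sigma0 j n * fmean K M1 t n - z j) <= eps / 4.
  rewrite -(mc j) -sumrB (le_trans (normC_sum _ _ _))//.
  have -> : eps / 4 = \sum_(n < M.+1) eps / 4 / M.+1%:R.
    by rewrite sumr_const card_ord -[RHS]mulr_natr mulfVK ?pnatr_eq0.
  apply: ler_sum => n _; rewrite -mulrBl normCM.
  have hm := fmean_le1 K t1 t0 n.
  rewrite (le_trans (ler_pM (normC_ge0 _) (normC_ge0 _) (ltW (rhoP a ac n j)) hm))//.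
  by rewrite mulr1.
apply: (@positive_density R a sigma0 eps sp Kc Bd q N K M M1 M2 t W z) => //.
- by rewrite /W (fbound_prod K (P := P))// ?leq_maxl// => n Pn; apply: tP0; rewrite (leq_trans _ Pn)// leq_maxr.
- by apply: M0P; rewrite leq_maxl.
Qed.
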